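(* Let $\mathcal{A}_N$ be the extended quantum Euclidean algebra and $\mathcal{A}_N\rtimes U_q^-so(N)$ its cross product with the negative Borel part of $U_qso(N)$ (both defined in the context). Put $$\lambda_0=\gamma_0\,\Lambda (x^0)^{-1}\ (N\text{ odd}),\qquad \lambda_{\pm1}=\gamma_{\pm1}\,\Lambda (x^{\pm1})^{-1}K^{\mp1}\ (N\text{ even}),\qquad \lambda_a=\gamma_a\,\Lambda\, r_{|a|}^{-1}r_{|a|-1}^{-1}x^{-a}\ \text{ otherwise},$$ where the $\gamma_a\in\mathbb{C}$ are any constants satisfying $$\gamma_0=-q^{-1/2}h^{-1}\ (N\text{ odd}),\qquad \gamma_1\gamma_{-1}=\begin{cases}-q^{-1}h^{-2}& N\text{ odd}\\ k^{-2}& N\text{ even}\end{cases},\qquad \gamma_a\gamma_{-a}=-q^{-1}k^{-2}\omega_a\omega_{a-1}\ \text{ for } a>1 .$$ Then there is an algebra homomorphism $\varphi^-:\mathcal{A}_N\rtimes U_q^-so(N)\to\mathcal{A}_N$ given on generators by $$\varphi^-(a)=a\quad(a\in\mathcal{A}_N),\qquad \varphi^-(\mathcal{L}^{-}{}^i_j)=g^{ih}\,\Lambda^{-1}[\lambda_h,x^k]\,g_{kj}.$$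
   Context: **Conventions.** $N\ge 3$; $q\in\mathbb{C}\setminus\{0\}$ is not a root of unity and a square root $q^{1/2}$ is fixed; $k=q-q^{-1}$, $h=q^{1/2}-q^{-1/2}$. $n=(N-1)/2$ for $N$ odd, $n=N/2$ for $N$ even. Indices run over $-n,\dots,n$, with $0$ omitted when $N$ is even; repeated upper/lower indices are summed. $\rho_{\mp i}=\pm(i-\tfrac12)$ for $i>0$ and $\rho_0=0$ ($N$ odd); $\rho_{\mp i}=\pm(i-1)$ for $i>0$ ($N$ even). $\omega_i=q^{\rho_i}+q^{-\rho_i}$. $g_{ij}=g^{ij}=q^{-\rho_i}\delta_{i,-j}$. **Braid matrix.** With $E_{ij}$ the $N\times N$ matrix unit (1 in row $i$, column $j$) and $(A\otimes B)^{ij}_{kl}=A_{ik}B_{jl}$, $$\hat R=q\sum_{i\ne0}E_{ii}\otimes E_{ii}+\sum_{i\neq\pm j\text{ or }i=j=0}E_{ij}\otimes E_{ji}+q^{-1}\sum_{i\neq0}E_{i,-i}\otimes E_{-i,i}+k\Big(\sum_{i<j}E_{ii}\otimes E_{jj}-\sum_{i<j}q^{-\rho_i+\rho_j}E_{i,-j}\otimes E_{-i,j}\Big).$$ **The algebra $\mathcal{A}_N$.** Unital associative algebra generated by $x^i$, $r_j^{\pm1}$ ($0\le j\le n$ for $N$ odd, $1\le j\le n$ for $N$ even), $\Lambda^{\pm1}$ and, for $N$ even only, $K^{\pm1}$, with relations: $x^ix^j=qx^jx^i$ for $i<j$, $i\ne-j$; $[x^i,x^{-i}]=k\,\omega_{i-1}^{-1}r_{i-1}^2$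 for $i>1$; $[x^1,x^{-1}]=0$ ($N$ even), $=h\,r_0^2$ ($N$ odd); $r_i^2=\sum_{k,l=-i}^{i}g_{kl}x^kx^l$, and $r_0=x^0$ for $N$ odd; $x^jr_i=r_ix^j$ for $|j|\le i$, $x^jr_i=q\,r_ix^j$ for $j<-i$, $x^jr_i=q^{-1}r_ix^j$ for $j>i$; $r_ir_j=r_jr_i$; $x^i\Lambda=q\Lambda x^i$, $r_i\Lambda=q\Lambda r_i$; and for $N$ even $Kx^{\pm1}=q^{\pm1}x^{\pm1}K$, $Kx^{\pm i}=x^{\pm i}K$ ($i>1$), $Kr_i=r_iK$, $K\Lambda=\Lambda K$. (For $N$ even $x^{\pm1}$ is invertible, since $r_1^2=2x^{1}x^{-1}$.) **$U_q^-so(N)$** is the algebra generated by $\mathcal{L}^-{}^i_j$ with relations $\mathcal{L}^-{}^i_j=0$ for $i<j$; $\mathcal{L}^-{}^{-n}_{-n}\cdots\mathcal{L}^-{}^{n}_{n}=1$; $\mathcal{L}^-{}^i_j\mathcal{L}^-{}^h_kg^{kj}=g^{hi}$, $\mathcal{L}^-{}^j_i\mathcal{L}^-{}^k_hg_{kj}=g_{hi}$; $\hat R^{ab}_{cd}\mathcal{L}^-{}^d_f\mathcal{L}^-{}^c_e=\mathcal{L}^-{}^b_c\mathcal{L}^-{}^a_d\hat R^{dc}_{ef}$. **Cross product.** $\mathcal{A}_N\rtimes U_q^-so(N)$ is the algebra generated by $\mathcal{A}_N$ and $U_q^-so(N)$ with the cross relations $x^i\mathcal{L}^-{}^a_b=\mathcal{L}^-{}^a_c\,x^j\,(\hat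 R^{-1})^{ci}_{jb}$ and $\Lambda\mathcal{L}^-{}^a_b=\mathcal{L}^-{}^a_b\Lambda$. *)

(* Defs.v *)
From HB Require Import structures.
From mathcomp Require Import all_boot all_order all_algebra.
From mathcomp Require Import generic_quotient.
From mathcomp Require Import boolp classical_sets reals.
From mathcomp Require Import complex mxtens monalg.

Set Implicit Arguments.
Unset Strict Implicit.
Unset Printing Implicit Defensive.

Import Order.TTheory GRing.Theory Num.Theory.

Local Open Scope ring_scope.
Local Open Scope quotient_scope.

(** * Unital associative algebras presented by generators and relations

   [presented rel] is the free associative algebra on [G] modulo the two-sided
   ideal generated by all [u - v] with [rel u v].  Since nothing guarantees
   [1 != 0] in such a quotient, it carries the structures [pzRingType] and
   [lmodType K], with the compatibility lemmas [presented_scalerAl] and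
   [presented_scalerAr], rather than [algType K].  An algebra homomorphism is
   accordingly a scalable [{rmorphism _ -> _}]. *)

Notation free_alg K G := {malg K[{fmonom G}]}.

Section Presented.
Variables (K : comNzRingType) (G : choiceType).
Variable rel : free_alg K G -> free_alg K G -> Prop.

Definition free_gen (g : G) : free_alg K G := mkmalgU (fmu g) 1.

Inductive in_ideal : free_alg K G -> Prop :=
| in_ideal_gen a u v b : rel u v -> in_ideal (a * (u - v) * b)
| in_ideal0 : in_ideal 0
| in_idealD x y : in_ideal x -> in_ideal y -> in_ideal (x + y).

Lemma in_idealMl c x : in_ideal x -> in_ideal (c * x).
Proof.
elim=> [a u v b uv||y z _ Iy _ Iz]; last by rewrite mulrDr; apply: in_idealD.
  by rewrite !mulrA -(mulrA _ _ b) mulrA; apply: in_ideal_gen.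
by rewrite mulr0; apply: in_ideal0.
Qed.

Lemma in_idealMr c x : in_ideal x -> in_ideal (x * c).
Proof.
elim=> [a u v b uv||y z _ Iy _ Iz]; last by rewrite mulrDl; apply: in_idealD.
  by rewrite -(mulrA _ b); apply: in_ideal_gen.
by rewrite mul0r; apply: in_ideal0.
Qed.

Lemma in_idealN x : in_ideal x -> in_ideal (- x).
Proof. by rewrite -mulN1r; apply: in_idealMl. Qed.

Definition ideal_eq (x y : free_alg K G) : bool := `[< in_ideal (x - y) >].

Lemma ideal_eq_equiv : equiv_class_of ideal_eq.
Proof.
split=> [x|x y|y x z].
- by apply/asboolP; rewrite subrr; apply: in_ideal0.
- by apply/asboolP/asboolP => /in_idealN; rewrite opprB.
- move=> /asboolP xy /asboolP yz; apply/asboolP.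
  by rewrite -(subrKA y); apply: in_idealD.
Qed.

Canonical ideal_eq_equivRel := EquivRelPack ideal_eq_equiv.

Definition presented := {eq_quot ideal_eq}.

HB.instance Definition _ := Choice.on presented.
HB.instance Definition _ := EqQuotient.on presented.

Lemma presentedP (x y : free_alg K G) :
  reflect (in_ideal (x - y)) (\pi_presented x == \pi_presented y).
Proof. by rewrite eqquotE; apply: asboolP. Qed.

Let repr_in_ideal (x : free_alg K G) :
  in_ideal (x - repr (\pi_presented x)).
Proof. by apply/presentedP; rewrite reprK. Qed.

Definition presented_zero := lift_cst presented 0.
Definition presented_one := lift_cst presented 1.
Definition presented_opp := lift_op1 presented -%R.
Definition presented_add := lift_op2 presented +%R.
Definition presented_mul := lift_op2 presented *%R.
Definition presented_scale c := lift_op1 presented (fun x => c *: x).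

Canonical pi_presented_zero := PiConst presented_zero.
Canonical pi_presented_one := PiConst presented_one.

Lemma pi_presented_oppr : {morph \pi : x / - x >-> presented_opp x}.
Proof.
move=> x; unlock presented_opp; apply/eqP/presentedP.
by rewrite -opprD; apply: in_idealN; apply: repr_in_ideal.
Qed.
Canonical pi_presented_opp_morph := PiMorph1 pi_presented_oppr.

Lemma pi_presented_addr :
  {morph \pi : x y / x + y >-> presented_add x y}.
Proof.
move=> x y; unlock presented_add; apply/eqP/presentedP.
by rewrite opprD addrACA; apply: in_idealD; apply: repr_in_ideal.
Qed.
Canonical pi_presented_add_morph := PiMorph2 pi_presented_addr.

Lemma pi_presented_mulr :
  {morph \pi : x y / x * y >-> presented_mul x y}.
Proof.
move=> x y; unlock presented_mul; apply/eqP/presentedP.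
rewrite -(subrKA (repr (\pi_presented x) * y)) -mulrBl -mulrBr.
apply: in_idealD; first exact/in_idealMr/repr_in_ideal.
exact/in_idealMl/repr_in_ideal.
Qed.
Canonical pi_presented_mul_morph := PiMorph2 pi_presented_mulr.

Lemma pi_presented_scale c :
  {morph \pi : x / c *: x >-> presented_scale c x}.
Proof.
move=> x; unlock presented_scale; apply/eqP/presentedP.
by rewrite -scalerBr -mul_malgC; apply/in_idealMl/repr_in_ideal.
Qed.
Canonical pi_presented_scale_morph c := PiMorph1 (pi_presented_scale c).

Lemma presented_addA : associative presented_add.
Proof. by move=> x y z; rewrite -[x]reprK -[y]reprK -[z]reprK !piE addrA. Qed.

Lemma presented_addC : commutative presented_add.
Proof. by move=> x y; rewrite -[x]reprK -[y]reprK !piE addrC. Qed.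

Lemma presented_add0 : left_id presented_zero presented_add.
Proof. by move=> x; rewrite -[x]reprK !piE add0r. Qed.

Lemma presented_addN : left_inverse presented_zero presented_opp presented_add.
Proof. by move=> x; rewrite -[x]reprK !piE addNr. Qed.

HB.instance Definition _ := GRing.isZmodule.Build presented
  presented_addA presented_addC presented_add0 presented_addN.

Lemma presented_mulA : associative presented_mul.
Proof. by move=> x y z; rewrite -[x]reprK -[y]reprK -[z]reprK !piE mulrA. Qed.

Lemma presented_mul1 : left_id presented_one presented_mul.
Proof. by move=> x; rewrite -[x]reprK !piE mul1r. Qed.

Lemma presented_mulr1 : right_id presented_one presented_mul.
Proof. by move=> x; rewrite -[x]reprK !piE mulr1. Qed.

Lemma presented_mulDl : left_distributive presented_mul presented_add.
Proof. by move=> x y z; rewrite -[x]reprK -[y]reprK -[z]reprK !piE mulrDl. Qed.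

Lemma presented_mulDr : right_distributive presented_mul presented_add.
Proof. by move=> x y z; rewrite -[x]reprK -[y]reprK -[z]reprK !piE mulrDr. Qed.

HB.instance Definition _ := GRing.Zmodule_isPzRing.Build presented
  presented_mulA presented_mul1 presented_mulr1 presented_mulDl presented_mulDr.

Lemma presented_scaleA c d x :
  presented_scale c (presented_scale d x) = presented_scale (c * d) x.
Proof. by rewrite -[x]reprK !piE scalerA. Qed.

Lemma presented_scale1 : left_id 1 presented_scale.
Proof. by move=> x; rewrite -[x]reprK !piE scale1r. Qed.

Lemma presented_scaleDr : right_distributive presented_scale +%R.
Proof. by move=> c x y; rewrite -[x]reprK -[y]reprK !piE scalerDr. Qed.

Lemma presented_scaleDl x : {morph presented_scale^~ x : c d / c + d}.
Proof. by move=> c d; rewrite -[x]reprK !piE scalerDl. Qed.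

HB.instance Definition _ := GRing.Zmodule_isLmodule.Build K presented
  presented_scaleA presented_scale1 presented_scaleDr presented_scaleDl.

Definition proj (x : free_alg K G) : presented := \pi_presented x.

Lemma proj_is_zmod_morphism : zmod_morphism proj.
Proof. by move=> x y; rewrite /proj !piE. Qed.

HB.instance Definition _ :=
  GRing.isZmodMorphism.Build (free_alg K G) presented proj
    proj_is_zmod_morphism.

Lemma proj_is_monoid_morphism : monoid_morphism proj.
Proof. by split=> [|x y]; rewrite /proj !piE. Qed.

HB.instance Definition _ :=
  GRing.isMonoidMorphism.Build (free_alg K G) presented proj
    proj_is_monoid_morphism.

Lemma proj_is_scalable : scalable proj.
Proof. by move=> c x; rewrite /proj pi_presented_scale. Qed.

HB.instance Definition _ :=
  GRing.isScalable.Build K (free_alg K G) presented *:%R proj proj_is_scalable.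

Lemma projP (x y : free_alg K G) : proj x = proj y <-> in_ideal (x - y).
Proof. by split=> [/eqP/presentedP|xy] //; apply/eqP/presentedP. Qed.

Lemma proj_surj (a : presented) : exists x, proj x = a.
Proof. by exists (repr a); rewrite /proj reprK. Qed.

Lemma presented_scalerAl (c : K) (a b : presented) : c *: (a * b) = c *: a * b.
Proof.
have [[x <-] [y <-]] := (proj_surj a, proj_surj b).
by rewrite -rmorphM -!linearZ -rmorphM scalerAl.
Qed.

Lemma presented_scalerAr (c : K) (a b : presented) : c *: (a * b) = a * (c *: b).
Proof.
have [[x <-] [y <-]] := (proj_surj a, proj_surj b).
rewrite -rmorphM -!linearZ -rmorphM; congr proj.
suff cC (z : free_alg K G) : malgC c * z = z * malgC c.
  by rewrite -!mul_malgC mulrA cC mulrA.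
rewrite [z]monalgE mulr_sumr mulr_suml; apply: eq_bigr => m _.
by rewrite !malgM_def !fgmulUU mul1m mulm1 mulrC.
Qed.

End Presented.

Arguments free_gen {K G} g.
Arguments proj {K G} rel x.

(* The two-sided inverse of [a], if there is one. *)
Definition ring_inv (A : pzRingType) (a : A) : A :=
  xget 0 [set b | a * b = 1 /\ b * a = 1]%classic.

(** * Indices, metric and braid matrix *)

(* The position [i : 'I_N] stands for the index [label i], which ranges over
   -n, ..., n without 0 when [N] is even; the order on positions is the order
   on indices, and [rev_ord] is the change of sign. *)
Definition label (N : nat) (i : 'I_N) : int :=
  if odd N || (i < N./2)%N then i%:Z - N./2%:Z else i%:Z - N./2%:Z + 1.

(* Twice [rho m], so that [q ^ rho m] is [s ^ rho2 N m] with [s ^+ 2 = q]. *)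
Definition rho2 (N : nat) (m : int) : int :=
  - sgz m * (2 * `|m| - (if odd N then 1 else 2)).

Section Matrices.
Variables (F : fieldType) (N : nat) (s : F).

Definition qq : F := s ^+ 2.
Definition kk : F := qq - qq^-1.
Definition hh : F := s - s^-1.

Definition qrho (m : int) : F := s ^ rho2 N m.
Definition omega (m : int) : F := qrho m + (qrho m)^-1.

(* Both [g_ij] and [g^ij]. *)
Definition metric (i j : 'I_N) : F :=
  if j == rev_ord i then (qrho (label i))^-1 else 0.

Definition E (i j : 'I_N) : 'M[F]_N := delta_mx i j.

Definition Rmx : 'M[F]_(N * N) :=
  qq *: (\sum_(i | label i != 0) E i i *t E i i)
  + \sum_i \sum_(j | (i != j) && (i != rev_ord j) || (i == j) && (label i == 0))
      E i j *t E j i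
  + qq^-1 *: (\sum_(i | label i != 0) E i (rev_ord i) *t E (rev_ord i) i)
  + kk *: (\sum_(i < N) \sum_(j < N | (i < j)%N) E i i *t E j j
           - \sum_(i < N) \sum_(j < N | (i < j)%N)
               ((qrho (label i))^-1 * qrho (label j)) *:
                 (E i (rev_ord j) *t E (rev_ord i) j)).

(* The entry [M^{ab}_{cd}] of a matrix acting on the tensor square. *)
Definition entry (M : 'M[F]_(N * N)) (a b c d : 'I_N) : F :=
  M (mxtens_index (a, b)) (mxtens_index (c, d)).

Definition Rhat := entry Rmx.
Definition Rhat_inv := entry (invmx Rmx).

End Matrices.

(** * The extended quantum Euclidean algebra *)

Definition radius_range (N : nat) (j : nat) : bool :=
  (j <= N./2)%N && (odd N || (0 < j)%N).

(* The boolean argument of [GR], [GLam] and [GK] is [true] for the formal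
   inverse; [GK] requires a proof that [N] is even. *)
Inductive qea_gen (N : nat) : Type :=
| GX of 'I_N
| GR of {j : nat | radius_range N j} & bool
| GLam of bool
| GK of ~~ odd N & bool.

HB.instance Definition _ (N : nat) := gen_eqMixin (qea_gen N).
HB.instance Definition _ (N : nat) := gen_choiceMixin (qea_gen N).

Section QuantumEuclideanAlgebra.
Variables (F : fieldType) (N : nat) (s : F).

Local Notation n := N./2.
Local Notation q := (qq s).
Local Notation k := (kk s).
Local Notation h := (hh s).
Local Notation free := (free_alg F (qea_gen N)).

Definition fX (i : 'I_N) : free := free_gen (GX i).
Definition fLam (inv : bool) : free := free_gen (GLam N inv).

(* [fR] and [fK] take the value 0 where there is no such generator. *)
Definition fR (j : nat) (inv : bool) : free :=
  if insub j is Some j' then free_gen (GR j' inv) else 0.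
Definition fK (inv : bool) : free :=
  if @idP (~~ odd N) is ReflectT evenN then free_gen (GK evenN inv) else 0.

Inductive qea_rel : free -> free -> Prop :=
| qea_Rinv j inv of radius_range N j :
    qea_rel (fR j inv * fR j (~~ inv)) 1
| qea_Laminv inv : qea_rel (fLam inv * fLam (~~ inv)) 1
| qea_Kinv inv of ~~ odd N : qea_rel (fK inv * fK (~~ inv)) 1
| qea_XX (i j : 'I_N) of (i < j)%N & i != rev_ord j :
    qea_rel (fX i * fX j) (q *: (fX j * fX i))
| qea_XXopp (i : 'I_N) of 1 < label i :
    qea_rel (fX i * fX (rev_ord i) - fX (rev_ord i) * fX i)
      ((k * (omega N s (label i - 1))^-1) *: fR `|label i - 1|%N false ^+ 2)
| qea_XXopp1 (i : 'I_N) of label i = 1 :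
    qea_rel (fX i * fX (rev_ord i) - fX (rev_ord i) * fX i)
      (if odd N then h *: fR 0 false ^+ 2 else 0)
| qea_Rsqr (j : nat) of radius_range N j :
    qea_rel (fR j false ^+ 2)
      (\sum_(a : 'I_N | (`|label a| <= j)%N)
         \sum_(b : 'I_N | (`|label b| <= j)%N)
            metric s a b *: (fX a * fX b))
| qea_R0 (i : 'I_N) of label i = 0 : qea_rel (fR 0 false) (fX i)
| qea_XRin (i : 'I_N) (j : nat) of radius_range N j & (`|label i| <= j)%N :
    qea_rel (fX i * fR j false) (fR j false * fX i)
| qea_XRlow (i : 'I_N) (j : nat) of radius_range N j & label i < - j%:Z :
    qea_rel (fX i * fR j false) (q *: (fR j false * fX i))
| qea_XRhigh (i : 'I_N) (j : nat) of radius_range N j & j%:Z < label i :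
    qea_rel (fX i * fR j false) (q^-1 *: (fR j false * fX i))
| qea_RR (i j : nat) of radius_range N i & radius_range N j :
    qea_rel (fR i false * fR j false) (fR j false * fR i false)
| qea_XLam (i : 'I_N) : qea_rel (fX i * fLam false) (q *: (fLam false * fX i))
| qea_RLam (j : nat) of radius_range N j :
    qea_rel (fR j false * fLam false) (q *: (fLam false * fR j false))
| qea_KX1 (i : 'I_N) of ~~ odd N & label i = 1 :
    qea_rel (fK false * fX i) (q *: (fX i * fK false))
| qea_KXN1 (i : 'I_N) of ~~ odd N & label i = -1 :
    qea_rel (fK false * fX i) (q^-1 *: (fX i * fK false))
| qea_KX (i : 'I_N) of ~~ odd N & (1 < `|label i|)%N :
    qea_rel (fK false * fX i) (fX i * fK false)
| qea_KR (j : nat) of ~~ odd N & radius_range N j :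
    qea_rel (fK false * fR j false) (fR j false * fK false)
| qea_KLam of ~~ odd N :
    qea_rel (fK false * fLam false) (fLam false * fK false).

Definition qea := presented qea_rel.

HB.instance Definition _ := GRing.PzRing.on qea.
HB.instance Definition _ := GRing.Lmodule.on qea.

Definition xx (i : 'I_N) : qea := proj qea_rel (fX i).
Definition rr (j : nat) : qea := proj qea_rel (fR j false).
Definition rr_inv (j : nat) : qea := proj qea_rel (fR j true).
Definition Lam : qea := proj qea_rel (fLam false).
Definition Lam_inv : qea := proj qea_rel (fLam true).
Definition KK : qea := proj qea_rel (fK false).
Definition KK_inv : qea := proj qea_rel (fK true).

End QuantumEuclideanAlgebra.

(** * The negative Borel part of [U_q so(N)] *)

Section BorelPart.
Variables (F : fieldType) (N : nat) (s : F).

Local Notation free := (free_alg F ('I_N * 'I_N)%type).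

(* [fL i j] is the generator with upper index [i] and lower index [j]. *)
Definition fL (i j : 'I_N) : free := free_gen (i, j).

Inductive uqso_rel : free -> free -> Prop :=
| uqso_tri (i j : 'I_N) of (i < j)%N : uqso_rel (fL i j) 0
| uqso_diag : uqso_rel (\prod_(i < N) fL i i) 1
| uqso_metric_up (i l : 'I_N) :
    uqso_rel (\sum_j \sum_m metric s m j *: (fL i j * fL l m))
             (metric s l i)%:A
| uqso_metric_down (i l : 'I_N) :
    uqso_rel (\sum_j \sum_m metric s m j *: (fL j i * fL m l))
             (metric s l i)%:A
| uqso_RLL (a b e f : 'I_N) :
    uqso_rel (\sum_c \sum_d Rhat s a b c d *: (fL d f * fL c e))
             (\sum_c \sum_d Rhat s d c e f *: (fL b c * fL a d)).

Definition uqso := presented uqso_rel.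

HB.instance Definition _ := GRing.PzRing.on uqso.
HB.instance Definition _ := GRing.Lmodule.on uqso.

Definition LL (i j : 'I_N) : uqso := proj uqso_rel (fL i j).

End BorelPart.

(** * The cross product

   The algebra generated by [qea N s] and [uqso N s]: it is presented with one
   generator for each element of either algebra; the relations
   [cross_qea*] and [cross_uqso*] make the two inclusions of generators
   algebra homomorphisms. *)

Section CrossProduct.
Variables (F : fieldType) (N : nat) (s : F).

Local Notation A := (qea N s).
Local Notation U := (uqso N s).
Local Notation free := (free_alg F (A + U)%type).

Definition fA (a : A) : free := free_gen (inl a).
Definition fU (u : U) : free := free_gen (inr u).

Inductive cross_rel : free -> free -> Prop :=
| cross_qeaD (a b : A) : cross_rel (fA (a + b)) (fA a + fA b)
| cross_qeaZ (c : F) (a : A) : cross_rel (fA (c *: a)) (c *: fA a)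
| cross_qeaM (a b : A) : cross_rel (fA (a * b)) (fA a * fA b)
| cross_qea1 : cross_rel (fA 1) 1
| cross_uqsoD (u v : U) : cross_rel (fU (u + v)) (fU u + fU v)
| cross_uqsoZ (c : F) (u : U) : cross_rel (fU (c *: u)) (c *: fU u)
| cross_uqsoM (u v : U) : cross_rel (fU (u * v)) (fU u * fU v)
| cross_uqso1 : cross_rel (fU 1) 1
| cross_XL (i a b : 'I_N) :
    cross_rel (fA (xx s i) * fU (LL s a b))
      (\sum_c \sum_j Rhat_inv s c i j b *: (fU (LL s a c) * fA (xx s j)))
| cross_LamL (a b : 'I_N) :
    cross_rel (fA (Lam N s) * fU (LL s a b)) (fU (LL s a b) * fA (Lam N s)).

Definition cross := presented cross_rel.

HB.instance Definition _ := GRing.PzRing.on cross.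
HB.instance Definition _ := GRing.Lmodule.on cross.

Definition of_qea (a : A) : cross := proj cross_rel (fA a).
Definition of_uqso (u : U) : cross := proj cross_rel (fU u).

End CrossProduct.

(** * The elements [lambda_a] *)

Section Lambda.
Variables (F : fieldType) (N : nat) (s : F) (gamma : 'I_N -> F).

Definition lambda (a : 'I_N) : qea N s :=
  gamma a *:
    (if label a == 0 then Lam N s * ring_inv (xx s a)
     else if ~~ odd N && (label a == 1) then
       Lam N s * ring_inv (xx s a) * KK_inv N s
     else if ~~ odd N && (label a == -1) then
       Lam N s * ring_inv (xx s a) * KK N s
     else
       Lam N s * rr_inv N s `|label a|%N * rr_inv N s `|label a|%N.-1
         * xx s (rev_ord a)).

End Lambda.

(* Main.v *)
(* Put [z_h = Lambda^-1 lambda_h]; then [M_h^k := Lambda^-1 [lambda_h, x^k]] equals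
   [z_h x^k - q x^k z_h], and the image of [L^i_j] is a rescaling of
   [M_(-i)^(-j)].  Everything follows from the relation
     [x^i M_h^k = sum_(m, j) R^(ik)_(mj) M_h^m x^j],
   which up to crossing symmetry is the cross relation, and from its counterpart
   in the opposite algebra, where [x] and [z] exchange roles.  Writing one factor
   of a product of two [M] as [z x - q x z] and moving [x] and [z] past the other
   factor gives the RLL relation; the metric relations then come from the
   telescoping sum of the [q^(-rho_j) M_h^j x^(-j)].

   The displayed relation rests on two facts.  The products [x^i x^(-i)] are
   increments of potentials, which are multiples of the [r_a^2 / omega_a], and
   [z_h] is a multiple of [D_h V x^(-h)], where [V] is the inverse of a potential
   and the diagonal entry [D_h] commutes with the [x^i] up to powers of [q].  In
   this form the [z_h] satisfy, in the opposite algebra, the same relations as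
   the [x^h]. *)

Require Import Defs.
From HB Require Import structures.
From mathcomp Require Import all_boot all_order all_algebra finmap.
From mathcomp Require Import boolp reals complex.
From mathcomp Require Import generic_quotient classical_sets monalg perm mxtens.
From mathcomp Require Import zify ring.

Set Implicit Arguments.
Unset Strict Implicit.
Unset Printing Implicit Defensive.

Import Order.TTheory GRing.Theory Num.Theory.

Local Open Scope ring_scope.

(** * Homomorphisms out of presented algebras *)

(** The product conditions on [gamma] say that the diagonal entries D_h and D_(-h) are inverse to
    each other; [gamma0] makes the middle one equal to 1. Away from k = h, M_h^k is either 0 or a
    multiple of z_h x^k, because z_h q-commutes with x^k; so M_h^h = D_h is the only entry that
    needs separate commutation rules.

    The duality of x and z rests on one identity: if V_p inverts U_p, then V_i V_(i+1) (U_(i+1) - q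
    U_i) = V_i - q V_(i+1), so reciprocals of potentials are again potentials, up to a constant. The
    right-hand side of the metric relations is then the product of an end value of one potential
    with the opposite end value of the other.

    The obstacle is the middle of the index range. For odd N one index is its own opposite, and s +
    s^-1 must stand in for omega_0. For even N the middle potential is 0 and has no inverse, so the
    two middle indices share the next gap and [K] replaces the missing ratio of radii. That q is not
    a root of unity serves to divide by k and by the omega_a. *)

Section UniversalProperty.
Local Open Scope quotient_scope.
Variables (K : comNzRingType) (G H : choiceType).
Variables (rel : free_alg K G -> free_alg K G -> Prop).
Variables (rel' : free_alg K H -> free_alg K H -> Prop).
Variable g : G -> presented rel'.

Definition eval_monom (m : {fmonom G}) : presented rel' := \prod_(i <- m) g i.

Definition eval_free (x : free_alg K G) : presented rel' :=
  \sum_(m <- msupp x) x@_m *: eval_monom m.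

Lemma eval_freeEw (d : {fset {fmonom G}}) x : (msupp x `<=` d)%fset ->
  eval_free x = \sum_(m <- d) x@_m *: eval_monom m.
Proof.
move=> le; rewrite /eval_free (big_fset_incl _ le) //= => m _ /mcoeff_outdom ->.
by rewrite scale0r.
Qed.

Lemma eval_freeU c m : eval_free << c *g m >> = c *: eval_monom m.
Proof. by rewrite (eval_freeEw msuppU_le) big_seq_fset1 mcoeffUU. Qed.

Lemma eval_free_is_zmod_morphism : zmod_morphism eval_free.
Proof.
move=> x y; rewrite (@eval_freeEw (msupp x `|` msupp y)%fset _ (msuppB_le _ _)).
rewrite (eval_freeEw (fsubsetUl (msupp x) (msupp y))).
rewrite (eval_freeEw (fsubsetUr (msupp x) (msupp y))).
by rewrite -sumrB; apply: eq_bigr => m _; rewrite mcoeffB scalerBl.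
Qed.

HB.instance Definition _ := GRing.isZmodMorphism.Build
  (free_alg K G) (presented rel') eval_free eval_free_is_zmod_morphism.

Lemma eval_free_is_scalable : scalable eval_free.
Proof.
move=> c x; rewrite (eval_freeEw (msuppZ_le _ _)) scaler_sumr.
by apply: eq_bigr => m _; rewrite mcoeffZ scalerA.
Qed.

HB.instance Definition _ := GRing.isScalable.Build
  K (free_alg K G) (presented rel') *:%R eval_free eval_free_is_scalable.

Lemma eval_free_is_monoid_morphism : monoid_morphism eval_free.
Proof.
split=> [|x y].
  by rewrite eval_freeU scale1r /eval_monom fm1 big_nil.
rewrite malgME raddf_sum mulr_suml /=; apply: eq_bigr => m _.
rewrite raddf_sum mulr_sumr /=; apply: eq_bigr => m' _.
rewrite eval_freeU -presented_scalerAl -presented_scalerAr scalerA.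
by rewrite /eval_monom fmM big_cat.
Qed.

HB.instance Definition _ := GRing.isMonoidMorphism.Build
  (free_alg K G) (presented rel') eval_free eval_free_is_monoid_morphism.

Lemma eval_free_gen i : eval_free (free_gen i) = g i.
Proof. by rewrite eval_freeU scale1r /eval_monom fmU big_seq1. Qed.

Hypothesis g_rel : forall u v, rel u v -> eval_free u = eval_free v.

Definition presented_lift (a : presented rel) : presented rel' :=
  eval_free (repr a).

(** The elements killed by [eval_free] are closed under sums and under products on both sides, so
    they contain the whole ideal once they contain the defining differences. The value at [repr] is
    therefore the value at any representative. *)
Lemma presented_liftE x : presented_lift (proj rel x) = eval_free x.
Proof.
have ideal0 z : in_ideal rel z -> eval_free z = 0.
  elim=> [a u v b uv||y y' _ e _ e']; first 1 last.
  - exact: raddf0.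
  - by rewrite raddfD /= e e' addr0.
  by rewrite !rmorphM raddfB /= (g_rel uv) subrr mulr0 mul0r.
apply/eqP; rewrite -subr_eq0 -raddfB; apply/eqP/ideal0/projP.
by rewrite /proj reprK.
Qed.

Lemma presented_lift_is_zmod_morphism : zmod_morphism presented_lift.
Proof.
move=> a b; have [[x <-] [y <-]] := (proj_surj a, proj_surj b).
by rewrite -raddfB !presented_liftE raddfB.
Qed.

HB.instance Definition _ := GRing.isZmodMorphism.Build
  (presented rel) (presented rel') presented_lift
  presented_lift_is_zmod_morphism.

Lemma presented_lift_is_monoid_morphism : monoid_morphism presented_lift.
Proof.
split=> [|a b]; first by rewrite -(rmorph1 (proj rel)) presented_liftE rmorph1.
have [[x <-] [y <-]] := (proj_surj a, proj_surj b).
by rewrite -rmorphM !presented_liftE rmorphM.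
Qed.

HB.instance Definition _ := GRing.isMonoidMorphism.Build
  (presented rel) (presented rel') presented_lift
  presented_lift_is_monoid_morphism.

Lemma presented_liftP : exists phi : {rmorphism presented rel -> presented rel'},
  scalable phi /\ forall i, phi (proj rel (free_gen i)) = g i.
Proof.
exists presented_lift; split=> [c a|i]; last first.
  by rewrite /= presented_liftE eval_free_gen.
by have [x <-] := proj_surj a; rewrite -linearZ /= !presented_liftE linearZ.
Qed.

End UniversalProperty.

(** * The braid matrix *)

Section BraidMatrix.
Variables (F : fieldType) (N : nat) (s : F).
Implicit Types i j a b : 'I_N.

Local Notation rh i := (qrho N s (label i)).

Lemma label_eq0 i : (label i == 0) = (i == rev_ord i).
Proof.
rewrite /label -val_eqE /=; case: i => i /= iN.
have := odd_double_half N; case: (odd N) => /= e.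
  by apply/idP/idP; lia.
by case: ifP => ?; apply/idP/idP; lia.
Qed.

Lemma label_rev i : label (rev_ord i) = - label i.
Proof.
rewrite /label /=; case: i => i /= iN.
have := odd_double_half N; case: (odd N) => /= e; first lia.
by do 2 case: ifP => ?; lia.
Qed.

Lemma qrho_rev i : rh (rev_ord i) = (rh i)^-1.
Proof.
rewrite label_rev /qrho invr_expz; congr (s ^ _).
by rewrite /rho2 sgzN normrN !mulNr.
Qed.

Section Contraction.
Variables (V : lmodType F) (a b : 'I_N) (f : 'I_N -> 'I_N -> V).

(** The contraction is isolated as a map linear in the matrix, so that the sums defining [Rmx] can
    be evaluated one elementary tensor at a time. *)
Definition contract (M : 'M[F]_(N * N)) : V :=
  \sum_c \sum_d entry M a b c d *: f c d.

Fact contract_is_linear : linear contract.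
Proof.
move=> t A B; rewrite /contract scaler_sumr -big_split; apply: eq_bigr => c _.
rewrite scaler_sumr -big_split; apply: eq_bigr => d _ /=.
by rewrite /entry !mxE scalerDl scalerA.
Qed.

HB.instance Definition _ := GRing.isLinear.Build
  F 'M[F]_(N * N) V *:%R contract contract_is_linear.

Let contractE i j i' j' :
  contract (E F i j *t E F i' j') = if (a == i) && (b == i') then f j j' else 0.
Proof.
rewrite /contract (bigD1 j) //= (bigD1 j') //= !big1 => [|c cj|d dj].
- by rewrite !addr0 /entry mxE !mxtens_indexK !mxE /= !eqxx !andbT -natrM mulnb;
    case: ifP => _; rewrite ?scale1r ?scale0r.
- rewrite big1 // => d _; rewrite /entry mxE !mxtens_indexK !mxE /=.
  by rewrite (negPf cj) andbF mul0r scale0r.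
- rewrite /entry mxE !mxtens_indexK !mxE /=.
  by rewrite (negPf dj) andbF mulr0 scale0r.
Qed.

Lemma Rhat_sum : \sum_c \sum_d Rhat s a b c d *: f c d =
  (if (a == b) && (label a != 0) then qq s *: f a a else 0)
  + (if (a != b) && (a != rev_ord b) || (a == b) && (label a == 0)
     then f b a else 0)
  + (if (b == rev_ord a) && (label a != 0) then (qq s)^-1 *: f b a else 0)
  + kk s *: ((if (a < b)%N then f a b else 0)
     - (if b == rev_ord a then
          \sum_(j < N | (a < j)%N) ((rh a)^-1 * rh j) *: f (rev_ord j) j
        else 0)).
Proof.
rewrite -[LHS]/(contract (Rmx N s)) /Rmx !linearD !linearZ /= linearN /=.
congr (_ + _ + _ + (_ *: _ + _ *: - _)).
- rewrite [contract _]linear_sum /=; under eq_bigr do rewrite contractE; rewrite big_mkcond.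
  rewrite (bigD1 a) //= big1 => [|i ia].
    rewrite eqxx addr0 /= [b == a]eq_sym.
    by case: (_ == b) (_ != 0) => [] [] //=; rewrite scaler0.
  by rewrite [a == i]eq_sym (negPf ia) if_same.
- rewrite [contract _]linear_sum /= (bigD1 a) //= [X in _ + X]big1 => [|i ia].
    rewrite addr0 [contract _]linear_sum /=; under eq_bigr do rewrite contractE.
    rewrite big_mkcond (bigD1 b) //= big1 => [|i ib]; last first.
      by rewrite [b == i]eq_sym (negPf ib) andbF if_same.
    by rewrite !eqxx addr0.
  rewrite [contract _]linear_sum /=; under eq_bigr do rewrite contractE; rewrite big1 // => j _.
  by rewrite [a == i]eq_sym (negPf ia).
- rewrite [contract _]linear_sum /=; under eq_bigr do rewrite contractE; rewrite big_mkcond.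
  rewrite (bigD1 a) //= big1 => [|i ia].
    rewrite eqxx addr0 /=; have [->|_] /= := eqVneq b (rev_ord a).
      by case: (_ != 0) => //=; rewrite scaler0.
    by rewrite if_same scaler0.
  by rewrite [a == i]eq_sym (negPf ia) if_same.
- rewrite [contract _]linear_sum /= (bigD1 a) //= [X in _ + X]big1 => [|i ia].
    rewrite addr0 [contract _]linear_sum /=; under eq_bigr do rewrite contractE.
    rewrite big_mkcond (bigD1 b) //= big1 => [|i ib]; last first.
      by rewrite [b == i]eq_sym (negPf ib) andbF if_same.
    by rewrite !eqxx addr0.
  rewrite [contract _]linear_sum /=; under eq_bigr do rewrite contractE; rewrite big1 // => j _.
  by rewrite [a == i]eq_sym (negPf ia).
- rewrite [contract _]linear_sum /= (bigD1 a) //= [X in _ + X]big1 => [|i ia].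
    rewrite addr0 [contract _]linear_sum /=.
    have [e|ba] := eqVneq b (rev_ord a); last first.
      by rewrite big1 // => j _; rewrite [contract _]linearZ /= contractE (negPf ba) andbF scaler0.
    by apply: eq_bigr => j _; rewrite [contract _]linearZ /= contractE e !eqxx.
  rewrite [contract _]linear_sum /= big1 // => j _; rewrite [contract _]linearZ /= contractE.
  by rewrite [a == i]eq_sym (negPf ia) scaler0.
Qed.

End Contraction.

End BraidMatrix.

Ltac split_ifs :=
  repeat (match goal with
  | |- context [if ?b then _ else _] =>
      first [ have -> : b = true by lia | have -> : b = false by lia
            | have [?|?] := boolP b ]
  | |- context [(nat_of_bool ?b)%:R] =>
      first [ have -> : b = true by lia | have -> : b = false by lia
            | have [?|?] := boolP b ]
  end; rewrite /= ?mulr0n ?mulr1n).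

(** * The inverse of the braid matrix *)

Section Inverse.
Variables (F : fieldType) (N : nat) (s : F).
Implicit Types i j a b : 'I_N.

Local Notation rh i := (qrho N s (label i)).
Local Notation q := (qq s).
Local Notation k := (kk s).

Lemma rho2E i : rho2 N (label i) =
  if (2 * i + 1 < N)%N then N%:Z - 2 - 2 * i%:Z
  else if (2 * i + 1 == N)%N then 0 else N%:Z - 2 * i%:Z.
Proof.
rewrite /rho2 /label; case: i => i /= iN.
have := odd_double_half N; case: (odd N) => /= e.
  by case: ltngtP => c; lia.
by case: ifP => c1; case: ltngtP => c; lia.
Qed.

Lemma qrhoE i : rh i =
  if (2 * i + 1 < N)%N then s ^ (N%:Z - 2 - 2 * i%:Z)
  else if (2 * i + 1 == N)%N then 1 else s ^ (N%:Z - 2 * i%:Z).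
Proof. by rewrite /qrho rho2E; do 2 case: ifP => // _. Qed.

Hypothesis s_neq0 : s != 0.

Lemma qrho_neq0 i : rh i != 0.
Proof. by rewrite /qrho expfz_neq0. Qed.

Lemma Rhat_entry a b c d : Rhat s a b c d =
  ((a == c) && (b == d) && (a == b) && (a != rev_ord a))%:R * q
  + ((b == c) && (a == d) && (a != b) && (a != rev_ord b) ||
     (b == c) && (a == d) && (a == b) && (a == rev_ord a))%:R
  + ((b == c) && (a == d) && (b == rev_ord a) && (a != rev_ord a))%:R * q^-1
  + k * (((a == c) && (b == d) && (a < b)%N)%:R
         - ((b == rev_ord a) && (c == rev_ord d) && (a < d)%N)%:R
           * (rh a)^-1 * rh d).
Proof.
(* A single entry is the contraction of [Rhat] with an indicator function, so [Rhat_sum] applies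
   with the field as a module over itself. *)
pose f i j : F^o := ((i == c) && (j == d))%:R.
have -> : Rhat s a b c d = \sum_i \sum_j Rhat s a b i j *: f i j.
  rewrite (bigD1 c) //= (bigD1 d) //= !big1 => [|i ic|j jd].
  - by rewrite /f !eqxx !addr0 -[_ *: 1%:R]/(_ * 1) mulr1.
  - by rewrite big1 // => j _; rewrite /f (negPf ic) scaler0.
  - by rewrite /f (negPf jd) andbF scaler0.
rewrite Rhat_sum !label_eq0 /f.
have scE (x y : F) : x *: (y : F^o) = x * y by [].
rewrite !scE; congr (_ + _ + _ + _ * (_ - _)).
- have [->|] := eqVneq a b; last by rewrite andbF mul0r.
  by case: (b == c); case: (b == d); case: (b == rev_ord b) => /=; rewrite ?mulr1 ?mul1r ?mul0r ?mulr0.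
- by case: (b == c); case: (a == d); case: (a == b) => /=; case: eqP => //=; case: eqP.
- by case: (b == c); case: (a == d); case: (b == rev_ord a); case: (a == rev_ord a); rewrite /= ?mulr1 ?mul1r ?mul0r ?mulr0.
- by case: (a == c); case: (b == d); case: ifP.
case: (b == rev_ord a); last by rewrite /= !mul0r.
rewrite /=; under eq_bigr do rewrite scE; have [ad|ad] := boolP (a < d)%N.
  rewrite (bigD1 d) //= big1 => [|j /andP[_ /negPf ->]]; last by rewrite andbF mulr0.
  rewrite eqxx andbT addr0 [c == _]eq_sym.
  by case: (_ == c); rewrite /= ?mul0r ?mul1r ?mulr0 ?mulr1.
rewrite andbF /= !mul0r big1 // => j aj; rewrite [j == d](negPf _) ?andbF ?mulr0 //.
by apply: contra ad => /eqP <-.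
Qed.

Let q_neq0 : q != 0. Proof. exact: expf_neq0. Qed.

(** One step of the telescoping in [qrho_sum]. Away from the middle [rho] drops by 1 per position;
    next to the middle of odd N it drops by 1/2, and the changed factor 1 compensates. The term in k
    occurs only between the two middle positions of even N, where both weights are 1 and q = q^-1 +
    k. *)
Lemma qrho_succ i j : j = i.+1 :> nat ->
  rh j ^+ 2 * (if j == rev_ord j then 1 else q)
  = rh i ^+ 2 * (if i == rev_ord i then 1 else q^-1)
    + k * ((i < rev_ord i)%N && (rev_ord j < j)%N)%:R.
Proof.
move=> ji; have iN := ltn_ord i; have jN := ltn_ord j.
have [lo|[mj|[mij|[mi|up]]]] : (2 * j + 1 < N \/ (2 * j + 1 = N \/ (2 * j = N
    \/ (2 * i + 1 = N \/ N < 2 * i + 1))))%N by lia.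
- have -> : rh j = rh i * q^-1.
    rewrite !qrhoE !ifT; try lia.
    rewrite /qq -[s ^+ 2]/(s ^ 2%:Z) invr_expz -expfzDr //; congr (_ ^ _); lia.
  rewrite !ifF; try by rewrite -val_eqE /=; lia.
  rewrite (_ : _ && _ = false) ?mulr0 ?addr0; last by rewrite /=; lia.
  by field.
- have -> : rh j = 1 by rewrite qrhoE ifF ?ifT //; lia.
  have -> : rh i = s.
    by rewrite qrhoE ifT; [rewrite -[RHS]expr1z; congr (_ ^ _)|]; lia.
  rewrite ifT ?ifF; try by rewrite -val_eqE /=; lia.
  rewrite (_ : _ && _ = false) ?mulr0 ?addr0; last by rewrite /=; lia.
  by rewrite /qq /kk /qq; field.
- have -> : rh j = 1.
    by rewrite qrhoE !ifF; [rewrite -[RHS](expr0z s); congr (_ ^ _)|..]; lia.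
  have -> : rh i = 1.
    by rewrite qrhoE ifT; [rewrite -[RHS](expr0z s); congr (_ ^ _)|]; lia.
  rewrite !ifF; try by rewrite -val_eqE /=; lia.
  rewrite (_ : _ && _ = true) ?mulr1; last by rewrite /=; lia.
  by rewrite /kk; field.
- have -> : rh j = s^-1.
    by rewrite qrhoE !ifF; [rewrite -[RHS]exprN1; congr (_ ^ _)|..]; lia.
  have -> : rh i = 1 by rewrite qrhoE ifF ?ifT //; lia.
  rewrite ifF ?ifT; try by rewrite -val_eqE /=; lia.
  rewrite (_ : _ && _ = false) ?mulr0 ?addr0; last by rewrite /=; lia.
  by rewrite /qq; field.
- have -> : rh j = rh i * q^-1.
    rewrite !qrhoE !ifF; try lia.
    rewrite /qq -[s ^+ 2]/(s ^ 2%:Z) invr_expz -expfzDr //; congr (_ ^ _); lia.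
  rewrite !ifF; try by rewrite -val_eqE /=; lia.
  rewrite (_ : _ && _ = false) ?mulr0 ?addr0; last by rewrite /=; lia.
  by field.
Qed.

(** This telescopes, since k = q - q^-1. At the middle of odd N both factors are 1 and their
    difference vanishes, so the contribution k of that position is recorded separately, by the same
    term that records the jump at the middle of even N. *)
Lemma qrho_sum i j : (i < j)%N ->
  k * \sum_(l < N | (i < l < j)%N) rh l ^+ 2
  = rh i ^+ 2 * (if i == rev_ord i then 1 else q^-1)
    - rh j ^+ 2 * (if j == rev_ord j then 1 else q)
    + k * ((i < rev_ord i)%N && (rev_ord j < j)%N)%:R.
Proof.
case: j => j jN /=; elim: j jN => // j IHj jN ij.
have [{}ij|ij'] : (i < j \/ i = j :> nat)%N by lia.
  pose l := Ordinal (ltnW jN); have e := IHj (ltnW jN) ij; rewrite -/l in e.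
  rewrite (@qrho_succ l (Ordinal jN)) // (bigD1 l) /=; last by rewrite ij ltnSn.
  rewrite (eq_bigl (fun m : 'I_N => (i < m < j)%N)) => [|m]; last first.
    by rewrite -val_eqE /=; apply/idP/idP; lia.
  rewrite mulrDr e -![l == _]val_eqE /= /kk.
  have iN := ltn_ord i.
  have [c|[c|c]] : (2 * j + 1 < N \/ (2 * j + 1 = N \/ N < 2 * j + 1))%N by lia.
  - have -> : (j == N - j.+1)%N = false by lia.
    have -> : (N - j.+1 < j)%N = false by lia.
    have -> : (j < N - j.+1)%N by lia.
    have -> : (i < N - i.+1)%N by lia.
    by rewrite ?andbT ?andbF /= ?mulr0n ?mulr1n; ring.
  - have -> : (j == N - j.+1)%N by lia.
    have -> : (N - j.+1 < j)%N = false by lia.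
    have -> : (j < N - j.+1)%N = false by lia.
    have -> : (N - j.+2 < j.+1)%N by lia.
    have -> : (i < N - i.+1)%N by lia.
    have -> : rh l = 1 by rewrite qrhoE ifF ?ifT //=; lia.
    by rewrite ?andbT ?andbF /= ?mulr0n ?mulr1n; ring.
  - have -> : (j == N - j.+1)%N = false by lia.
    have -> : (N - j.+1 < j)%N by lia.
    have -> : (j < N - j.+1)%N = false by lia.
    have -> : (N - j.+2 < j.+1)%N by lia.
    by rewrite ?andbT ?andbF /= ?mulr0n ?mulr1n; ring.
rewrite big1 ?mulr0 => [|m]; last by lia.
by rewrite (@qrho_succ i (Ordinal jN)) /= ?ij' //; rewrite -ij'; ring.
Qed.

(* Crossing symmetry: the inverse of the braid matrix in terms of its own entries. *)
Definition Sinv c i j b : F := rh b / rh c * Rhat s i (rev_ord b) (rev_ord c) j.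

Lemma Rhat_diag j c : Rhat s j c j c =
  if j == c then (if c == rev_ord c then 1 else q)
  else k * (if (j < c)%N then 1 - (if j == rev_ord c then rh c ^+ 2 else 0) else 0).
Proof.
rewrite Rhat_entry !eqxx.
have [->|jc] := eqVneq j c.
  rewrite ltnn /=.
  by case: (c == rev_ord c); rewrite /= ?mulr0n ?mulr1n; ring.
rewrite /= [c == rev_ord j]eq_sym.
have -> : (rev_ord j == c) = (j == rev_ord c).
  by apply/eqP/eqP => [<-|->]; rewrite rev_ordK.
case: eqP => [e|_] /=; last first.
  by case: (j < c)%N; rewrite /= ?mulr0n ?mulr1n; ring.
have -> : rh j = (rh c)^-1 by rewrite e qrho_rev.
rewrite invrK.
by case: (j < c)%N; rewrite /= ?mulr0n ?mulr1n; ring.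
Qed.

(** Conservation of weight: a pair goes to itself, to its transpose, or, if it is a pair of
    opposites, to another pair of opposites. *)
Lemma Rhat_weight a b c d :
  ~~ [|| (a == c) && (b == d), (a == d) && (b == c) | (b == rev_ord a) && (c == rev_ord d)] ->
  Rhat s a b c d = 0.
Proof.
rewrite !negb_or => /and3P[h1 h2 h3]; rewrite Rhat_entry.
rewrite (negPf h1) [(b == c) && _]andbC (negPf h2) (negPf h3) /=.
by ring.
Qed.

(** The block of weight zero, in which all pairs of opposites mix. The long sum reduces to the
    squares of [rh] between i and c, which [qrho_sum] evaluates; what remains is a comparison of c
    with i, with [rev_ord i] and with the middle. *)
Lemma Sinv_zero i c : \sum_m \sum_j Rhat s i (rev_ord i) m j * Sinv m j c (rev_ord c)
   = (i == c)%:R.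
Proof.
pose f m j : F^o := Sinv m j c (rev_ord c).
rewrite -[LHS]/(\sum_m \sum_j Rhat s i (rev_ord i) m j *: f m j).
have fE j : f (rev_ord j) j = rh j * (rh c)^-1 * Rhat s j c j c.
  by rewrite /f /Sinv !qrho_rev invrK !rev_ordK [rh j * _]mulrC.
have scE (x y : F) : x *: (y : F^o) = x * y by [].
rewrite Rhat_sum !label_eq0 eqxx fE scE.
have sumE : \sum_(j < N | (i < j)%N) ((rh i)^-1 * rh j) *: f (rev_ord j) j
   = (rh i)^-1 * (rh c)^-1 * \sum_(j < N | (i < j)%N) rh j ^+ 2 * Rhat s j c j c.
  by rewrite mulr_sumr; apply: eq_bigr => j _; rewrite fE scE; ring.
rewrite sumE !scE rev_ordK andbN /=.
(* Only the positions up to c contribute, because [Rhat_diag] vanishes for j > c. The term in k^2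
   comes from j = [rev_ord c], where the diagonal entry contains an additional - [rh c ^+ 2]. *)
have kS : k * \sum_(j < N | (i < j)%N) rh j ^+ 2 * Rhat s j c j c
  = if (i < c)%N then k * (rh i ^+ 2 * (if i == rev_ord i then 1 else q^-1)
       + k * ((i < rev_ord i)%N && (rev_ord c < c)%N)%:R)
       - k ^+ 2 * ((rev_ord c < c)%N && (i < rev_ord c)%N)%:R else 0.
  case: ifP => [ic|ic]; last first.
    rewrite big1 ?mulr0 // => j ij; rewrite Rhat_diag -val_eqE /= ifF; last by lia.
    by rewrite ifF ?mulr0 //; lia.
  rewrite (bigD1 c) //= Rhat_diag eqxx.
  rewrite (eq_bigl (fun m : 'I_N => (i < m)%N && (m != c))) // (bigID (fun m : 'I_N => (m < c)%N)) /=.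
  rewrite [X in _ + (_ + X)]big1 ?addr0 => [|j]; last first.
    move=> /andP[/andP[ij jc] cj]; rewrite Rhat_diag (negPf jc) (negPf cj); ring.
  rewrite (eq_bigl (fun m : 'I_N => (i < m < c)%N)) => [|j]; last first.
    by rewrite -val_eqE /=; apply/idP/idP; lia.
  rewrite (eq_bigr (fun j => k * rh j ^+ 2 - (if j == rev_ord c then k else 0))) => [|j]; last first.
    move=> /andP[_ jc]; rewrite Rhat_diag jc ifF; last by rewrite -val_eqE /=; lia.
    case: eqP => [->|_]; last by ring.
    by rewrite qrho_rev; field; apply: qrho_neq0.
  rewrite sumrB -mulr_sumr mulrDr mulrBr qrho_sum //.
  rewrite -big_mkcondr /=.
  have -> : \sum_(j < N | (i < j < c)%N && (j == rev_ord c)) k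
      = k * ((rev_ord c < c)%N && (i < rev_ord c)%N)%:R.
    have [h|h] := boolP ((rev_ord c < c)%N && (i < rev_ord c)%N).
      rewrite (big_pred1 (rev_ord c)) ?mulr1 // => j; rewrite /= -val_eqE /=.
      by apply/idP/idP; move: h => /=; lia.
    rewrite big1 ?mulr0 // => j /andP[ijc /eqP jc]; exfalso.
    by move: h ijc; rewrite jc /=; lia.
  ring.
rewrite [k * _]mulrBr -[k * (_ * _)]mulrCA kS.
have -> : f i (rev_ord i) = (rh i)^-1 * (rh c)^-1 * Rhat s (rev_ord i) c (rev_ord i) c.
  by rewrite -{1}[ i]rev_ordK fE qrho_rev.
rewrite !Rhat_diag.
have iN := ltn_ord i; have cN := ltn_ord c.
have rc0 := qrho_neq0 c; have ri0 := qrho_neq0 i.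
have rmid : i = (N - i.+1)%N :> nat -> rh i = 1 by move=> ?; rewrite qrhoE ifF ?ifT //; lia.
have [ci|ci] := eqVneq c i.
  rewrite ci in rc0 *; rewrite -!val_eqE /= /kk; split_ifs;
    by [field; rewrite ?q_neq0 ?ri0 ?oner_neq0
       | rewrite rmid; [field; rewrite ?q_neq0 ?oner_neq0 | lia]].
have [ci'|ci'] := eqVneq c (rev_ord i).
  rewrite ci' in rc0 *; rewrite rev_ordK qrho_rev -!val_eqE /= /kk; split_ifs;
    by [field; rewrite ?q_neq0 ?ri0 ?oner_neq0
       | rewrite rmid; [field; rewrite ?q_neq0 ?oner_neq0 | lia]].
have rci : i = rev_ord c -> rh c = (rh i)^-1 by move=> ->; rewrite qrho_rev invrK.
rewrite -!val_eqE /= in ci ci' rci *; rewrite /kk; split_ifs.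
  all: try by field; rewrite ?q_neq0 ?ri0 ?rc0 ?oner_neq0.
  all: try by rewrite rmid; [field; rewrite ?q_neq0 ?rc0 ?oner_neq0 | lia].
Qed.

(** Outside weight zero the blocks have size at most two, so comparing the four indices leaves
    finitely many identities in the field. *)
Lemma Rhat_SinvE i k' a b :
  \sum_m \sum_j Rhat s i k' m j * Sinv m j a b = ((i == a) && (k' == b))%:R.
Proof.
have [->|ki] := eqVneq k' (rev_ord i).
  have [->|ba] := eqVneq b (rev_ord a).
    by rewrite Sinv_zero (inj_eq rev_ord_inj) andbb.
  rewrite [_ && _](_ : _ = false); last first.
    by apply: contraNF ba => /andP[/eqP -> /eqP <-].
  have S0 j : Sinv (rev_ord j) j a b = 0.
    rewrite /Sinv Rhat_weight ?mulr0 // rev_ordK eqxx /=.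
    rewrite -!val_eqE /=; move: ba; rewrite -val_eqE /=.
    by have := ltn_ord a; have := ltn_ord b; have := ltn_ord j; lia.
  rewrite -[LHS]/(\sum_m \sum_j Rhat s i (rev_ord i) m j *: (Sinv m j a b : F^o)).
  have S0' : Sinv i (rev_ord i) a b = 0 by rewrite -{1}[ i]rev_ordK S0.
  rewrite Rhat_sum !S0 S0' !scaler0 !if_same big1 => [|j _]; last by rewrite S0 scaler0.
  by rewrite !label_eq0 andbN !if_same !add0r ?subrr ?oppr0 ?addr0 ?scaler0.
rewrite -[LHS]/(\sum_m \sum_j Rhat s i k' m j *: (Sinv m j a b : F^o)).
have scE (x y : F) : x *: (y : F^o) = x * y by [].
rewrite Rhat_sum (negPf ki) !label_eq0 !scE /Sinv !Rhat_entry.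
have ri := qrho_neq0 i; have rk := qrho_neq0 k'.
have iN := ltn_ord i; have kN := ltn_ord k'; have aN := ltn_ord a; have bN := ltn_ord b.
rewrite -!val_eqE /= in ki *; rewrite /kk.
have [/val_inj ai|ai] := eqVneq (a : nat) i; have [/val_inj bi|bi] := eqVneq (b : nat) i;
  have [/val_inj ak|ak] := eqVneq (a : nat) k'; have [/val_inj bk|bk] := eqVneq (b : nat) k';
  try subst; try (by exfalso; lia); split_ifs;
  by field; rewrite ?q_neq0 ?ri ?rk ?oner_neq0.
Qed.

(** A right inverse of a square matrix is its inverse. This replaces [invmx] in the cross relation
    by entries of the braid matrix itself. *)
Lemma Rhat_invE c i j b : Rhat_inv s c i j b = Sinv c i j b.
Proof.
pose S : 'M[F]_(N * N) := \matrix_(u, v) Sinv (mxtens_unindex u).1 (mxtens_unindex u).2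
  (mxtens_unindex v).1 (mxtens_unindex v).2.
have SE m l u v : S (mxtens_index (m, l)) (mxtens_index (u, v)) = Sinv m l u v.
  by rewrite mxE !mxtens_indexK.
have RS : Rmx N s *m S = 1%:M.
  apply/matrixP => u v; case: (mxtens_indexP u) => i1 i2; case: (mxtens_indexP v) => a1 a2.
  rewrite !mxE (can_eq (@mxtens_indexK N N)) xpair_eqE -Rhat_SinvE.
  rewrite pair_big (reindex (fun p => @mxtens_index N N p)); last first.
    by exists (@mxtens_unindex N N) => p _; [apply: mxtens_indexK|apply: mxtens_unindexK].
  by apply: eq_bigr => -[m l] _; rewrite SE.
have [Ru _] := mulmx1_unit RS.
rewrite /Rhat_inv /entry; have -> : invmx (Rmx N s) = S.
  by rewrite -[RHS](mulKmx Ru) RS mulmx1.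
exact: SE.
Qed.

End Inverse.

(** * Braid commutation relations *)

Section RhatCases.
Variables (F : fieldType) (N : nat) (s : F) (V : lmodType F).
Variables (f : 'I_N -> 'I_N -> V).
Implicit Types i j a b : 'I_N.

Local Notation rh i := (qrho N s (label i)).
Local Notation q := (qq s).
Local Notation k := (kk s).
Local Notation "'R[' f ]_( i , j )" :=
  (\sum_c \sum_d Rhat s i j c d *: f c d).

Lemma Rhat_sum_off i j : j != rev_ord i -> j != i ->
  R[f]_(i, j) = f j i + (if (i < j)%N then k *: f i j else 0).
Proof.
move=> ji' ji; have ij' : i != rev_ord j.
  by apply: contra ji' => /eqP ->; rewrite rev_ordK.
rewrite Rhat_sum [i == j]eq_sym (negPf ji) (negPf ji') ij' /=.
by rewrite add0r !addr0 oppr0 addr0; case: ifP => _; rewrite ?scaler0.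
Qed.

Lemma Rhat_sum_diag i : i != rev_ord i -> R[f]_(i, i) = q *: f i i.
Proof.
move=> ii'; rewrite Rhat_sum label_eq0 eqxx ltnn (negPf ii') /=.
by rewrite !addr0 oppr0 addr0 scaler0 addr0.
Qed.

Lemma Rhat_sum_opp i : i != rev_ord i ->
  R[f]_(i, rev_ord i) = q^-1 *: f (rev_ord i) i
    + (if (i < rev_ord i)%N then k *: f i (rev_ord i) else 0)
    - (k / rh i) *: \sum_(j < N | (i < j)%N) rh j *: f (rev_ord j) j.
Proof.
move=> ii'; rewrite Rhat_sum label_eq0 eqxx (negPf ii') rev_ordK eqxx /=.
rewrite !add0r scalerBr addrA; congr (_ + _ - _).
  by case: ifP => _; rewrite ?scaler0.
rewrite -(scalerA k); congr (_ *: _); rewrite scaler_sumr.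
by apply: eq_bigr => j _; rewrite scalerA.
Qed.

Lemma qrho_mid i : i = rev_ord i -> rh i = 1.
Proof.
move=> /eqP; rewrite -label_eq0 /qrho /rho2 => /eqP ->.
by rewrite sgz0 oppr0 mul0r expr0z.
Qed.

Lemma Rhat_sum_mid i : i = rev_ord i ->
  R[f]_(i, i) = f i i - k *: \sum_(j < N | (i < j)%N) rh j *: f (rev_ord j) j.
Proof.
move=> ii'; rewrite Rhat_sum label_eq0 -ii' eqxx ltnn /= add0r addr0 sub0r.
rewrite qrho_mid //.
by rewrite invr1 scalerN; congr (_ - _ *: _); apply: eq_bigr => j _; rewrite mul1r.
Qed.

End RhatCases.

(* [m] is kept abstract so that the results also apply to the opposite product. *)
Record bilinear_assoc (F : fieldType) (B : lmodType F) (m : B -> B -> B) : Prop :=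
  BilinearAssoc {
    ba_assoc : associative m;
    ba_Dl : left_distributive m +%R;
    ba_Dr : right_distributive m +%R;
    ba_Zl : forall c a b, m (c *: a) b = c *: m a b;
    ba_Zr : forall c a b, m a (c *: b) = c *: m a b }.

Lemma bilinear_assoc_opp (F : fieldType) (B : lmodType F) (m : B -> B -> B) :
  bilinear_assoc m -> bilinear_assoc (fun a b => m b a).
Proof.
by case=> A Dl Dr Zl Zr; split=> // a b c; rewrite A.
Qed.

Section Frames.
Variables (F : fieldType) (N : nat) (s : F).
Variables (B : lmodType F) (m : B -> B -> B).
Hypotheses (s_neq0 : s != 0) (mP : bilinear_assoc m).
Implicit Types (i j h : 'I_N) (x : 'I_N -> B) (W : nat -> B) (z : B).

Local Notation rh i := (qrho N s (label i)).
Local Notation q := (qq s).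
Local Notation k := (kk s).
Local Notation "a ** b" := (m a b) (at level 40, left associativity).
Local Notation "'R[' f ]_( i , j )" :=
  (\sum_c \sum_d Rhat s i j c d *: f c d).

Let q_neq0 : q != 0. Proof. exact: expf_neq0. Qed.

Let mA := ba_assoc mP.
Let mZl := ba_Zl mP.
Let mZr := ba_Zr mP.

Lemma ba_0l a : 0 ** a = 0.
Proof. by have := mZl 0 0 a; rewrite !scale0r. Qed.

Lemma ba_0r a : a ** 0 = 0.
Proof. by have := mZr 0 a 0; rewrite !scale0r. Qed.

Lemma ba_Nl a b : (- a) ** b = - (a ** b).
Proof. by rewrite -scaleN1r mZl scaleN1r. Qed.

Lemma ba_Nr a b : a ** (- b) = - (a ** b).
Proof. by rewrite -scaleN1r mZr scaleN1r. Qed.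

Lemma ba_Bl a b c : (a - b) ** c = a ** c - b ** c.
Proof. by rewrite (ba_Dl mP) ba_Nl. Qed.

Lemma ba_Br a b c : a ** (b - c) = a ** b - a ** c.
Proof. by rewrite (ba_Dr mP) ba_Nr. Qed.

Lemma ba_suml (I : Type) (r : seq I) (P : pred I) (f : I -> B) a :
  (\sum_(i <- r | P i) f i) ** a = \sum_(i <- r | P i) f i ** a.
Proof. by rewrite (big_morph (m^~ a) (fun b c => ba_Dl mP b c a) (ba_0l a)). Qed.

Lemma ba_sumr (I : Type) (r : seq I) (P : pred I) (f : I -> B) a :
  a ** (\sum_(i <- r | P i) f i) = \sum_(i <- r | P i) a ** f i.
Proof. by rewrite (big_morph (m a) (fun b c => ba_Dr mP a b c) (ba_0r a)). Qed.

(** [W p] belongs to the gap between the positions p - 1 and p. The fields for opposite and middle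
    indices are what is left of the braid relation in weight zero once its long sum has been
    telescoped; see [qspace_braid]. *)
Record qspace x W : Prop := QSpace {
  qspace_comm : forall i j, (i < j)%N -> j != rev_ord i ->
    x i ** x j = q *: (x j ** x i);
  qspace_pair : forall i, x i ** x (rev_ord i) = rh i *: (W i.+1 - W i);
  qspace_exch : forall i, i != rev_ord i ->
    q^-1 *: (x (rev_ord i) ** x i)
      + (if (i < rev_ord i)%N then k *: (x i ** x (rev_ord i)) else 0)
    = q *: (x i ** x (rev_ord i)) + (k / rh i) *: W (rev_ord i);
  qspace_mid : forall i, i = rev_ord i ->
    x i ** x i = q *: (x i ** x i) + k *: W i }.

Definition qcomm x z i : B := z ** x i - q *: (x i ** z).

(** The q-commutator of z with [x i] is axiomatized only at i = h, where it becomes the diagonal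
    entry D_h; for the other i, [frame_lt] and [frame_gt] compute it. [frame_pair] is the jump of
    the sum in [qcomm_telescope] at position h. *)
Record frame x W h z : Prop := Frame {
  frame_lt : forall i, (i < h)%N -> x i ** z = q^-1 *: (z ** x i);
  frame_gt : forall i, (h < i)%N -> x i ** z = q *: (z ** x i);
  frame_off : forall i, i != h -> i != rev_ord h ->
    x i ** qcomm x z h = qcomm x z h ** x i;
  frame_diag : h != rev_ord h ->
    x h ** qcomm x z h = q *: (qcomm x z h ** x h);
  frame_opp : h != rev_ord h ->
    qcomm x z h ** x (rev_ord h) = q *: (x (rev_ord h) ** qcomm x z h);
  frame_mid : h = rev_ord h -> x h ** qcomm x z h = qcomm x z h ** x h;
  frame_pair : qcomm x z h ** x (rev_ord h)
    = ((1 - q ^+ 2) * rh h) *: (z ** W h.+1) }.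

Lemma qspace_telescope x W (p : nat) : qspace x W -> (p <= N)%N ->
  \sum_(j < N | (j < p)%N) (rh j)^-1 *: (x j ** x (rev_ord j)) = W p - W 0.
Proof.
move=> xW; elim: p => [|p IHp] pN; first by rewrite subrr big1.
rewrite (bigD1 (Ordinal pN)) //= (eq_bigl (fun j : 'I_N => (j < p)%N)) => [|j].
  rewrite IHp 1?ltnW // (qspace_pair xW) scalerA mulVf ?scale1r ?qrho_neq0 //=.
  by rewrite addrA subrK.
by rewrite -val_eqE /=; apply/idP/idP; lia.
Qed.

Section Frame.
Variables (x : 'I_N -> B) (W : nat -> B) (h : 'I_N) (z : B).
Hypotheses (xW : qspace x W) (zh : frame x W h z).
Let M := qcomm x z.

Lemma qcomm_lt i : (i < h)%N -> M i = 0.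
Proof.
by move=> ih; rewrite /M /qcomm (frame_lt zh) // scalerA mulfV // scale1r subrr.
Qed.

Lemma qcomm_gt i : (h < i)%N -> M i = (1 - q ^+ 2) *: (z ** x i).
Proof.
by move=> hi; rewrite /M /qcomm (frame_gt zh) // scalerA scalerBl scale1r.
Qed.

(** The terms below h vanish, the term at h contributes the full value (1 - q^2) z W_(h+1) by
    [frame_pair], and each later term adds the next increment of the same expression. *)
Lemma qcomm_telescope (p : nat) : (p <= N)%N ->
  \sum_(j < N | (j < p)%N) (rh j)^-1 *: (M j ** x (rev_ord j))
  = if (h < p)%N then (1 - q ^+ 2) *: (z ** W p) else 0.
Proof.
elim: p => [|p IHp] pN; first by rewrite big1.
rewrite (bigD1 (Ordinal pN)) //= (eq_bigl (fun j : 'I_N => (j < p)%N)) => [|j].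
  rewrite (IHp (ltnW pN)).
  have [hp|hp] := ltnP h p.
    rewrite qcomm_gt // mZl scalerA -mA (qspace_pair xW) mZr scalerA.
    rewrite [_ * rh _]mulrAC mulVf ?qrho_neq0 // mul1r (leqW hp).
    by rewrite -scalerDr -(ba_Dr mP) /= subrK.
  rewrite /= addr0; have [hp'|ph] := eqVneq (h : nat) p.
    have -> : Ordinal pN = h by apply: val_inj.
    rewrite (frame_pair zh) scalerA mulrC mulfK ?qrho_neq0 //=.
    by rewrite -hp' ltnSn.
  have ph' : (p < h)%N by lia.
  by rewrite qcomm_lt // ba_0l scaler0 ltnS leqNgt ph'.
by rewrite -val_eqE /=; apply/idP/idP; lia.
Qed.

Lemma qcomm_sum_above i :
  \sum_(j < N | (i < j)%N) rh j *: (M (rev_ord j) ** x j)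
  = if (h < rev_ord i)%N then (1 - q ^+ 2) *: (z ** W (rev_ord i)) else 0.
Proof.
rewrite -qcomm_telescope; last exact: (ltnW (ltn_ord _)).
rewrite (reindex_inj rev_ord_inj) /=.
apply: eq_big => [j|j _]; last by rewrite rev_ordK qrho_rev.
have := ltn_ord i; have := ltn_ord j => /= jN iN.
by apply/idP/idP; lia.
Qed.

(* The case [k = rev_ord i] is where the sum over weights occurs; there the terms
   below [h] vanish, and the others telescope by [qcomm_sum_above]. *)
Lemma frame_cross i k' :
  x i ** M k' = R[fun a b => M a ** x b]_(i, k').
Proof.
have iN := ltn_ord i; have kN := ltn_ord k'; have hN := ltn_ord h.
have xzh : x h ** z = q^-1 *: (z ** x h - M h).
  by rewrite /M /qcomm opprB addrC subrK scalerA mulVf // scale1r.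
have qk : 1 - q ^+ 2 = - (q * k) by rewrite /kk; field; exact: q_neq0.
have [->{k' kN}|ki'] := eqVneq k' (rev_ord i); last first.
  have [e|ki] := eqVneq k' i.
    rewrite {}e in ki' *.
    rewrite Rhat_sum_diag //; have [ih|hi|/val_inj hi] := ltngtP i h.
    - by rewrite qcomm_lt // ba_0l ba_0r scaler0.
    - by rewrite qcomm_gt // mZr mZl mA (frame_gt zh hi) !mZl -mA !scalerA mulrC.
    - by rewrite hi in ki' *; rewrite (frame_diag zh).
  rewrite Rhat_sum_off //; have [kh|hk|kh] := ltngtP k' h.
  - rewrite qcomm_lt // ba_0r ba_0l add0r; case: ifP => // ik.
    by rewrite qcomm_lt ?ba_0l ?scaler0 // (ltn_trans ik).
  - rewrite [M k']qcomm_gt //; have [ih|hi|/val_inj ih] := ltngtP i h.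
    + have ik := ltn_trans ih hk.
      rewrite ik qcomm_lt // ba_0l scaler0 addr0 mZr mZl mA (frame_lt zh ih) mZl -!mA.
      by rewrite (qspace_comm xW ik ki') mZr !scalerA; congr (_ *: _); field.
    + rewrite qcomm_gt // mZr !mZl mA (frame_gt zh hi) mZl -!mA.
      have [ik|{}ki|ik] := ltngtP i k'; last by rewrite (val_inj ik) eqxx in ki.
        rewrite (qspace_comm xW ik ki') !mZr !scalerA -scalerDl; congr (_ *: _).
        by rewrite /kk; field.
      have ik' : i != rev_ord k' by apply: contra ki' => /eqP ->; rewrite rev_ordK.
      by rewrite (qspace_comm xW ki ik') !mZr !scalerA addr0.
    + subst i; rewrite hk mZr mZl mA xzh mZl ba_Bl -!mA.
      rewrite (qspace_comm xW hk ki') mZr scalerBr !scalerA -scaleNr.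
      by rewrite mulVf // scale1r scalerDr scalerA; congr (_ + _ *: _); rewrite /kk; field.
  - move/val_inj: kh => kh; subst k'.
    have -> : (if (i < h)%N then k *: (M i ** x h) else 0) = 0.
      by case: ltnP => // ih; rewrite qcomm_lt // ba_0l scaler0.
    rewrite addr0 (frame_off zh) //; first by rewrite eq_sym.
    by apply: contra ki' => /eqP ->; rewrite rev_ordK.
have [mi|mi] := eqVneq i (rev_ord i).
  rewrite -mi Rhat_sum_mid // qcomm_sum_above -mi.
  have [ih|hi|/val_inj hi] := ltngtP i h.
  - by rewrite qcomm_lt // ba_0l ba_0r scaler0 subr0.
  - rewrite qcomm_gt // mZr mZl mA (frame_gt zh hi) mZl -!mA.
    have kW : k *: (z ** W i) = (1 - q) *: (z ** (x i ** x i)).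
      rewrite [(1 - q) *: _]scalerBl scale1r -!(mZr _ z) -ba_Br; congr (_ ** _).
      by apply/eqP; rewrite eq_sym subr_eq; apply/eqP; rewrite addrC; apply: qspace_mid.
    rewrite [k *: _]scalerA [k * _]mulrC -[(_ * k) *: _]scalerA kW -scalerBr.
    by rewrite [(1 - q) *: _]scalerBl scale1r subKr.
  by rewrite hi in mi *; rewrite scaler0 subr0 (frame_mid zh).
rewrite Rhat_sum_opp // qcomm_sum_above.
have [i'h|hi'|/val_inj i'h] := ltngtP (rev_ord i) h.
- rewrite qcomm_lt // ba_0l ba_0r !scaler0 add0r subr0.
  by case: ltnP => // ii'; rewrite qcomm_lt ?ba_0l ?scaler0 //; apply: ltn_trans i'h.
- rewrite qcomm_gt // mZr mZl.
  set Z := z ** (x i ** x (rev_ord i)); set Z' := z ** (x (rev_ord i) ** x i).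
  (* [qspace_exch] trades the potential left by the telescoped sum for products of coordinates, so
     that both sides become combinations of [Z] and [Z'], or of [Z'] and M_h^h x^(-h) when i = h. *)
  have kW : (k / rh i) *: (z ** W (rev_ord i)) = q^-1 *: Z'
      + (if (i < rev_ord i)%N then k *: Z else 0) - q *: Z.
    apply/eqP; rewrite eq_sym subr_eq -!(mZr _ z) -(ba_Dr mP) [_ *: W _ + _]addrC.
    rewrite -(qspace_exch xW mi) (ba_Dr mP) !mZr.
    by case: ifP => _; rewrite ?mZr ?ba_0r.
  have scC (a b : F) (v : B) : a *: (b *: v) = b *: (a *: v).
    by rewrite !scalerA mulrC.
  rewrite -mA -/Z' [(k / _) *: _]scC kW {kW}.
  have [ih|hi|/val_inj hi] := ltngtP i h.
  + rewrite (qcomm_lt ih) ba_0l scaler0 if_same addr0 mA (frame_lt zh ih) mZl -mA.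
    rewrite (ltn_trans ih hi') [q^-1 *: (_ *: Z')]scC -scalerBr; congr (_ *: _).
    rewrite -addrA opprD addrA subrr add0r opprB -scalerBl.
    by congr (_ *: _); rewrite /kk; field.
  + rewrite qcomm_gt // mZl mA (frame_gt zh hi) mZl -!mA -/Z.
    rewrite [q^-1 *: (_ *: Z')]scC; case: ifP => _; last by rewrite !addr0 -scalerBr subKr.
    by rewrite [k *: (_ *: Z)]scC -scalerDr -scalerBr subKr.
  + rewrite /Z /Z' hi in hi' *; rewrite hi' mA xzh mZl ba_Bl -mA.
    rewrite [q^-1 *: ((1 - _) *: (_ ** (x _ ** _)))]scC [RHS]addrAC -scalerBr -addrA opprD addrA subrr add0r opprB.
    rewrite -[_ - k *: _]scalerBl !scalerBr !scalerA -scaleNr.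
    by congr (_ *: _ + _ *: _); rewrite /kk; field.
- have ei : i = rev_ord h by rewrite -i'h rev_ordK.
  have -> : (if (i < rev_ord i)%N then k *: (M i ** x (rev_ord i)) else 0) = 0.
    by rewrite i'h; case: ltnP => // ih; rewrite qcomm_lt // ba_0l scaler0.
  rewrite scaler0 subr0 addr0 i'h ei /M (frame_opp zh); last by rewrite -i'h rev_ordK eq_sym.
  by rewrite scalerA mulVf // scale1r.
Qed.

End Frame.

End Frames.

Section RhatSymmetries.
Variables (F : fieldType) (N : nat) (s : F).
Hypothesis s_neq0 : s != 0.
Implicit Types a b c d : 'I_N.

Local Notation rh i := (qrho N s (label i)).

Lemma rev_ord_eq a b : (rev_ord a == b) = (a == rev_ord b).
Proof. by apply/eqP/eqP => [<-|->]; rewrite rev_ordK. Qed.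

Lemma Rhat_sym a b c d : Rhat s a b c d = Rhat s c d a b.
Proof.
rewrite !Rhat_entry; have aN := ltn_ord a; have bN := ltn_ord b.
have cN := ltn_ord c; have dN := ltn_ord d.
congr (_%:R * _ + _%:R + _%:R * _ + _ * (_%:R - _)).
1,2,3,4: by congr nat_of_bool; rewrite -!val_eqE /=; apply/idP/idP; lia.
have -> : (d == rev_ord c) && (a == rev_ord b) && (c < b)%N
    = (b == rev_ord a) && (c == rev_ord d) && (a < d)%N.
  by rewrite -!val_eqE /=; apply/idP/idP; lia.
have [/andP[/andP[/eqP -> /eqP ->] _]|_] := boolP (_ && _); last by rewrite !mul0r.
by rewrite !qrho_rev invrK mulrAC.
Qed.

Lemma Rhat_rev a b c d :
  Rhat s a b c d = Rhat s (rev_ord b) (rev_ord a) (rev_ord d) (rev_ord c).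
Proof.
rewrite !Rhat_entry; have aN := ltn_ord a; have bN := ltn_ord b.
have cN := ltn_ord c; have dN := ltn_ord d.
congr (_%:R * _ + _%:R + _%:R * _ + _ * (_%:R - _)).
1,2,3,4: by congr nat_of_bool; rewrite -!val_eqE /=; apply/idP/idP; lia.
rewrite [in RHS](_ : _ && _ = (b == rev_ord a) && (c == rev_ord d) && (a < d)%N); last first.
  by rewrite -!val_eqE /=; apply/idP/idP; lia.
have [/andP[/andP[/eqP -> /eqP ->] _]|_] := boolP (_ && _); last by rewrite !mul0r.
by rewrite !rev_ordK.
Qed.

(** In each case allowed by [Rhat_weight] the product of the two [rh] is permuted or, for opposites,
    equal to 1. In [borel_entry_RLL] this carries the rescaling of the generators across the braid
    matrix. *)
Lemma Rhat_qrho a b c d :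
  Rhat s a b c d * (rh a * rh b) = Rhat s a b c d * (rh c * rh d).
Proof.
have [/or3P h|/(Rhat_weight s) ->] := boolP [|| (a == c) && (b == d),
  (a == d) && (b == c) | (b == rev_ord a) && (c == rev_ord d)]; last by rewrite !mul0r.
congr (_ * _); case: h => /andP[/eqP -> /eqP ->] //; first by rewrite mulrC.
by rewrite !qrho_rev mulfV ?mulVf ?qrho_neq0.
Qed.

End RhatSymmetries.

(** * RLL and metric relations from the two exchange relations *)

Section Transition.
Variables (F : fieldType) (N : nat) (s : F).
Variables (B : lmodType F) (m : B -> B -> B).
Hypotheses (s_neq0 : s != 0) (mP : bilinear_assoc m).
Implicit Types (h i j a b c d : 'I_N).

Local Notation rh i := (qrho N s (label i)).
Local Notation q := (qq s).
Local Notation k := (kk s).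
Local Notation "a ** b" := (m a b) (at level 40, left associativity).
Local Notation "'R[' f ]_( i , j )" :=
  (\sum_c \sum_d Rhat s i j c d *: f c d).

Let mA := ba_assoc mP.
Let mZl := ba_Zl mP.
Let mZr := ba_Zr mP.

Lemma Rsum_mull (f : 'I_N -> 'I_N -> B) (a : B) i j :
  a ** R[f]_(i, j) = R[fun c d => a ** f c d]_(i, j).
Proof.
rewrite (ba_sumr mP); apply: eq_bigr => c _; rewrite (ba_sumr mP).
by apply: eq_bigr => d _; rewrite mZr.
Qed.

Lemma Rsum_mulr (f : 'I_N -> 'I_N -> B) (a : B) i j :
  R[f]_(i, j) ** a = R[fun c d => f c d ** a]_(i, j).
Proof.
rewrite (ba_suml mP); apply: eq_bigr => c _; rewrite (ba_suml mP).
by apply: eq_bigr => d _; rewrite mZl.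
Qed.

Lemma eq_Rsum (f g : 'I_N -> 'I_N -> B) i j :
  (forall c d, f c d = g c d) -> R[f]_(i, j) = R[g]_(i, j).
Proof. by move=> fg; apply: eq_bigr => c _; apply: eq_bigr => d _; rewrite fg. Qed.

Lemma Rsum_exchange (f : 'I_N -> 'I_N -> 'I_N -> 'I_N -> B) i j a b :
  R[fun c d => R[f c d]_(a, b)]_(i, j)
  = R[fun u v => R[fun c d => f c d u v]_(i, j)]_(a, b).
Proof.
under eq_bigr => c _ do under eq_bigr => d _ do rewrite scaler_sumr.
under eq_bigr => c _ do rewrite exchange_big.
rewrite exchange_big; apply: eq_bigr => u _.
under eq_bigr => c _ do under eq_bigr => d _ do rewrite scaler_sumr.
under eq_bigr => c _ do rewrite exchange_big.
rewrite exchange_big; apply: eq_bigr => v _.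
rewrite scaler_sumr; apply: eq_bigr => c _; rewrite scaler_sumr.
by apply: eq_bigr => d _; rewrite !scalerA mulrC.
Qed.

Lemma Rsum_lin (f g : 'I_N -> 'I_N -> B) t i j :
  R[fun c d => f c d - t *: g c d]_(i, j) = R[f]_(i, j) - t *: R[g]_(i, j).
Proof.
rewrite scaler_sumr -sumrB; apply: eq_bigr => c _.
rewrite scaler_sumr -sumrB; apply: eq_bigr => d _.
by rewrite scalerBr !scalerA mulrC.
Qed.

(** For opposite indices the long sum telescopes to W_(-i) - W_0, and [qspace_exch] or [qspace_mid]
    absorbs W_(-i). Only the end value W_0 survives. *)
Lemma qspace_braid x W i j : qspace s m x W ->
  R[fun c d => x c ** x d]_(i, j)
  = q *: (x i ** x j) + (if j == rev_ord i then (k / rh i) *: W 0 else 0).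
Proof.
move=> xW.
have q_neq0 : q != 0 by exact: expf_neq0.
have sumE : \sum_(l < N | (i < l)%N) rh l *: (x (rev_ord l) ** x l) = W (rev_ord i) - W 0.
  rewrite -(qspace_telescope s_neq0 xW); last exact: (ltnW (ltn_ord _)).
  rewrite (reindex_inj rev_ord_inj) /=.
  apply: eq_big => [l|l _]; last by rewrite rev_ordK qrho_rev.
  by have := ltn_ord i; have := ltn_ord l; move=> ? ?; apply/idP/idP; lia.
have [->|ji'] := eqVneq j (rev_ord i).
  have [ii'|ii'] := eqVneq i (rev_ord i).
    rewrite -ii' Rhat_sum_mid // sumE -ii' {1}(qspace_mid xW ii') qrho_mid // divr1.
    by rewrite -addrA scalerBr subKr.
  by rewrite Rhat_sum_opp // sumE (qspace_exch xW ii') -addrA scalerBr subKr.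
rewrite addr0; have [e|ji] := eqVneq j i.
  by rewrite {}e in ji' *; rewrite Rhat_sum_diag.
rewrite Rhat_sum_off //; case: ltngtP => [ij|ij|/val_inj e]; last by rewrite e eqxx in ji.
  rewrite (qspace_comm xW ij ji') !scalerA -[X in X + _]scale1r -scalerDl.
  by congr (_ *: _); rewrite /kk; field.
have ij' : i != rev_ord j by apply: contra ji' => /eqP ->; rewrite rev_ordK.
by rewrite (qspace_comm xW ij ij') addr0.
Qed.

Section Relations.
Variables (x z : 'I_N -> B).
Local Notation M h i := (qcomm s m x (z h) i).
Hypothesis xM : forall h i j,
  x i ** M h j = R[fun c d => M h c ** x d]_(i, j).
Hypothesis Mz : forall h i j, M (rev_ord j) h ** z (rev_ord i)
  = R[fun c d => z (rev_ord d) ** M (rev_ord c) h]_(i, j).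

(** One braid matrix acts on the coordinate indices (f, e), the other on the frame indices (a, b),
    so their sums can be exchanged. [Mz] creates the second matrix, [xM] removes the first, and the
    leftover z and x^f recombine into a q-commutator. *)
Lemma transition_RLL a b e f :
  R[fun c d => M (rev_ord d) f ** M (rev_ord c) e]_(a, b)
  = R[fun c d => M (rev_ord b) c ** M (rev_ord a) d]_(f, e).
Proof.
transitivity (R[fun c d => (M (rev_ord b) c ** z (rev_ord a)) ** x d
    - q *: ((M (rev_ord b) c ** x d) ** z (rev_ord a))]_(f, e)); last first.
  by apply: eq_Rsum => c d; rewrite /qcomm !(ba_Br mP) mZr !mA.
rewrite Rsum_lin -Rsum_mulr -xM -mA Mz Rsum_mull.
have -> : R[fun c d => (M (rev_ord b) c ** z (rev_ord a)) ** x d]_(f, e)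
   = R[fun c d => z (rev_ord d) ** (x f ** M (rev_ord c) e)]_(a, b).
  under eq_Rsum => c d do rewrite Mz Rsum_mulr.
  rewrite Rsum_exchange; apply: eq_Rsum => c d.
  by rewrite xM Rsum_mull; apply: eq_Rsum => u v; rewrite mA.
by rewrite -Rsum_lin; apply: eq_Rsum => c d; rewrite /qcomm (ba_Bl mP) mZl !mA.
Qed.

(** Splitting M_b^j gives two sums. In the one containing z x, [Mz] brings a z to the left, [T]
    collapses the sum over j to z [WN], and [Q] evaluates the braided product of the two z. Its
    q-multiple cancels the other sum; its metric part is the result. *)
Lemma transition_metric WN V a b :
  (forall h, \sum_j (rh j)^-1 *: (M h j ** x (rev_ord j))
     = (1 - q ^+ 2) *: (z h ** WN)) ->
  (forall i j, R[fun c d => z (rev_ord d) ** z (rev_ord c)]_(i, j)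
     = q *: (z (rev_ord j) ** z (rev_ord i))
       + (if j == rev_ord i then (k / rh i) *: V else 0)) ->
  (forall h, WN ** z h = z h ** WN) ->
  \sum_j rh j *: (M a (rev_ord j) ** M b j)
  = if b == rev_ord a then ((1 - q ^+ 2) * k * rh b) *: (V ** WN) else 0.
Proof.
move=> T Q WNz.
have Tr h : \sum_j rh j *: (M h (rev_ord j) ** x j) = (1 - q ^+ 2) *: (z h ** WN).
  rewrite -T (reindex_inj rev_ord_inj) /=.
  by apply: eq_bigr => j _; rewrite qrho_rev rev_ordK.
transitivity (\sum_j rh j *: (M a (rev_ord j) ** z b ** x j)
   - q *: ((\sum_j rh j *: (M a (rev_ord j) ** x j)) ** z b)).
  rewrite (ba_suml mP) scaler_sumr -sumrB; apply: eq_bigr => j _.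
  by rewrite {2}/qcomm (ba_Br mP) mZr mZl scalerBr !scalerA mulrC !mA.
have -> : \sum_j rh j *: (M a (rev_ord j) ** z b ** x j)
    = (1 - q ^+ 2) *: (R[fun c d => z (rev_ord d) ** z (rev_ord c)]_(rev_ord b, rev_ord a) ** WN).
  rewrite Rsum_mulr.
  transitivity (\sum_j R[fun c d => z (rev_ord d) ** (rh j *: (M (rev_ord c) (rev_ord j) ** x j))]_(rev_ord b, rev_ord a)).
    apply: eq_bigr => j _; rewrite -{1}[a]rev_ordK -{1}[b]rev_ordK Mz Rsum_mulr.
    rewrite scaler_sumr; apply: eq_bigr => c _; rewrite scaler_sumr; apply: eq_bigr => d _.
    by rewrite mZr !scalerA mulrC mA.
  rewrite exchange_big scaler_sumr; apply: eq_bigr => c _.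
  rewrite exchange_big scaler_sumr; apply: eq_bigr => d _ /=.
  by rewrite -scaler_sumr -(ba_sumr mP) Tr mZr !scalerA mulrC mA.
rewrite Q Tr mZl -mA WNz mA (ba_Dl mP) mZl !rev_ordK qrho_rev invrK.
rewrite scalerDr !scalerA [q * _]mulrC addrAC subrr add0r.
rewrite [b == _]eq_sym; case: ifP => _; last by rewrite (ba_0l mP) scaler0.
by rewrite mZl scalerA mulrA.
Qed.

End Relations.

End Transition.

(** * Exchanging the two middle indices for even N *)

Section Swap.
Variables (N : nat) (h : 'I_N).
Hypothesis h_mid : rev_ord h = h.+1 :> nat.
Implicit Types a b c d i j : 'I_N.

(* For even [N] the coordinates of labels 1 and -1 commute, so exchanging them
   preserves all relations; the frame axioms fail at label -1 and are obtained
   there by this exchange. *)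
Definition swap : 'S_N := tperm h (rev_ord h).

Lemma swapE i : swap i = (if i == h then rev_ord h else if i == rev_ord h then h else i).
Proof. by rewrite /swap; case: tpermP => [->|->|/eqP/negPf -> /eqP/negPf ->] //; rewrite ?eqxx //; case: eqP. Qed.

Lemma swapK : involutive swap.
Proof. exact: tpermK. Qed.

Lemma swap_rev i : swap (rev_ord i) = rev_ord (swap i).
Proof.
have [->|ih] := eqVneq i h; first by rewrite /swap tpermR tpermL rev_ordK.
have [->|ih'] := eqVneq i (rev_ord h); first by rewrite rev_ordK /swap tpermR tpermL.
rewrite /swap !tpermD //; first by rewrite eq_sym.
- by rewrite eq_sym.
- by rewrite eq_sym rev_ord_eq.
- by rewrite (inj_eq rev_ord_inj) eq_sym.
Qed.

Lemma swap_lt i j : j != rev_ord i -> (swap i < swap j)%N = (i < j)%N.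
Proof.
have iN := ltn_ord i; have jN := ltn_ord j; have hN := ltn_ord h.
rewrite !swapE; move: h_mid; rewrite -!val_eqE /= => hm.
by do !case: eqP; move=> *; apply/idP/idP => /=; lia.
Qed.

Variables (F : fieldType) (s : F).
Hypothesis s_neq0 : s != 0.

Local Notation rh i := (qrho N s (label i)).
Local Notation q := (qq s).
Local Notation k := (kk s).

Lemma qrho_h : rh h = 1.
Proof.
have hN := ltn_ord h; rewrite qrhoE ifT; last by move: h_mid => /=; lia.
by rewrite -[RHS](expr0z s); congr (_ ^ _); move: h_mid => /=; lia.
Qed.

Lemma qrho_swap i : rh (swap i) = rh i.
Proof.
by rewrite swapE; case: eqP => [->|_]; [|case: eqP => [->|_] //];
  rewrite qrho_rev qrho_h invr1.
Qed.

(** The swap can reverse the order only between opposite middle indices. There [rh] is 1, so the two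
    order-dependent terms, both multiplied by k, cancel. *)
Lemma Rhat_swap a b c d : Rhat s (swap a) (swap b) (swap c) (swap d) = Rhat s a b c d.
Proof.
rewrite !Rhat_entry -!swap_rev !(inj_eq perm_inj) !qrho_swap.
congr (_ + _ * _).
have [->|ba] := eqVneq b (rev_ord a); last by rewrite swap_lt.
have [->|da] := eqVneq d (rev_ord a); last by rewrite !andbF (swap_lt da).
rewrite rev_ordK [c == a]eq_sym /=.
have [aH|/norP[ah ah']] := boolP ((a == h) || (a == rev_ord h)); last first.
  by rewrite !swapE (negPf ah) (negPf ah') rev_ord_eq (negPf ah') (inj_eq rev_ord_inj) (negPf ah).
have -> : rh a = 1 by case/orP: aH => /eqP ->; rewrite ?qrho_rev qrho_h ?invr1.
have -> : rh (rev_ord a) = 1 by case/orP: aH => /eqP ->; rewrite ?rev_ordK ?qrho_rev qrho_h ?invr1.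
by rewrite invr1 !mulr1 !andbT !subrr.
Qed.

Variables (B : lmodType F) (m : B -> B -> B).
Hypothesis mP : bilinear_assoc m.
Local Notation "a ** b" := (m a b) (at level 40, left associativity).
Local Notation "'R[' f ]_( i , j )" :=
  (\sum_c \sum_d Rhat s i j c d *: f c d).

Lemma Rsum_swap (f : 'I_N -> 'I_N -> B) i j :
  R[fun c d => f (swap c) (swap d)]_(i, j) = R[f]_(swap i, swap j).
Proof.
rewrite [RHS](reindex_inj (@perm_inj _ swap)); apply: eq_bigr => c _.
rewrite [RHS](reindex_inj (@perm_inj _ swap)); apply: eq_bigr => d _.
by rewrite Rhat_swap.
Qed.

Section FrameSwap.
Variables (x : 'I_N -> B) (W : nat -> B) (z : B).
Hypothesis xW : qspace s m (fun i => x (swap i)) W.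
Hypothesis zf : frame s m (fun i => x (swap i)) W (rev_ord h) z.

Lemma frame_cross_swap i j :
  x i ** qcomm s m x z j = R[fun c d => qcomm s m x z c ** x d]_(i, j).
Proof.
have := frame_cross s_neq0 mP xW zf (swap i) (swap j).
rewrite /qcomm !swapK => ->.
by rewrite (Rsum_swap (fun c d => qcomm s m x z c ** x d)) !swapK.
Qed.

Lemma frame_telescope_swap :
  \sum_j (rh j)^-1 *: (qcomm s m x z j ** x (rev_ord j)) = (1 - q ^+ 2) *: (z ** W N).
Proof.
have := qcomm_telescope s_neq0 mP xW zf (leqnn N).
rewrite ltn_ord => <-; rewrite (reindex_inj (@perm_inj _ swap)) /=.
apply: eq_big => [j|j _]; first by rewrite ltn_ord.
by rewrite qrho_swap swap_rev.
Qed.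

End FrameSwap.

End Swap.

(** * Potentials and torus data *)

Section LinearCombination.
Variables (F : fieldType) (B : lmodType F) (u v w : B).

Inductive lexp :=
  LAtom0 | LAtom1 | LAtom2 | LZero
| LAdd of lexp & lexp | LOpp of lexp | LScale of F & lexp.

Fixpoint lexp_eval e : B := match e with
  | LAtom0 => u | LAtom1 => v | LAtom2 => w | LZero => 0
  | LAdd a b => lexp_eval a + lexp_eval b
  | LOpp a => - lexp_eval a
  | LScale c a => c *: lexp_eval a end.

Fixpoint lexp_coef (c0 c1 c2 : F) e : F := match e with
  | LAtom0 => c0 | LAtom1 => c1 | LAtom2 => c2 | LZero => 0
  | LAdd a b => lexp_coef c0 c1 c2 a + lexp_coef c0 c1 c2 b
  | LOpp a => - lexp_coef c0 c1 c2 a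
  | LScale c a => c * lexp_coef c0 c1 c2 a end.

Lemma lexp_evalE e : lexp_eval e = lexp_coef 1 0 0 e *: u
  + lexp_coef 0 1 0 e *: v + lexp_coef 0 0 1 e *: w.
Proof.
elim: e => [||||a IHa b IHb|a IHa|c a IHa] /=;
  rewrite ?scale1r ?scale0r ?addr0 ?add0r ?IHa ?IHb //.
- by rewrite !scalerDl addrACA [X in X + _ = _]addrACA.
- by rewrite !scaleNr !opprD.
by rewrite !scalerDr !scalerA.
Qed.

Lemma lexp_eq e f :
  lexp_coef 1 0 0 e = lexp_coef 1 0 0 f -> lexp_coef 0 1 0 e = lexp_coef 0 1 0 f ->
  lexp_coef 0 0 1 e = lexp_coef 0 0 1 f -> lexp_eval e = lexp_eval f.
Proof. by rewrite !lexp_evalE => -> -> ->. Qed.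

End LinearCombination.

Ltac lexp_reify F u v w t :=
  lazymatch t with
  | Algebra.zero => constr:(@LZero F)
  | u => constr:(@LAtom0 F) | v => constr:(@LAtom1 F) | w => constr:(@LAtom2 F)
  | Algebra.add ?a ?b => let a' := lexp_reify F u v w a in
      let b' := lexp_reify F u v w b in constr:(LAdd a' b')
  | Algebra.opp ?a => let a' := lexp_reify F u v w a in constr:(LOpp a')
  | GRing.scale ?c ?a => let a' := lexp_reify F u v w a in constr:(LScale c a')
  end.

(* [lincomb u v w] reduces an equality of linear combinations of [u], [v] and
   [w] to the equalities of their coefficients. *)
Tactic Notation "lincomb" constr(F) constr(B) constr(u) constr(v) constr(w) :=
  lazymatch goal with |- @eq _ ?a ?b =>
    let a' := lexp_reify F u v w a in let b' := lexp_reify F u v w b in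
    change (@lexp_eval F B u v w a' = @lexp_eval F B u v w b');
    apply: lexp_eq => /=
  end.

Section Potential.
Variables (F : fieldType) (N : nat) (s : F).
Implicit Types i j : 'I_N.

Local Notation rh i := (qrho N s (label i)).
Local Notation q := (qq s).
Local Notation k := (kk s).

(** The product x_i x_(-i) is U_(i+1) - q^-1 U_i above the middle and U_i - q U_(i+1) below it. With
    W_p = [gap_weight p] U_p both become [rh i] (W_(i+1) - W_i), a plain difference that telescopes
    over the whole range; this dictates the powers of s and the sign below the middle. *)
Definition gap_weight (p : nat) : F :=
  if (N < 2 * p)%N then s ^ (2 * p%:Z - N%:Z - 2)
  else if (2 * p < N)%N then - s ^ (2 * p%:Z - N%:Z + 2) else 0.

Hypothesis s_neq0 : s != 0.
Let q_neq0 : q != 0. Proof. exact: expf_neq0. Qed.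

Lemma qrho_gap_hi i : (rev_ord i < i)%N -> rh i * gap_weight i.+1 = 1.
Proof.
have iN := ltn_ord i => /= ii'; rewrite qrhoE !ifF ?/gap_weight ?ifT; try lia.
by rewrite -expfzDr // -[RHS](expr0z s); congr (_ ^ _); lia.
Qed.

Lemma qrho_gap_hi_below i : (N < 2 * i)%N -> rh i * gap_weight i = q^-1.
Proof.
have iN := ltn_ord i => /= ii'; rewrite qrhoE !ifF ?/gap_weight ?ifT; try lia.
by rewrite /qq -[s ^+ 2]/(s ^ 2%:Z) invr_expz -expfzDr //; congr (_ ^ _); lia.
Qed.

Lemma qrho_gap_lo i : (2 * i.+1 < N)%N -> rh i * gap_weight i.+1 = - q.
Proof.
have iN := ltn_ord i => /= ii'; rewrite qrhoE ifT /gap_weight 1?ifF ?ifT; try lia.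
by rewrite mulrN /qq -[s ^+ 2]/(s ^ 2%:Z) -expfzDr //; congr (- _ ^ _); lia.
Qed.

Lemma qrho_gap_lo_below i : (i < rev_ord i)%N -> rh i * gap_weight i = -1.
Proof.
have iN := ltn_ord i => /= ii'; rewrite qrhoE ifT /gap_weight 1?ifF ?ifT; try lia.
by rewrite mulrN -expfzDr // -[in RHS](expr0z s); congr (- _ ^ _); lia.
Qed.

Lemma gap_weight_mid i : i = rev_ord i -> gap_weight i.+1 = s^-1 /\ gap_weight i = - s.
Proof.
move=> /(congr1 val) /= e; have iN := ltn_ord i; rewrite /gap_weight; split.
  by rewrite ifT; [rewrite -[RHS]exprN1; congr (_ ^ _)|]; lia.
by rewrite ifF 1?ifT; [rewrite -[in RHS](expr1z s); congr (- _ ^ _)|..]; lia.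
Qed.

Variables (B : lmodType F) (m : B -> B -> B).
Local Notation "a ** b" := (m a b) (at level 40, left associativity).

Lemma qspace_of_pairs (x : 'I_N -> B) (U : nat -> B) :
  (forall i j, (i < j)%N -> j != rev_ord i -> x i ** x j = q *: (x j ** x i)) ->
  (forall i, (rev_ord i < i)%N -> x i ** x (rev_ord i) = U i.+1 - q^-1 *: U i) ->
  (forall i, (rev_ord i < i)%N -> x (rev_ord i) ** x i = U i.+1 - q *: U i) ->
  (forall i, i = rev_ord i -> x i ** x i = (s + s^-1) *: U i) ->
  (forall p, (p <= N)%N -> U (N - p)%N = U p) ->
  (forall p, (2 * p = N)%N -> U p = 0) ->
  qspace s m x (fun p => gap_weight p *: U p).
Proof.
move=> xx hi lo mid sym U0.
have Urev i : U (rev_ord i) = U i.+1 by rewrite /= sym.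
have Urev1 i : U (rev_ord i).+1 = U i.
  by have iN := ltn_ord i; rewrite -sym /=; [congr U|]; lia.
(* The gap just below i may be the middle gap of even N; both sides are then 0, because U vanishes
   there. *)
have below_hi i : (rev_ord i < i)%N -> (rh i * gap_weight i) *: U i = q^-1 *: U i.
  move=> ii'; have [c|c] : (N < 2 * i)%N \/ (2 * i = N)%N.
    by have := ltn_ord i; move: ii' => /=; lia.
    by rewrite qrho_gap_hi_below.
  by rewrite U0 // !scaler0.
split=> // i.
- rewrite scalerBr !scalerA; have iN := ltn_ord i.
  have [ii'|ii'|/val_inj ii'] := ltngtP i (rev_ord i).
  + have := lo (rev_ord i); rewrite rev_ordK => -> //.
    rewrite qrho_gap_lo_below // Urev1 Urev scaleN1r opprK.
    have [c|c] : (2 * i.+1 < N)%N \/ (2 * i.+1 = N)%N by move: ii' => /=; lia.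
      by rewrite qrho_gap_lo // scaleNr addrC.
    by rewrite [U i.+1]U0 // !scaler0 add0r subr0.
  + by rewrite qrho_gap_hi // scale1r below_hi // hi.
  + have [-> ->] := gap_weight_mid ii'.
    rewrite qrho_mid // !mul1r scaleNr opprK -ii' mid // -(Urev i) -ii' -scalerDl.
    by rewrite addrC.
- move=> ii'; have iN := ltn_ord i.
  have -> : (k / rh i) *: (gap_weight (rev_ord i) *: U (rev_ord i))
      = k *: ((rh (rev_ord i) * gap_weight (rev_ord i)) *: U (rev_ord i)).
    by rewrite qrho_rev !scalerA mulrA.
  have [c|c|/val_inj c] := ltngtP i (rev_ord i); last by rewrite -c eqxx in ii'.
    rewrite below_hi ?rev_ordK //.
    have := lo (rev_ord i); have := hi (rev_ord i); rewrite rev_ordK => -> // -> //.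
    by lincomb F B (U (rev_ord i).+1) (U (rev_ord i)) (0 : B); rewrite /kk; field.
  rewrite qrho_gap_lo_below ?rev_ordK // hi // lo // Urev.
  by lincomb F B (U i.+1) (U i) (0 : B); rewrite /kk; field.
move=> ii'; have [_ ->] := gap_weight_mid ii'; rewrite mid //.
rewrite !scalerA -scalerDl; congr (_ *: _); rewrite /kk /qq; field.
by rewrite s_neq0.
Qed.

End Potential.

Section QCommutation.
Variables (F : fieldType) (B : lmodType F) (m : B -> B -> B).
Hypothesis mP : bilinear_assoc m.
Implicit Types (a b : B) (c d t : F).
Local Notation "a ** b" := (m a b) (at level 40, left associativity).

Definition qcommutes c a b := a ** b = c *: (b ** a).

Local Notation qc := qcommutes.

Lemma qc_mr c d e a b b' : qc c a b -> qc d a b' -> e = c * d -> qc e a (b ** b').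
Proof.
rewrite /qcommutes => ab ab' ->.
by rewrite (ba_assoc mP) ab (ba_Zl mP) -!(ba_assoc mP) ab' (ba_Zr mP) scalerA.
Qed.

Lemma qc_ml c d e a a' b : qc c a b -> qc d a' b -> e = c * d -> qc e (a ** a') b.
Proof.
rewrite /qcommutes => ab a'b ->.
by rewrite -(ba_assoc mP) a'b (ba_Zr mP) !(ba_assoc mP) ab (ba_Zl mP) scalerA mulrC.
Qed.

Lemma qc_zr c t a b : qc c a b -> qc c a (t *: b).
Proof. by rewrite /qcommutes (ba_Zl mP) (ba_Zr mP) => ->; rewrite !scalerA mulrC. Qed.

Lemma qc_zl c t a b : qc c a b -> qc c (t *: a) b.
Proof. by rewrite /qcommutes (ba_Zl mP) (ba_Zr mP) => ->; rewrite !scalerA mulrC. Qed.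

Lemma qc_sym c d a b : d * c = 1 -> qc c a b -> qc d b a.
Proof. by rewrite /qcommutes => dc ->; rewrite scalerA dc scale1r. Qed.

Lemma qc_refl a : qc 1 a a.
Proof. by rewrite /qcommutes scale1r. Qed.

Lemma qc1P a b : qc 1 a b -> a ** b = b ** a.
Proof. by rewrite /qcommutes scale1r. Qed.

End QCommutation.

Section Torus.
Variables (F : fieldType) (N : nat) (s : F).
Variables (B : lmodType F) (m : B -> B -> B) (e : B).
Hypotheses (s_neq0 : s != 0) (mP : bilinear_assoc m).
Hypothesis q_neqV : kk s != 0.
Hypotheses (m1l : left_id e m) (m1r : right_id e m).
Implicit Types (h i j : 'I_N) (x D : 'I_N -> B) (U V : nat -> B) (p r : nat).

Local Notation rh i := (qrho N s (label i)).
Local Notation q := (qq s).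
Local Notation k := (kk s).
Local Notation "a ** b" := (m a b) (at level 40, left associativity).
Local Notation qc := (qcommutes m).

Let q_neq0 : q != 0. Proof. exact: expf_neq0. Qed.
Let q2_neq1 : 1 - q ^+ 2 != 0.
Proof.
have -> : 1 - q ^+ 2 = - (q * k) by rewrite /kk; field.
by rewrite oppr_eq0 mulf_neq0.
Qed.

Let qq_neq1 : q * q - 1 != 0.
Proof. by rewrite -expr2 -oppr_eq0 opprB. Qed.

(** The potential of gap p is a multiple of a squared radius, and p and N - p bound the positions
    within that radius. A coordinate above this interval passes the square with q^-2, one below with
    q^2, and one inside commutes with it. *)
Definition gap_exp (i p : nat) : F :=
  if (maxn p (N - p) <= i)%N then q ^- 2
  else if (i < minn p (N - p))%N then q ^+ 2 else 1.

(* [U p] is the potential of the gap between the positions [p - 1] and [p], [V p]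
   its inverse and [D i] the diagonal entry of the image of the Borel part.  For
   even [N] the potential of the middle gap vanishes. *)
Record torus x D U V : Prop := Torus {
  torus_comm : forall i j, (i < j)%N -> j != rev_ord i ->
    x i ** x j = q *: (x j ** x i);
  torus_hi : forall i, (rev_ord i < i)%N ->
    x i ** x (rev_ord i) = U i.+1 - q^-1 *: U i;
  torus_lo : forall i, (rev_ord i < i)%N ->
    x (rev_ord i) ** x i = U i.+1 - q *: U i;
  torus_mid : forall i, i = rev_ord i -> x i ** x i = (s + s^-1) *: U i;
  torus_symU : forall p, (p <= N)%N -> U (N - p)%N = U p;
  torus_symV : forall p, (p <= N)%N -> V (N - p)%N = V p;
  torus_U0 : forall p, (2 * p = N)%N -> U p = 0;
  torus_V0 : forall p, (2 * p = N)%N -> V p = 0;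
  torus_UV : forall p, (p <= N)%N -> 2 * p != N -> U p ** V p = e;
  torus_VU : forall p, (p <= N)%N -> 2 * p != N -> V p ** U p = e;
  torus_VV : forall p r, (p <= N)%N -> (r <= N)%N -> V p ** V r = V r ** V p;
  torus_xU : forall i p, (p <= N)%N -> qc (gap_exp i p) (x i) (U p);
  torus_xV : forall i p, (p <= N)%N -> qc (gap_exp i p)^-1 (x i) (V p);
  torus_DD : forall i, D i ** D (rev_ord i) = e;
  torus_Dx : forall i j, i != j -> i != rev_ord j -> qc 1 (x j) (D i);
  torus_Dx_diag : forall i, i != rev_ord i -> qc q (x i) (D i);
  torus_Dx_opp : forall i, i != rev_ord i -> qc q^-1 (x (rev_ord i)) (D i);
  torus_Dmid : forall i, i = rev_ord i -> D i = e;
  torus_DV : forall i p, (p <= N)%N -> qc 1 (D i) (V p);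
  torus_DcD : forall i j, qc 1 (D i) (D j) }.

Definition mid_pair h := (rev_ord h == h.+1 :> nat).

(** The scalars normalize the q-commutator of z_h with x_h to D_h; see [torus_qcomm_z]. If h is the
    lower index of the middle pair, then [V h.+1] is 0, and the next gap [h.+2] is used, the one
    that already serves [rev_ord h]. *)
Definition torus_z x D V h : B :=
  if mid_pair h then (1 - q ^+ 2)^-1 *: (D h ** V h.+2 ** x (rev_ord h))
  else (if (rev_ord h < h)%N then (1 - q ^+ 2)^-1
        else if (h < rev_ord h)%N then k^-1 else s / (1 - q ^+ 2))
       *: (D h ** V h.+1 ** x (rev_ord h)).

Section Basic.
Variables (x D : 'I_N -> B) (U V : nat -> B).
Hypothesis xDUV : torus x D U V.
Let z := torus_z x D V.
Let W p := gap_weight N s p *: U p.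
(** Up to sign, the constant is the product of the scalars (1 - q^2)^-1 and k^-1 occurring in the z
    of opposite indices, since 1 - q^2 = - q k. *)
Let U' p := (q^-1 * k ^- 2) *: V p.
Let W' p := gap_weight N s p *: U' p.

Lemma torus_qspace : qspace s m x W.
Proof. by case: xDUV => *; apply: qspace_of_pairs. Qed.

(** The powers of q contributed by D_h, V and x_(-h) multiply to q^-1 below h and q above h. The
    exception is the middle pair: there [rev_ord h] lies above h but gets q^-1, which violates
    [frame_gt] and makes the swap necessary. *)
Lemma qc_xz i h : i != h -> qc (if (i < h)%N || (mid_pair h && (i == rev_ord h)) then q^-1 else q) (x i) (z h).
Proof.
move=> ih; have iN := ltn_ord i; have hN := ltn_ord h.
have xD : qc (if i == rev_ord h then q^-1 else 1) (x i) (D h).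
  have [e'|ih'] := eqVneq i (rev_ord h).
    by rewrite e' in ih *; apply: (torus_Dx_opp xDUV); rewrite eq_sym.
  by apply: (torus_Dx xDUV); rewrite eq_sym // rev_ord_eq.
have xx : qc (if i == rev_ord h then 1 else if (i < rev_ord h)%N then q else q^-1) (x i) (x (rev_ord h)).
  have [->|ih'] := eqVneq i (rev_ord h); first exact: qc_refl.
  case: ltngtP => [c|c|/val_inj c]; last by rewrite c eqxx in ih'.
    by apply: (torus_comm xDUV) => //; rewrite (inj_eq rev_ord_inj) eq_sym.
  apply: (@qc_sym _ _ _ q); rewrite ?mulVf //.
  by apply: (torus_comm xDUV); rewrite ?rev_ordK.
rewrite /z /torus_z; move: xD xx ih; rewrite -!val_eqE /= => xD xx ih.
have [mh|mh] := boolP (mid_pair h); apply: (qc_zr mP).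
  have h2 : (h.+2 <= N)%N by move: mh; rewrite /mid_pair /=; lia.
  apply: (qc_mr mP (qc_mr mP xD (torus_xV xDUV i h2) erefl) xx).
  by rewrite /gap_exp; move: mh; rewrite /mid_pair /= => mh; split_ifs; field; rewrite ?q_neq0 ?oner_neq0.
apply: (qc_mr mP (qc_mr mP xD (torus_xV xDUV i hN) erefl) xx).
by rewrite /gap_exp; move: mh; rewrite /mid_pair /= => mh; split_ifs; field; rewrite ?q_neq0 ?oner_neq0.
Qed.

Lemma qc_Dx i j : qc (if i == rev_ord i then 1 else
   if j == i then q^-1 else if j == rev_ord i then q else 1) (D i) (x j).
Proof.
have [ii'|ii'] := eqVneq i (rev_ord i).
  by rewrite (torus_Dmid xDUV ii') -[qc _ _ _]/(_ = _) m1l m1r scale1r.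
have [->|ji] := eqVneq j i.
  by apply: qc_sym (torus_Dx_diag xDUV ii'); rewrite mulVf.
have [->|ji'] := eqVneq j (rev_ord i).
  by apply: qc_sym (torus_Dx_opp xDUV ii'); rewrite mulfV.
apply: qc_sym (mul1r 1) _; apply: (torus_Dx xDUV); first by rewrite eq_sym.
by rewrite eq_sym rev_ord_eq.
Qed.

Lemma qc_Dz i j : qc (if i == rev_ord i then 1 else
   if j == rev_ord i then q^-1 else if j == i then q else 1) (D i) (z j).
Proof.
have := qc_Dx i (rev_ord j); rewrite rev_ord_eq (inj_eq rev_ord_inj) => Dx.
have DD := torus_DcD xDUV i j; have jN := ltn_ord j.
rewrite /z /torus_z; case: (boolP (mid_pair j)) => mj; apply: (qc_zr mP).
  have j2 : (j.+2 <= N)%N by move: mj; rewrite /mid_pair /=; lia.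
  by apply: (qc_mr mP (qc_mr mP DD (torus_DV xDUV i j2) erefl) Dx); rewrite !mul1r.
by apply: (qc_mr mP (qc_mr mP DD (torus_DV xDUV i jN) erefl) Dx); rewrite !mul1r.
Qed.

Section Generic.
Variable h : 'I_N.
Hypothesis not_mid : ~~ mid_pair h.

Let DV := D h ** V h.+1.

Let gapN : (2 * h.+1)%N != N.
Proof. by have := ltn_ord h; move: not_mid; rewrite /mid_pair /=; lia. Qed.

Let DVU : DV ** U h.+1 = D h.
Proof. by rewrite /DV -(ba_assoc mP) (torus_VU xDUV (ltn_ord h) gapN) m1r. Qed.

Let zE : z h = (if (rev_ord h < h)%N then (1 - q ^+ 2)^-1
        else if (h < rev_ord h)%N then k^-1 else s / (1 - q ^+ 2)) *: (DV ** x (rev_ord h)).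
Proof. by rewrite /z /torus_z (negPf not_mid). Qed.

Let gap_h : gap_exp h h.+1 = if (h < rev_ord h)%N then q ^+ 2 else 1.
Proof.
have hN := ltn_ord h; move: not_mid; rewrite /mid_pair /gap_exp /= => hm.
by split_ifs.
Qed.

(** With D_h V moved to the left, the q-commutator is a combination of the potentials of the two
    gaps adjacent to h, or of the single one at a self-opposite index. In the first case the
    potential not inverted by V drops out; the other leaves D_h. *)
Lemma torus_qcomm_z : qcomm s m x (z h) h = D h.
Proof.
have hN := ltn_ord h.
have xDV : x h ** DV = ((if h == rev_ord h then 1 else q) / gap_exp h h.+1) *: (DV ** x h).
  have xD : qc (if h == rev_ord h then 1 else q) (x h) (D h).
    have [hh|hh] := eqVneq h (rev_ord h); last exact: (torus_Dx_diag xDUV).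
    by rewrite (torus_Dmid xDUV hh) -[qc _ _ _]/(_ = _) m1l m1r scale1r.
  exact: (qc_mr mP xD (torus_xV xDUV h hN) erefl).
rewrite /qcomm zE (ba_Zl mP) (ba_Zr mP) (ba_assoc mP) xDV (ba_Zl mP) -!(ba_assoc mP DV) gap_h.
have DVUe p : U p = U h.+1 -> DV ** U p = D h by move=> ->; exact: DVU.
have [hh|hh|/val_inj hh] := ltngtP h (rev_ord h).
- rewrite ifF; last by apply/negP => /eqP e'; move: hh; rewrite -e' ltnn.
  have := torus_hi xDUV (i := rev_ord h); have := torus_lo xDUV (i := rev_ord h).
  rewrite rev_ordK => -> // -> //; rewrite !(ba_Br mP) !(ba_Zr mP).
  rewrite [DV ** U (rev_ord h)]DVUe; last by rewrite /= (torus_symU xDUV).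
  lincomb F B (DV ** U (rev_ord h).+1) (D h) (0 : B); rewrite /kk; field; rewrite ?q_neq0 ?qq_neq1 ?oner_neq0 ?q2_neq1 //.
- rewrite ifF; last by apply/negP => /eqP e'; move: hh; rewrite -e' ltnn.
  rewrite (torus_hi xDUV hh) (torus_lo xDUV hh) !(ba_Br mP) !(ba_Zr mP) DVU.
  lincomb F B (DV ** U h) (D h) (0 : B); field; rewrite ?q_neq0 ?qq_neq1 ?oner_neq0 ?q2_neq1 //.
- rewrite ifT; last by apply/eqP.
  rewrite -hh (torus_mid xDUV hh) (ba_Zr mP) [DV ** U h]DVUe; last first.
    by rewrite -[RHS](torus_symU xDUV) //; congr U; rewrite {1}hh /=; lia.
  rewrite !scalerA -scalerBl -[RHS]scale1r; congr (_ *: _); move: q2_neq1; rewrite /qq => s4.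
  by field; rewrite s_neq0 ?oner_neq0 s4.
Qed.

Lemma torus_frame : frame s m x W h (z h).
Proof.
have hN := ltn_ord h; have hm := not_mid; split; rewrite ?torus_qcomm_z.
- move=> i ih; have := @qc_xz i h; rewrite ih => H; apply: H.
  by apply: contraL ih => /eqP ->; rewrite ltnn.
- move=> i hi; have := @qc_xz i h; rewrite ltnNge (ltnW hi) (negPf hm) /= => H; apply: H.
  by apply: contraL hi => /eqP ->; rewrite ltnn.
- move=> i ih ih'; have := torus_Dx xDUV (i := h) (j := i).
  rewrite eq_sym ih eq_sym rev_ord_eq ih' => H.
  by rewrite (H isT isT) scale1r.
- by move=> hh; apply: (torus_Dx_diag xDUV).
- move=> hh; have := qc_Dx h (rev_ord h).
  by rewrite (negPf hh) eqxx [_ == h]eq_sym (negPf hh).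
- by move=> hh; have := qc_Dx h h; rewrite -hh eqxx => /(qc_sym (mul1r 1)) ->; rewrite scale1r.
(* For [frame_pair], [U h.+1] moves left past [x (rev_ord h)] and cancels the V inside z; a scalar
   identity between [gap_weight], [gap_exp] and the normalization remains. *)
rewrite /W (ba_Zr mP) zE (ba_Zl mP).
have xU := torus_xU xDUV (rev_ord h) hN.
rewrite -[DV ** _ ** _](ba_assoc mP) xU (ba_Zr mP) (ba_assoc mP) DVU !scalerA.
rewrite -[LHS]scale1r; congr (_ *: _).
have E c0 g0 : (1 - q ^+ 2) * rh h * (gap_weight N s h.+1 * c0 * g0)
    = (1 - q ^+ 2) * c0 * g0 * (rh h * gap_weight N s h.+1) by ring.
rewrite {}E /gap_exp; have [hh|hh|/val_inj hh] := ltngtP h (rev_ord h).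
- rewrite (qrho_gap_lo s_neq0); last by move: hh hm; rewrite /mid_pair /=; lia.
  rewrite ifT; last by move: hh hm; rewrite /mid_pair /=; lia.
  by rewrite /kk; field; rewrite ?q_neq0 ?qq_neq1 ?oner_neq0 ?q2_neq1 //.
- rewrite (qrho_gap_hi s_neq0) // !ifF; try by move: hh hm; rewrite /mid_pair /=; lia.
  by field; rewrite ?q_neq0 ?qq_neq1 ?oner_neq0 ?q2_neq1 //.
have [-> _] := gap_weight_mid s_neq0 hh; rewrite qrho_mid // !ifF; try by move: (congr1 val hh) hm; rewrite /mid_pair /=; lia.
by field; rewrite ?s_neq0 ?q_neq0 ?qq_neq1 ?oner_neq0 ?q2_neq1 //.
Qed.

End Generic.

Lemma qc_VV p r : (p <= N)%N -> (r <= N)%N -> qc 1 (V p) (V r).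
Proof. by move=> pN rN; rewrite -[qc _ _ _]/(_ = _) scale1r; apply: (torus_VV xDUV). Qed.

Lemma torus_dual_comm i j : (i < j)%N -> j != rev_ord i -> qc q (z i) (z j).
Proof.
move=> ij ji'; have iN := ltn_ord i; have jN := ltn_ord j.
have nij : (i == j) = false by rewrite -val_eqE /=; lia.
have zD : qc 1 (z i) (D j).
  apply: qc_sym (mul1r 1) _; have := qc_Dz j i.
  rewrite eq_sym rev_ord_eq in ji'; rewrite (negPf ji').
  by rewrite nij if_same.
have zx : qc (if (rev_ord j < i)%N then q else q^-1) (z i) (x (rev_ord j)).
  have ne : rev_ord j != i by rewrite rev_ord_eq.
  have := qc_xz ne; rewrite (inj_eq rev_ord_inj) [j == i]eq_sym nij andbF orbF.
  by apply: qc_sym; case: ifP => _; rewrite ?mulfV ?mulVf.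
have zV r : (r <= N)%N -> r = (if mid_pair j then j.+2 else j.+1) ->
    qc (if (rev_ord j < i)%N then 1 else q ^+ 2) (z i) (V r).
  move=> rN er.
  have xV := torus_xV xDUV (rev_ord i) rN.
  have Vi p : (p <= N)%N -> qc (if (rev_ord j < i)%N then 1 else q ^+ 2)
      (D i ** V p ** x (rev_ord i)) (V r).
    move=> pN; apply: (qc_ml mP (qc_ml mP (torus_DV xDUV i rN) (qc_VV pN rN) erefl) xV).
    move: ji' er; rewrite /gap_exp /mid_pair -val_eqE /= => ji'; case: ifP => mj ->.
      by split_ifs; field; rewrite ?q_neq0 ?oner_neq0.
    by split_ifs; field; rewrite ?q_neq0 ?oner_neq0.
  rewrite /z /torus_z; case: (boolP (mid_pair i)) => mi; apply: (qc_zl mP); apply: Vi => //.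
  by move: mi; rewrite /mid_pair /=; lia.
rewrite {2}/z /torus_z; case: (boolP (mid_pair j)) => mj; apply: (qc_zr mP).
  have j2 : (j.+2 <= N)%N by move: mj; rewrite /mid_pair /=; lia.
  have := zV _ j2; rewrite mj => /(_ erefl) zVj.
  apply: (qc_mr mP (qc_mr mP zD zVj erefl) zx).
  by case: ifP => _; field; rewrite ?q_neq0 ?oner_neq0.
have := zV _ jN; rewrite (negPf mj) => /(_ erefl) zVj.
apply: (qc_mr mP (qc_mr mP zD zVj erefl) zx).
by case: ifP => _; field; rewrite ?q_neq0 ?oner_neq0.
Qed.

(** D_(-i) moves left until it meets D_i and cancels. What is left is two inverse potentials times
    the opposite product, to which [torus_hi] or [torus_lo] applies. *)
Lemma torus_prod i p r : i != rev_ord i -> (p <= N)%N -> (r <= N)%N ->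
  (D i ** V p ** x (rev_ord i)) ** (D (rev_ord i) ** V r ** x i)
  = (q / gap_exp (rev_ord i) r) *: (V p ** V r ** (x (rev_ord i) ** x i)).
Proof.
move=> ii' pN rN; have ii'' : rev_ord i != rev_ord (rev_ord i).
  by rewrite rev_ordK eq_sym.
have xDV := qc_mr mP (torus_Dx_diag xDUV ii'') (torus_xV xDUV (rev_ord i) rN) erefl.
have VD : V p ** D (rev_ord i) = D (rev_ord i) ** V p.
  by have := torus_DV xDUV (rev_ord i) pN => ->; rewrite scale1r.
rewrite -[LHS](ba_assoc mP) [x _ ** (_ ** x i)](ba_assoc mP) xDV.
rewrite (ba_Zl mP) (ba_Zr mP) -!(ba_assoc mP); congr (_ *: _).
by rewrite [V p ** (D _ ** _)](ba_assoc mP) VD -!(ba_assoc mP) [D i ** _](ba_assoc mP) (torus_DD xDUV) m1l.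
Qed.

Lemma torus_VVU p r : (p <= N)%N -> (r <= N)%N -> (2 * r)%N != N ->
  V p ** V r ** U r = V p.
Proof. by move=> pN rN r2; rewrite -(ba_assoc mP) (torus_VU xDUV) // m1r. Qed.

(** Multiplying [torus_lo] by the inverse potentials of both adjacent gaps leaves their difference.
    If the lower gap is the middle one, its U and V are 0, and both z carry the V of the upper gap
    instead. *)
Lemma torus_dual_hi i : (rev_ord i < i)%N -> z i ** z (rev_ord i) = U' i.+1 - q^-1 *: U' i.
Proof.
move=> ii'; have iN := ltn_ord i.
have mi : ~~ mid_pair i by move: ii'; rewrite /mid_pair /=; lia.
have ne : i != rev_ord i by move: ii'; rewrite -val_eqE /=; lia.
rewrite /z /torus_z (negPf mi) ii'; case: (boolP (mid_pair _)) => mi'.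
  have er : (rev_ord i).+2 = i.+1 by move: mi'; rewrite /mid_pair /=; lia.
  have U0 : U i = 0 by apply: (torus_U0 xDUV); move: mi'; rewrite /mid_pair /=; lia.
  have V0 : V i = 0 by apply: (torus_V0 xDUV); move: mi'; rewrite /mid_pair /=; lia.
  rewrite rev_ordK er (ba_Zl mP) (ba_Zr mP) torus_prod // (torus_lo xDUV ii') U0 scaler0 subr0.
  rewrite torus_VVU //; last by move: ii' => /=; lia.
  rewrite /U' V0 /gap_exp !ifF; try by move: mi'; rewrite /mid_pair /=; lia.
  by lincomb F B (V i.+1) (0 : B) (0 : B); rewrite /kk; field; rewrite ?q_neq0 ?qq_neq1 ?oner_neq0 ?q2_neq1 //.
have er : V (rev_ord i).+1 = V i.
  by rewrite -(torus_symV xDUV) /=; [congr V|]; lia.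
have c2 : (N < 2 * i)%N by move: mi' ii'; rewrite /mid_pair /=; lia.
rewrite rev_ordK ltnNge (ltnW ii') /= ii' er (ba_Zl mP) (ba_Zr mP) torus_prod //; last exact: ltnW.
rewrite (torus_lo xDUV ii') (ba_Br mP) (ba_Zr mP).
rewrite [V _ ** V i](torus_VV xDUV) ?(ltnW iN) // torus_VVU ?(ltnW iN) //; last lia.
rewrite (torus_VV xDUV) ?(ltnW iN) // torus_VVU ?(ltnW iN) //; last by lia.
rewrite /U' /gap_exp ifF ?ifT; try by move: ii' => /=; lia.
by lincomb F B (V i.+1) (V i) (0 : B); rewrite /kk; field; rewrite ?q_neq0 ?qq_neq1 ?oner_neq0 ?q2_neq1 //.
Qed.

Lemma torus_dual_lo i : (rev_ord i < i)%N -> z (rev_ord i) ** z i = U' i.+1 - q *: U' i.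
Proof.
move=> ii'; have iN := ltn_ord i.
have mi : ~~ mid_pair i by move: ii'; rewrite /mid_pair /=; lia.
have ne : rev_ord i != rev_ord (rev_ord i) by move: ii'; rewrite -val_eqE /=; lia.
have prod p r (pN : (p <= N)%N) (rN : (r <= N)%N) := torus_prod ne pN rN.
rewrite rev_ordK in prod.
have gap_i : gap_exp i i.+1 = 1 by rewrite /gap_exp !ifF //; move: ii' => /=; lia.
rewrite /z /torus_z (negPf mi) ii'; case: (boolP (mid_pair _)) => mi'.
  have er : (rev_ord i).+2 = i.+1 by move: mi'; rewrite /mid_pair /=; lia.
  have U0 : U i = 0 by apply: (torus_U0 xDUV); move: mi'; rewrite /mid_pair /=; lia.
  have V0 : V i = 0 by apply: (torus_V0 xDUV); move: mi'; rewrite /mid_pair /=; lia.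
  rewrite rev_ordK er (ba_Zl mP) (ba_Zr mP) prod // (torus_hi xDUV ii') U0 scaler0 subr0.
  rewrite torus_VVU //; last by move: ii' => /=; lia.
  rewrite /U' V0 gap_i.
  by lincomb F B (V i.+1) (0 : B) (0 : B); rewrite /kk; field; rewrite ?q_neq0 ?qq_neq1 ?oner_neq0 ?q2_neq1 //.
have er : V (rev_ord i).+1 = V i.
  by rewrite -(torus_symV xDUV) /=; [congr V|]; lia.
have c2 : (N < 2 * i)%N by move: mi' ii'; rewrite /mid_pair /=; lia.
rewrite rev_ordK ltnNge (ltnW ii') /= ii' er (ba_Zl mP) (ba_Zr mP) prod //; last exact: ltnW.
rewrite (torus_hi xDUV ii') (ba_Br mP) (ba_Zr mP) torus_VVU ?(ltnW iN) //; last lia.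
rewrite (torus_VV xDUV) ?(ltnW iN) // torus_VVU ?(ltnW iN) //; last by lia.
rewrite /U' gap_i.
by lincomb F B (V i.+1) (V i) (0 : B); rewrite /kk; field; rewrite ?q_neq0 ?qq_neq1 ?oner_neq0 ?q2_neq1 //.
Qed.

Lemma torus_dual_mid i : i = rev_ord i -> z i ** z i = (s + s^-1) *: U' i.
Proof.
move=> ii'; have iN := ltn_ord i; have ei := congr1 val ii'; rewrite /= in ei.
have mi : ~~ mid_pair i by rewrite /mid_pair /=; lia.
have gap_i : gap_exp i i.+1 = 1 by rewrite /gap_exp !ifF //; lia.
have xV := torus_xV xDUV i iN; rewrite gap_i invr1 in xV.
have UE : U i = U i.+1 by rewrite -(torus_symU xDUV iN); congr U; lia.
have VE : V i = V i.+1 by rewrite -(torus_symV xDUV iN); congr V; lia.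
rewrite /z /torus_z (negPf mi) -ii' ltnn (torus_Dmid xDUV ii') m1l.
rewrite (ba_Zl mP) (ba_Zr mP) -!(ba_assoc mP) [x i ** (_ ** _)](ba_assoc mP) xV scale1r.
rewrite -!(ba_assoc mP) (torus_mid xDUV ii') UE !(ba_Zr mP) (ba_assoc mP) torus_VVU //; last lia.
rewrite /U' VE !scalerA; congr (_ *: _); move: q2_neq1 q_neqV; rewrite /kk /qq => s4 s4'.
by field; rewrite s_neq0 ?oner_neq0 s4 -expr2 -oppr_eq0 opprB s4.
Qed.

Lemma torus_dual_qspace : qspace s (fun a b => m b a) (fun i => z (rev_ord i)) W'.
Proof.
apply: qspace_of_pairs => //.
- move=> i j ij ji'; apply: torus_dual_comm; last by rewrite (inj_eq rev_ord_inj) -rev_ord_eq eq_sym.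
  by have := ltn_ord j; rewrite /=; lia.
- by move=> i ii'; rewrite rev_ordK torus_dual_hi.
- by move=> i ii'; rewrite rev_ordK torus_dual_lo.
- by move=> i ii'; rewrite -ii' torus_dual_mid.
- by move=> p pN; rewrite /U' (torus_symV xDUV).
- by move=> p pN; rewrite /U' (torus_V0 xDUV) ?scaler0.
Qed.

End Basic.

(** The middle potential is 0, so [torus_hi] and [torus_lo] give the same value at the middle pair
    and may be interchanged. [gap_exp] notices the swap only at the middle gap, where U and V
    vanish. *)
Lemma torus_swap h x D U V : mid_pair h -> torus x D U V ->
  torus (fun i => x (swap h i)) (fun i => D (swap h i)) U V.
Proof.
move=> /eqP hm T; have hN := ltn_ord h.
have Hlt i : (rev_ord i < i)%N -> i = rev_ord h \/ swap h i = i /\ swap h (rev_ord i) = rev_ord i.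
  move=> ii'; have [->|ih'] := eqVneq i (rev_ord h); [by left|right].
  have si : swap h i = i.
    rewrite swapE (negPf ih') ifF //; apply/negP => /eqP e'.
    by move: hm ii'; rewrite e' /=; lia.
  by rewrite swap_rev si.
have U0 : U (rev_ord h) = 0 by apply: (torus_U0 T); move: hm => /=; lia.
have gapE i p : (2 * p)%N != N -> gap_exp (swap h i) p = gap_exp i p.
  move=> p2; rewrite swapE.
  have [->|ih] := eqVneq i h; first by rewrite /gap_exp; move: hm => /= hm; split_ifs.
  by have [->|//] := eqVneq i (rev_ord h); rewrite /gap_exp; move: hm => /= hm; split_ifs.
split.
- by move=> i j ij ji'; apply: (torus_comm T); rewrite ?(swap_lt hm) // -swap_rev (inj_eq perm_inj).
- move=> i ii'; have [->|[-> ->]] := Hlt i ii'; last exact: (torus_hi T).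
  rewrite rev_ordK /swap tpermL tpermR -{1}[h]rev_ordK (torus_lo T); last by rewrite rev_ordK hm.
  by rewrite U0 !scaler0.
- move=> i ii'; have [->|[-> ->]] := Hlt i ii'; last exact: (torus_lo T).
  have := torus_hi T (i := rev_ord h); rewrite rev_ordK /swap tpermL tpermR => ->; last by rewrite hm.
  by rewrite U0 !scaler0.
- move=> i ii'; have ei := congr1 val ii'; have -> : swap h i = i; last exact: (torus_mid T).
  by rewrite swapE !ifF //; rewrite -val_eqE /=; move: hm ei => /=; lia.
- exact: (torus_symU T).
- exact: (torus_symV T).
- exact: (torus_U0 T).
- exact: (torus_V0 T).
- exact: (torus_UV T).
- exact: (torus_VU T).
- exact: (torus_VV T).
- move=> i p pN; have [p2|p2] := eqVneq (2 * p)%N N.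
    by rewrite (torus_U0 T) // -[qc _ _ _]/(_ = _) (ba_0l mP) (ba_0r mP) scaler0.
  by rewrite -gapE //; apply: (torus_xU T).
- move=> i p pN; have [p2|p2] := eqVneq (2 * p)%N N.
    by rewrite (torus_V0 T) // -[qc _ _ _]/(_ = _) (ba_0l mP) (ba_0r mP) scaler0.
  by rewrite -gapE //; apply: (torus_xV T).
- by move=> i; rewrite swap_rev (torus_DD T).
- by move=> i j ij ij'; apply: (torus_Dx T); rewrite -?swap_rev (inj_eq perm_inj).
- by move=> i ii'; apply: (torus_Dx_diag T); rewrite -?swap_rev (inj_eq perm_inj).
- by move=> i ii'; rewrite swap_rev; apply: (torus_Dx_opp T); rewrite -?swap_rev (inj_eq perm_inj).
- by move=> i ii'; apply: (torus_Dmid T); rewrite -swap_rev -ii'.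
- by move=> i p; apply: (torus_DV T).
- by move=> i j; apply: (torus_DcD T).
Qed.

(** This equivariance is what the separate clause for the middle pair in [torus_z] achieves: both
    middle indices have the same gap and the same scalar. *)
Lemma torus_z_swap h x D V i : mid_pair h ->
  torus_z (fun i => x (swap h i)) (fun i => D (swap h i)) V i = torus_z x D V (swap h i).
Proof.
move=> hm; have /eqP hm' := hm; have hN := ltn_ord h.
have mh' : mid_pair (rev_ord h) = false by move: hm'; rewrite /mid_pair /=; lia.
have hlt : (h < rev_ord h)%N by rewrite hm'.
rewrite /torus_z !swap_rev swapE; have [->|ih] := eqVneq i h.
  by rewrite hm mh' rev_ordK hlt hm'.
have [->|//] := eqVneq i (rev_ord h).
by rewrite hm mh' rev_ordK hlt hm'.
Qed.

Section DualFrame.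
Variables (x D : 'I_N -> B) (U V : nat -> B).
Hypothesis xDUV : torus x D U V.

Lemma torus_qcomm h : qcomm s m x (torus_z x D V h) h = D h.
Proof.
have [hm|hm] := boolP (mid_pair h); last exact: torus_qcomm_z xDUV _ hm.
have hm' : ~~ mid_pair (rev_ord h) by move: hm; rewrite /mid_pair /=; have := ltn_ord h; lia.
have := torus_qcomm_z (torus_swap hm xDUV) hm'.
by rewrite torus_z_swap // /qcomm /swap tpermR.
Qed.

(** With factors reversed, the q-commutator of x_(-h) with z_(-h) is again M_(-h)^(-h) = D_(-h). The
    axioms thus become commutation rules between D_(-h) and the z, and between x_(-h) and the z. *)
Lemma torus_dual_frame h : ~~ mid_pair h ->
  frame s (fun a b => m b a) (fun i => torus_z x D V (rev_ord i))
    (fun p => gap_weight N s p *: ((q^-1 * k ^- 2) *: V p)) h (x (rev_ord h)).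
Proof.
move=> hm; have hN := ltn_ord h.
have qD : qcomm s (fun a b => m b a) (fun i => torus_z x D V (rev_ord i)) (x (rev_ord h)) h
    = D (rev_ord h) by exact: torus_qcomm.
split; rewrite ?qD.
- move=> i ih; have ne : rev_ord h != rev_ord i by rewrite (inj_eq rev_ord_inj) -val_eqE /=; lia.
  have := qc_xz xDUV ne; rewrite ifT //.
  by apply/orP; left; have := ltn_ord i; rewrite /=; lia.
- move=> i ih; have ne : rev_ord h != rev_ord i by rewrite (inj_eq rev_ord_inj) -val_eqE /=; lia.
  have := qc_xz xDUV ne; rewrite ifF //; apply/negP; rewrite -val_eqE /mid_pair.
  by move: hm (ltn_ord i); rewrite /mid_pair /=; lia.
- move=> i ih ih'; have := qc_Dz xDUV (rev_ord h) (rev_ord i).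
  by rewrite !(inj_eq rev_ord_inj) (negPf ih) (negPf ih') if_same => /qc1P.
- move=> hh; have := qc_Dz xDUV (rev_ord h) (rev_ord h).
  by rewrite !(inj_eq rev_ord_inj) (negPf hh) eqxx.
- move=> hh; have := qc_Dz xDUV (rev_ord h) h.
  rewrite !(inj_eq rev_ord_inj) (negPf hh) rev_ordK eqxx => H.
  by apply: (qc_sym _ H); rewrite mulfV.
- move=> hh; have := qc_Dz xDUV (rev_ord h) (rev_ord h).
  by rewrite -!hh eqxx => /qc1P.
have xD : qc (if h == rev_ord h then 1 else q) (x (rev_ord h)) (D (rev_ord h)).
  have [hh|hh] := eqVneq h (rev_ord h).
    by rewrite -hh (torus_Dmid xDUV hh) -[qc _ _ _]/(_ = _) m1l m1r scale1r.
  by apply: (torus_Dx_diag xDUV); rewrite (inj_eq rev_ord_inj).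
have VD : V h.+1 ** D (rev_ord h) = D (rev_ord h) ** V h.+1.
  by have := torus_DV xDUV (rev_ord h) hN => ->; rewrite scale1r.
rewrite rev_ordK !(ba_Zl mP) scalerA /torus_z (negPf hm) (ba_Zl mP).
rewrite -[_ ** _ ** D _](ba_assoc mP) xD (ba_Zr mP) (ba_assoc mP) -(ba_assoc mP (D h)) VD.
rewrite (ba_assoc mP (D h)) (torus_DD xDUV) m1l !scalerA; congr (_ *: _).
have E c0 : (1 - q ^+ 2) * rh h * gap_weight N s h.+1 * c0
    = (1 - q ^+ 2) * c0 * (rh h * gap_weight N s h.+1) by ring.
rewrite -?mulrA ?[_ * (rh h * _)]mulrA mulrA E.
have [hh|hh|/val_inj hh] := ltngtP h (rev_ord h).
- rewrite (qrho_gap_lo s_neq0) ?ifF; try by move: hh hm; rewrite /mid_pair -?val_eqE /=; lia.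
  by rewrite /kk; field; rewrite ?q_neq0 ?qq_neq1 ?oner_neq0 ?q2_neq1 //.
- rewrite (qrho_gap_hi s_neq0) // ifF; last by move: hh; rewrite -val_eqE /=; lia.
  by rewrite /kk; field; rewrite ?q_neq0 ?qq_neq1 ?oner_neq0 ?q2_neq1 //.
have [-> _] := gap_weight_mid s_neq0 hh; rewrite qrho_mid // ifT; last by apply/eqP.
move: q2_neq1 q_neqV; rewrite /kk /qq => s4 s4'.
by field; rewrite s_neq0 ?oner_neq0 s4 -expr2 -oppr_eq0 opprB s4.
Qed.

End DualFrame.

(** * The relations of the Borel generators *)

Section Relations.
Variables (x D : 'I_N -> B) (U V : nat -> B).
Hypothesis xDUV : torus x D U V.
Let z := torus_z x D V.
Let W p := gap_weight N s p *: U p.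
Let W' p := gap_weight N s p *: ((q^-1 * k ^- 2) *: V p).
Local Notation M h i := (qcomm s m x (z h) i).
Local Notation "'R[' f ]_( i , j )" :=
  (\sum_c \sum_d Rhat s i j c d *: f c d).

Let not_mid_rev h : mid_pair h -> ~~ mid_pair (rev_ord h).
Proof. by rewrite /mid_pair /=; have := ltn_ord h; lia. Qed.

Lemma torus_swap_frame h : mid_pair h ->
  frame s m (fun i => x (swap h i)) W (rev_ord h) (z h).
Proof.
move=> hm; have := torus_frame (torus_swap hm xDUV) (not_mid_rev hm).
by rewrite torus_z_swap // /swap tpermR.
Qed.

Lemma torus_cross h i j : x i ** M h j = R[fun c d => M h c ** x d]_(i, j).
Proof.
have [hm|hm] := boolP (mid_pair h); last first.
  exact: (frame_cross s_neq0 mP (torus_qspace xDUV) (torus_frame xDUV hm)).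
have hm' := eqP hm.
apply: (frame_cross_swap hm' s_neq0 mP _ (torus_swap_frame hm)).
exact: torus_qspace (torus_swap hm xDUV).
Qed.

Lemma torus_telescope h :
  \sum_j (rh j)^-1 *: (M h j ** x (rev_ord j)) = (1 - q ^+ 2) *: (z h ** W N).
Proof.
have [hm|hm] := boolP (mid_pair h); last first.
  have := qcomm_telescope s_neq0 mP (torus_qspace xDUV) (torus_frame xDUV hm) (leqnn N).
  by rewrite ltn_ord => <-; apply: eq_bigl => j; rewrite ltn_ord.
have hm' := eqP hm.
apply: (frame_telescope_swap hm' s_neq0 mP _ (torus_swap_frame hm)).
exact: torus_qspace (torus_swap hm xDUV).
Qed.

Let mop a b := m b a.
Let mopP : bilinear_assoc mop. Proof. exact: bilinear_assoc_opp. Qed.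

Let z_swap h : mid_pair h ->
  (fun i => torus_z (fun i => x (swap h i)) (fun i => D (swap h i)) V (rev_ord i))
  = (fun i => z (rev_ord (swap h i))).
Proof. by move=> hm; apply: funext => i; rewrite torus_z_swap // swap_rev. Qed.

Lemma torus_swap_dual_frame h : mid_pair h ->
  frame s mop (fun i => z (rev_ord (swap h i))) W' (rev_ord h) (x (rev_ord h)).
Proof.
move=> hm; have := torus_dual_frame (torus_swap hm xDUV) (not_mid_rev hm).
by rewrite z_swap // rev_ordK /swap tpermL.
Qed.

Lemma torus_dual_cross h i j :
  M (rev_ord j) h ** z (rev_ord i)
  = R[fun c d => z (rev_ord d) ** M (rev_ord c) h]_(i, j).
Proof.
rewrite -[h]rev_ordK; set h' := rev_ord h.
have [hm|hm] := boolP (mid_pair h'); last first.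
  exact: (frame_cross s_neq0 mopP (torus_dual_qspace xDUV) (torus_dual_frame xDUV hm)).
have hm' := eqP hm.
apply: (frame_cross_swap hm' s_neq0 mopP (x := fun i => z (rev_ord i)) _ (torus_swap_dual_frame hm)).
by rewrite -z_swap //; apply: torus_dual_qspace (torus_swap hm xDUV).
Qed.

Lemma torus_dual_telescope h :
  \sum_j (rh j)^-1 *: (z j ** M (rev_ord j) h) = (1 - q ^+ 2) *: (W' N ** x h).
Proof.
rewrite -[h]rev_ordK; set h' := rev_ord h.
transitivity (\sum_j (rh j)^-1 *: (mop (qcomm s mop (fun i => z (rev_ord i)) (x (rev_ord h')) j) (z (rev_ord (rev_ord j))))).
  by apply: eq_bigr => j _; rewrite rev_ordK.
have [hm|hm] := boolP (mid_pair h'); last first.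
  have := qcomm_telescope s_neq0 mopP (torus_dual_qspace xDUV) (torus_dual_frame xDUV hm) (leqnn N).
  by rewrite ltn_ord => <-; apply: eq_bigl => j; rewrite ltn_ord.
have hm' := eqP hm.
apply: (frame_telescope_swap hm' s_neq0 mopP (x := fun i => z (rev_ord i)) _ (torus_swap_dual_frame hm)).
by rewrite -z_swap //; apply: torus_dual_qspace (torus_swap hm xDUV).
Qed.

Definition borel_entry i j : B := (rh j / rh i) *: M (rev_ord i) (rev_ord j).
Local Notation L := borel_entry.

Lemma borel_entry_tri i j : (i < j)%N -> L i j = 0.
Proof.
move=> ij; have ne : rev_ord j != rev_ord i by rewrite (inj_eq rev_ord_inj) -val_eqE /=; lia.
have := qc_xz xDUV ne; rewrite ifT; last first.
  by have := ltn_ord j; move=> jN; apply/orP; left => /=; lia.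
by rewrite /L /qcomm => ->; rewrite scalerA mulfV // scale1r subrr scaler0.
Qed.

Lemma borel_entry_diag i : L i i = D (rev_ord i).
Proof. by rewrite /L mulfV ?qrho_neq0 // scale1r (torus_qcomm xDUV). Qed.

(** The metric factors in [borel_entry] are exactly those of the crossing formula [Sinv]; they
    convert the braid matrix of [torus_cross] into its inverse. *)
Lemma borel_entry_cross i a b :
  x i ** L a b = \sum_c \sum_j Rhat_inv s c i j b *: (L a c ** x j).
Proof.
rewrite /L (ba_Zr mP) torus_cross (reindex_inj rev_ord_inj) scaler_sumr.
apply: eq_bigr => c _; rewrite scaler_sumr; apply: eq_bigr => j _.
rewrite Rhat_invE // /Sinv (ba_Zl mP) !scalerA.
congr (_ *: _); field.
by rewrite !qrho_neq0.
Qed.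

Lemma borel_entry_RLL a b e' f :
  \sum_c \sum_d Rhat s a b c d *: (L d f ** L c e')
  = \sum_c \sum_d Rhat s d c e' f *: (L b c ** L a d).
Proof.
(* The rescaling of two generators depends on the summed indices only through [rh c * rh d], which
   [Rhat_qrho] exchanges for [rh a * rh b]; the factor t then leaves the sum. *)
pose t := rh e' * rh f / (rh a * rh b).
transitivity (t *: R[fun c d => M (rev_ord d) (rev_ord f) ** M (rev_ord c) (rev_ord e')]_(a, b)).
  rewrite scaler_sumr; apply: eq_bigr => c _; rewrite scaler_sumr; apply: eq_bigr => d _.
  rewrite /L (ba_Zl mP) (ba_Zr mP) !scalerA; congr (_ *: _).
  have nz : rh a * rh b * (rh c * rh d) != 0 by rewrite !mulf_neq0 ?qrho_neq0.
  apply: (mulIf nz); transitivity (Rhat s a b c d * (rh a * rh b) * (rh e' * rh f)).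
    by field; rewrite !qrho_neq0.
  by rewrite Rhat_qrho // /t; field; rewrite !qrho_neq0.
rewrite (transition_RLL mP torus_cross torus_dual_cross) scaler_sumr (reindex_inj rev_ord_inj).
apply: eq_bigr => c _; rewrite scaler_sumr (reindex_inj rev_ord_inj); apply: eq_bigr => d _ /=.
rewrite -Rhat_rev // Rhat_sym // /L (ba_Zl mP) (ba_Zr mP) !scalerA; congr (_ *: _).
have nz : rh a * rh b * (rh c * rh d) != 0 by rewrite !mulf_neq0 ?qrho_neq0.
apply: (mulIf nz); transitivity (Rhat s d c e' f * (rh e' * rh f) * (rh c * rh d)).
  by rewrite /t; field; rewrite !qrho_neq0.
by rewrite -Rhat_qrho //; field; rewrite !qrho_neq0.
Qed.

(** Together with U_0 = U_N = V_N^-1 this makes the product of opposite end values of [W'] and [W]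
    equal to - q^-1 k^-2. In [transition_metric] it meets (1 - q^2) k = - q k^2, so the metric
    relations come out with constant 1. *)
Let gap_weight_ends : (0 < N)%N -> gap_weight N s 0 * gap_weight N s N = -1.
Proof.
move=> N0; rewrite /gap_weight muln0 ltn0 N0 ifT; last by lia.
by rewrite mulNr -expfzDr // -[in RHS](expr0z s); congr (- _ ^ _); lia.
Qed.

Let ends_UV : (0 < N)%N -> [/\ U 0 = U N, V 0 = V N, U N ** V N = e & V N ** U N = e].
Proof.
move=> N0; rewrite -{1}(subnn N) (torus_symU xDUV) // -{1}(subnn N) (torus_symV xDUV) //.
by split=> //; [apply: (torus_UV xDUV)|apply: (torus_VU xDUV)] => //; lia.
Qed.

Let W0WN : (0 < N)%N -> m (W' 0) (W N) = - (q^-1 * k ^- 2) *: e.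
Proof.
move=> N0; have [_ V0 _ VU] := ends_UV N0.
rewrite /W' /W !(ba_Zl mP) (ba_Zr mP) V0 VU !scalerA; congr (_ *: _).
by rewrite mulrAC gap_weight_ends // mulN1r.
Qed.

Let WNW0 : (0 < N)%N -> m (W' N) (W 0) = - (q^-1 * k ^- 2) *: e.
Proof.
move=> N0; have [U0 _ _ VU] := ends_UV N0.
rewrite /W' /W !(ba_Zl mP) (ba_Zr mP) U0 VU !scalerA; congr (_ *: _).
by rewrite mulrAC [gap_weight _ _ N * _]mulrC gap_weight_ends // mulN1r.
Qed.

Let V_N h : qc 1 (x h) (V N).
Proof.
have := torus_xV xDUV h (leqnn N); rewrite /gap_exp subnn maxn0 minn0 ltn0.
by rewrite leqNgt ltn_ord invr1.
Qed.

Let WNx h : W' N ** x h = x h ** W' N.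
Proof.
by rewrite !(ba_Zl mP) !(ba_Zr mP) (qc1P (V_N h)).
Qed.

Let WNz h : W N ** z h = z h ** W N.
Proof.
have N0 : (0 < N)%N by apply: leq_ltn_trans (ltn_ord h).
have [_ _ UV VU] := ends_UV N0.
suff zV : qc 1 (z h) (V N).
  rewrite /W (ba_Zl mP) (ba_Zr mP); congr (_ *: _).
  rewrite -[LHS]m1r -VU (ba_assoc mP) -(ba_assoc mP (U N) (z h)) (qc1P zV).
  by rewrite (ba_assoc mP) UV m1l.
have xV := V_N (rev_ord h).
have DVx p : (p <= N)%N -> qc 1 (D h ** V p ** x (rev_ord h)) (V N).
  move=> pN; have VV : qc 1 (V p) (V N) by exact: (qc_VV xDUV pN (leqnn N)).
  apply: (qc_ml mP (qc_ml mP (torus_DV xDUV h (leqnn N)) VV erefl) xV).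
  by rewrite !mulr1.
rewrite /z /torus_z; case: (boolP (mid_pair h)) => hm; apply: (qc_zl mP); apply: DVx.
  by have := ltn_ord h; move: hm; rewrite /mid_pair /=; lia.
exact: ltn_ord.
Qed.

Lemma borel_entry_metric_up i l :
  \sum_j \sum_r metric s r j *: (L i j ** L l r) = metric s l i *: e.
Proof.
transitivity ((rh i * rh l)^-1 *: \sum_j rh j *: (M (rev_ord i) (rev_ord j) ** M (rev_ord l) j)).
  rewrite scaler_sumr; apply: eq_bigr => j _.
  rewrite (bigD1 (rev_ord j)) //= big1 ?addr0 => [|r rj]; last first.
    by rewrite /metric -rev_ord_eq [rev_ord j == r]eq_sym (negPf rj) scale0r.
  rewrite /metric rev_ordK eqxx /L rev_ordK (ba_Zl mP) (ba_Zr mP) !scalerA qrho_rev.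
  by congr (_ *: _); field; rewrite ?qrho_neq0 ?oner_neq0 //.
have Q i' j' : R[fun c d => z (rev_ord d) ** z (rev_ord c)]_(i', j')
     = q *: (z (rev_ord j') ** z (rev_ord i')) + (if j' == rev_ord i' then (k / rh i') *: W' 0 else 0).
  exact: (qspace_braid s_neq0 i' j' (torus_dual_qspace xDUV)).
rewrite (transition_metric mP torus_dual_cross _ _ torus_telescope Q WNz).
rewrite rev_ordK W0WN ?(leq_ltn_trans _ (ltn_ord i)) //; case: eqP => [<-|il]; last first.
  by rewrite scaler0 /metric eq_sym; case: eqP => // _; rewrite scale0r.
rewrite /metric eqxx qrho_rev !scalerA; congr (_ *: _).
by rewrite /kk; field; rewrite ?qrho_neq0 ?q_neq0 ?qq_neq1 ?oner_neq0.
Qed.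

(** Here the sum runs over the frame index. In the opposite algebra x and z exchange roles, the
    frame index becomes the coordinate index, and [transition_metric] applies again. *)
Lemma borel_entry_metric_down i l :
  \sum_j \sum_r metric s r j *: (L j i ** L r l) = metric s l i *: e.
Proof.
transitivity ((rh i * rh l) *: \sum_j rh j *: (M (rev_ord j) (rev_ord i) ** M j (rev_ord l))).
  rewrite scaler_sumr; apply: eq_bigr => j _.
  rewrite (bigD1 (rev_ord j)) //= big1 ?addr0 => [|r rj]; last first.
    by rewrite /metric -rev_ord_eq [rev_ord j == r]eq_sym (negPf rj) scale0r.
  rewrite /metric rev_ordK eqxx /L rev_ordK (ba_Zl mP) (ba_Zr mP) !scalerA qrho_rev.
  by congr (_ *: _); field; rewrite ?qrho_neq0 ?oner_neq0 //.
have Q i' j' : R[fun c d => mop (x (rev_ord (rev_ord d))) (x (rev_ord (rev_ord c)))]_(i', j')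
     = q *: (mop (x (rev_ord (rev_ord j'))) (x (rev_ord (rev_ord i'))))
       + (if j' == rev_ord i' then (k / rh i') *: W 0 else 0).
  rewrite !rev_ordK -(qspace_braid s_neq0 i' j' (torus_qspace xDUV)).
  by apply: eq_Rsum => c d; rewrite !rev_ordK.
have T h : \sum_j (rh j)^-1 *: mop (qcomm s mop (fun i => z (rev_ord i)) (x (rev_ord h)) j)
     (z (rev_ord (rev_ord j))) = (1 - q ^+ 2) *: mop (x (rev_ord h)) (W' N).
  rewrite -torus_dual_telescope; apply: eq_bigr => j _.
  by rewrite rev_ordK.
have C h i' j' : mop (qcomm s mop (fun i => z (rev_ord i)) (x (rev_ord (rev_ord j'))) h) (x (rev_ord (rev_ord i')))
  = R[fun c d => mop (x (rev_ord (rev_ord d))) (qcomm s mop (fun i => z (rev_ord i)) (x (rev_ord (rev_ord c))) h)]_(i', j').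
  rewrite !rev_ordK; transitivity (x i' ** M (rev_ord h) j'); first by [].
  by rewrite torus_cross; apply: eq_Rsum => c d; rewrite !rev_ordK.
have TM := transition_metric mopP C l i T Q (fun h => esym (WNx (rev_ord h))).
transitivity ((rh i * rh l) *: (if i == rev_ord l then ((1 - q ^+ 2) * k * rh i) *: mop (W 0) (W' N) else 0)).
  by rewrite -TM; congr (_ *: _); apply: eq_bigr => j _;rewrite /mop /qcomm rev_ordK.
rewrite /mop WNW0 ?(leq_ltn_trans _ (ltn_ord i)) // /metric; case: eqP => [->|il]; last first.
  by rewrite scaler0 scale0r.
rewrite qrho_rev !scalerA; congr (_ *: _).
by rewrite /kk; field; rewrite ?qrho_neq0 ?q_neq0 ?qq_neq1 ?oner_neq0.
Qed.

End Relations.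

End Torus.

(** * Radii *)

Lemma absz_pred (l : int) : 1 < l -> `|l|.-1%N%:Z = l - 1.
Proof. lia. Qed.

Section Labels.
Variable N : nat.
Implicit Types (i j : 'I_N) (p : nat).

(** The index a such that the positions with |label| at most a are those between gap p and its
    mirror image N - p, for p away from the middle gap of even N. *)
Definition gap_radius p := (maxn p (N - p) - uphalf N)%N.

(* The paper's [K] takes over the role of the radii for the labels 1 and -1. *)
Definition near_mid i := ~~ odd N && (`|label i| == 1)%N.

Lemma gap_radius_range p : (p <= N)%N -> (2 * p)%N != N -> radius_range N (gap_radius p).
Proof.
move=> pN p2; rewrite /radius_range /gap_radius.
have := odd_double_half N; rewrite uphalf_half; case: (odd N) => /= E; lia.
Qed.

Lemma gap_radius_sym p : (p <= N)%N -> gap_radius (N - p) = gap_radius p.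
Proof. by move=> pN; rewrite /gap_radius; congr (_ - _)%N; lia. Qed.

Lemma label_gap_hi i p : (p <= N)%N -> (2 * p)%N != N ->
  ((gap_radius p)%:Z < label i) = (maxn p (N - p) <= i)%N.
Proof.
move=> pN p2; have iN := ltn_ord i; rewrite /gap_radius /label.
have := odd_double_half N; rewrite uphalf_half; case: (odd N) => /= E.
  by apply/idP/idP; lia.
by case: ifP => ?; apply/idP/idP; lia.
Qed.

Lemma label_gap_lo i p : (p <= N)%N -> (2 * p)%N != N ->
  (label i < - (gap_radius p)%:Z) = (i < minn p (N - p))%N.
Proof.
move=> pN p2; have iN := ltn_ord i; rewrite /gap_radius /label.
have := odd_double_half N; rewrite uphalf_half; case: (odd N) => /= E.
  by apply/idP/idP; lia.
by case: ifP => ?; apply/idP/idP; lia.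
Qed.

Lemma gap_radius_above i : (rev_ord i < i)%N -> gap_radius i.+1 = `|label i|%N.
Proof.
have iN := ltn_ord i; rewrite /gap_radius /label /=.
have := odd_double_half N; rewrite uphalf_half; case: (odd N) => /= E; first lia.
by case: ifP => ?; lia.
Qed.

Lemma gap_radius_below i : (rev_ord i < i)%N -> gap_radius i = `|label i|.-1%N.
Proof.
have iN := ltn_ord i; rewrite /gap_radius /label /=.
have := odd_double_half N; rewrite uphalf_half; case: (odd N) => /= E; first lia.
by case: ifP => ?; lia.
Qed.

Lemma label_gt0 i : (0 < label i) = (rev_ord i < i)%N.
Proof.
have iN := ltn_ord i; rewrite /label /=.
have := odd_double_half N; case: (odd N) => /= E; first by apply/idP/idP; lia.
by case: ifP => ?; apply/idP/idP; lia.
Qed.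

Lemma label_radius i : label i != 0 -> radius_range N `|label i|.
Proof.
have iN := ltn_ord i; rewrite /radius_range /label.
have := odd_double_half N; case: (odd N) => /= E; first lia.
by case: ifP => ?; lia.
Qed.

Lemma label_radius_pred i : label i != 0 -> ~~ near_mid i ->
  radius_range N `|label i|.-1.
Proof.
have iN := ltn_ord i; rewrite /radius_range /near_mid /label.
have := odd_double_half N; case: (odd N) => /= E; first lia.
by case: ifP => ?; lia.
Qed.

Lemma label_abs_eq i j : (`|label j| == `|label i|)%N = (j == i) || (j == rev_ord i).
Proof.
have iN := ltn_ord i; have jN := ltn_ord j; rewrite -!val_eqE /label /=.
have := odd_double_half N; case: (odd N) => /= E; first by apply/idP/idP; lia.
by do 2 case: ifP => ?; apply/idP/idP; lia.
Qed.

Lemma label_lt0 i : (label i < 0) = (i < rev_ord i)%N.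
Proof. by rewrite -oppr_gt0 -label_rev label_gt0 rev_ordK. Qed.

Lemma near_mid_rev i : near_mid (rev_ord i) = near_mid i.
Proof. by rewrite /near_mid label_rev abszN. Qed.

Lemma near_midE i : 0 < label i -> near_mid i = (2 * i == N)%N.
Proof.
have iN := ltn_ord i; rewrite /near_mid /label.
have := odd_double_half N; case: (odd N) => /= E; first by move=> li; apply/idP/idP; lia.
by case: ifP => ? li; apply/idP/idP; lia.
Qed.

Lemma near_mid_label i : near_mid i -> label i = 1 \/ label i = -1.
Proof. by case/andP => _ /eqP; lia. Qed.

Lemma near_mid_gt0 i : 0 < label i -> near_mid i -> label i = 1.
Proof. by move=> li /near_mid_label[//|e]; rewrite e in li. Qed.

Lemma far_gt0 i : 0 < label i -> ~~ near_mid i -> label i = 1 /\ odd N \/ 1 < label i.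
Proof.
rewrite /near_mid => li nm; have [l1|l1] := eqVneq (label i) 1; [left|right]; last lia.
by split=> //; apply: contraR nm => ->; rewrite l1.
Qed.

Lemma mid_pair_near i : mid_pair i -> near_mid i /\ label i = -1.
Proof.
have iN := ltn_ord i; rewrite /mid_pair /near_mid /label /=.
have := odd_double_half N; case: (odd N) => /= E; first lia.
by case: ifP => ? mh; split; lia.
Qed.

Lemma near_mid_pair i : near_mid i -> label i = -1 -> mid_pair i.
Proof.
move=> nm li; have := near_midE (i := rev_ord i).
rewrite near_mid_rev nm label_rev li /mid_pair /= => /(_ isT) /esym /eqP e2.
by apply/eqP; have := ltn_ord i; lia.
Qed.

Lemma label_leq_pred i j : label i != 0 ->
  (`|label j| <= `|label i|.-1)%N
  = (`|label j| <= `|label i|)%N && (j != i) && (j != rev_ord i).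
Proof.
move=> li; rewrite -andbA -negb_or -label_abs_eq; apply/idP/idP; lia.
Qed.

Lemma label_leq_near i j : near_mid i ->
  (`|label j| <= `|label i|)%N = (j == i) || (j == rev_ord i).
Proof.
move=> nm; rewrite -label_abs_eq; have /andP[ev /eqP ->] := nm.
have : label j != 0 by rewrite label_eq0 -val_eqE /=; have := ltn_ord j; lia.
by move=> lj; apply/idP/idP; lia.
Qed.

Lemma label_mid i : i = rev_ord i -> [/\ odd N, label i = 0 & gap_radius i = 0%N].
Proof.
move=> ii'; have iN := ltn_ord i; have : i = (N - i.+1)%N :> nat by rewrite {1}ii'.
move=> e1; have l0 : label i = 0 by apply/eqP; rewrite label_eq0 -ii'.
split=> //; first lia.
rewrite /gap_radius uphalf_half; have := odd_double_half N; case: (odd N) => /=; lia.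
Qed.

Lemma label0_odd i : label i = 0 -> odd N.
Proof. by move=> l0; have [|//] := @label_mid i; apply/eqP; rewrite -label_eq0 l0. Qed.

Lemma rho2_pred i : 1 < label i -> rho2 N (label i - 1) = 2 + rho2 N (label i).
Proof. by rewrite /rho2; case: (odd N); lia. Qed.

Lemma rho2_1 : odd N -> rho2 N 1 = -1.
Proof. by rewrite /rho2 => ->; rewrite gtr0_sgz // normr1. Qed.

End Labels.

Section DiagExponent.
Variables (F : fieldType) (q : F).
Implicit Types l L : int.

(** The exponents of r_|L| and of the inverse of r_(|L|-1) cancel except at the labels L and -L,
    which the larger radius includes and the smaller one does not. *)
Lemma diag_exponent_hi l L : q != 0 -> 0 < L ->
  (if l == L then q else if l == - L then q^-1 else 1)
  = (if `|L|%N%:Z < l then q^-1 else if l < - `|L|%N%:Z then q else 1)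
    * (if `|L|.-1%N%:Z < l then q else if l < - `|L|.-1%N%:Z then q^-1 else 1).
Proof.
case: L => // -[//|L] q0 _ /=.
by split_ifs; rewrite ?mulr1 ?mul1r ?mulfV ?mulVf.
Qed.

Lemma diag_exponent_lo l L : q != 0 -> L < 0 ->
  (if l == L then q else if l == - L then q^-1 else 1)
  = (if `|L|.-1%N%:Z < l then q^-1 else if l < - `|L|.-1%N%:Z then q else 1)
    * (if `|L|%N%:Z < l then q else if l < - `|L|%N%:Z then q^-1 else 1).
Proof.
case: L => // L q0 _; rewrite /= NegzE opprK.
by split_ifs; rewrite ?mulr1 ?mul1r ?mulfV ?mulVf.
Qed.

End DiagExponent.

Section Radii.
Variables (F : fieldType) (N : nat) (s : F).
Hypothesis s_neq0 : s != 0.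
Variables (B : lmodType F) (m : B -> B -> B) (e : B).
Hypotheses (mP : bilinear_assoc m) (m1l : left_id e m) (m1r : right_id e m).
Implicit Types (i j h : 'I_N) (a p : nat).

Local Notation rh i := (qrho N s (label i)).
Local Notation q := (qq s).
Local Notation k := (kk s).
Local Notation "a ** b" := (m a b) (at level 40, left associativity).
Local Notation qc := (qcommutes m).

Let q_neq0 : q != 0. Proof. exact: expf_neq0. Qed.

Lemma qc_inv c d (a u v : B) : u ** v = e -> v ** u = e -> d * c = 1 -> qc c a u -> qc d a v.
Proof.
rewrite /qcommutes => uv vu dc au.
rewrite -[LHS]m1l -vu -!(ba_assoc mP) [u ** (_ ** _)](ba_assoc mP).
have -> : u ** a = d *: (a ** u) by rewrite au scalerA dc scale1r.
by rewrite (ba_Zl mP) (ba_Zr mP) -!(ba_assoc mP) uv m1r.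
Qed.

Record radial_algebra (x : 'I_N -> B) (r ri : nat -> B) (K Ki : B) : Prop :=
  RadialAlgebra {
    ra_r_ri : forall a, radius_range N a -> r a ** ri a = e;
    ra_ri_r : forall a, radius_range N a -> ri a ** r a = e;
    ra_K_Ki : ~~ odd N -> K ** Ki = e;
    ra_Ki_K : ~~ odd N -> Ki ** K = e;
    ra_xx : forall i j, (i < j)%N -> i != rev_ord j -> qc q (x i) (x j);
    ra_opp : forall i, 1 < label i ->
      x i ** x (rev_ord i) - x (rev_ord i) ** x i
      = (k * (omega N s (label i - 1))^-1) *:
        (r `|label i - 1|%N ** r `|label i - 1|%N);
    ra_opp1 : forall i, label i = 1 ->
      x i ** x (rev_ord i) - x (rev_ord i) ** x i
      = if odd N then hh s *: (r 0%N ** r 0%N) else 0;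
    ra_sqr : forall a, radius_range N a -> r a ** r a =
      \sum_(i : 'I_N | (`|label i| <= a)%N) (rh i)^-1 *: (x i ** x (rev_ord i));
    ra_r0 : forall i, label i = 0 -> r 0%N = x i;
    ra_xr : forall i a, radius_range N a ->
      qc (if a%:Z < label i then q^-1 else if label i < - a%:Z then q else 1) (x i) (r a);
    ra_rr : forall a b, radius_range N a -> radius_range N b -> qc 1 (r a) (r b);
    ra_Kx : forall i, ~~ odd N ->
      qc (if label i == 1 then q else if label i == -1 then q^-1 else 1) K (x i);
    ra_Kr : forall a, ~~ odd N -> radius_range N a -> qc 1 K (r a) }.

(** By the formula for omega the value at 0 would be 2. With s + s^-1 instead, the commutator of x^1
    and x^(-1) for odd N fits the general pattern, because k = (s + s^-1) h, and [qrho_pred] also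
    holds at label 1. *)
Definition omega0 (a : nat) : F := if a == 0%N then s + s^-1 else omega N s a%:Z.

Variables (x : 'I_N -> B) (r ri : nat -> B) (K Ki : B).
Hypothesis R : radial_algebra x r ri K Ki.
Hypothesis omega0_neq0 : forall a, radius_range N a -> omega0 a != 0.
Hypothesis k_neq0 : k != 0.
Variable gamma : 'I_N -> F.
Hypothesis gamma0 : forall i, label i = 0 -> gamma i = - (s^-1 * (s - s^-1)^-1).
Hypothesis gamma1 : forall i, label i = 1 -> gamma i * gamma (rev_ord i) =
  if odd N then - (q^-1 * (s - s^-1) ^- 2) else (q - q^-1) ^- 2.
Hypothesis gamma_gt1 : forall i, 1 < label i -> gamma i * gamma (rev_ord i) =
  - (q^-1 * (q - q^-1) ^- 2 * omega N s (label i) * omega N s (label i - 1)).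

Local Notation gap_radius := (gap_radius N).

Definition gap_pot p : B := if (2 * p == N)%N then 0 else
  (omega0 (gap_radius p))^-1 *: (r (gap_radius p) ** r (gap_radius p)).

Definition gap_pot_inv p : B := if (2 * p == N)%N then 0 else
  omega0 (gap_radius p) *: (ri (gap_radius p) ** ri (gap_radius p)).

(** The scalars are read off from [radial_zE]: D_h times the inverse potential and x^(-h),
    normalized as in [torus_z], has to reproduce Lambda^-1 lambda_h. *)
Definition diag_entry i : B :=
  if i == rev_ord i then e
  else if near_mid i then - (k * gamma i) *: (if label i == 1 then Ki else K)
  else if (rev_ord i < i)%N then
    ((1 - q ^+ 2) * gamma i / omega0 `|label i|)
      *: (r `|label i| ** ri `|label i|.-1)
  else (k * gamma i / omega0 `|label i|.-1)
      *: (r `|label i|.-1 ** ri `|label i|).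

Local Notation U := gap_pot.
Local Notation V := gap_pot_inv.
Local Notation D := diag_entry.

Lemma qc1_r (b : B) a : radius_range N a -> qc 1 b (r a) -> qc 1 b (ri a).
Proof. by move=> ra; apply: (qc_inv (ra_r_ri R ra) (ra_ri_r R ra)); rewrite mulr1. Qed.

Lemma qc1_K (b : B) : ~~ odd N -> qc 1 b K -> qc 1 b Ki.
Proof. by move=> ev; apply: (qc_inv (ra_K_Ki R ev) (ra_Ki_K R ev)); rewrite mulr1. Qed.

Lemma qc1_unit (b : B) : qc 1 b e.
Proof. by rewrite /qcommutes m1l m1r scale1r. Qed.

Lemma qc1_sym (b c : B) : qc 1 b c -> qc 1 c b.
Proof. by apply: qc_sym; rewrite mulr1. Qed.

Lemma qc1_mul (b c d : B) : qc 1 b c -> qc 1 b d -> qc 1 b (c ** d).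
Proof. by move=> bc bd; apply: (qc_mr mP bc bd); rewrite mulr1. Qed.

Lemma qc1_diag (b : B) i : (forall a, radius_range N a -> qc 1 b (r a)) ->
  (~~ odd N -> qc 1 b K) -> qc 1 b (D i).
Proof.
move=> br bK; rewrite /diag_entry; case: eqP => [_|/eqP mi]; first exact: qc1_unit.
have li : label i != 0 by rewrite label_eq0.
case: ifP => [/andP[ev _]|ni].
  by apply: (qc_zr mP); case: ifP => _; [apply: qc1_K|]; auto.
have ra := label_radius li; have ra' := label_radius_pred li (negbT ni).
by case: ifP => _; apply: (qc_zr mP); apply: qc1_mul; auto; apply: qc1_r; auto.
Qed.

Lemma qc1_r_diag a i : radius_range N a -> qc 1 (r a) (D i).
Proof.
move=> ra; apply: qc1_diag => [b rb|ev]; first exact: (ra_rr R ra rb).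
exact: qc1_sym (ra_Kr R ev ra).
Qed.

Lemma qc1_K_diag i : ~~ odd N -> qc 1 K (D i).
Proof.
move=> ev; apply: qc1_diag => [b rb|_]; first exact: (ra_Kr R ev rb).
by rewrite /qcommutes scale1r.
Qed.

Lemma qc1_diag_diag i j : qc 1 (D i) (D j).
Proof.
apply: qc1_diag => [a ra|ev]; apply: qc1_sym; first exact: qc1_r_diag.
exact: qc1_K_diag.
Qed.

Lemma qc1_gap_inv (b : B) p : (forall a, radius_range N a -> qc 1 b (r a)) ->
  (p <= N)%N -> qc 1 b (V p).
Proof.
move=> br pN; rewrite /gap_pot_inv; case: eqP => [_|/eqP p2].
  by rewrite /qcommutes (ba_0l mP) (ba_0r mP) scaler0.
have ra := gap_radius_range pN p2.
by apply: (qc_zr mP); apply: qc1_mul; apply: qc1_r; auto.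
Qed.

Lemma qc1_r_gap_inv a p : radius_range N a -> (p <= N)%N -> qc 1 (r a) (V p).
Proof. by move=> ra pN; apply: qc1_gap_inv => // b rb; apply: (ra_rr R ra rb). Qed.

Lemma qc_x_gap i p : (p <= N)%N -> qc (gap_exp N s i p) (x i) (U p).
Proof.
move=> pN; rewrite /gap_pot; case: eqP => [_|/eqP p2].
  by rewrite /qcommutes (ba_0l mP) (ba_0r mP) scaler0.
have ra := gap_radius_range pN p2; have xr := ra_xr R i ra.
apply: (qc_zr mP); apply: (qc_mr mP xr xr).
rewrite label_gap_hi // label_gap_lo // /gap_exp.
by case: ifP => _; [|case: ifP => _]; rewrite ?mulr1 // -expr2 ?exprVn.
Qed.

Lemma qc_x_rinv i a : radius_range N a ->
  qc (if a%:Z < label i then q else if label i < - a%:Z then q^-1 else 1) (x i) (ri a).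
Proof.
move=> ra; apply: (qc_inv (ra_r_ri R ra) (ra_ri_r R ra) _ (ra_xr R i ra)).
by case: ifP => _; [|case: ifP => _]; rewrite ?mulr1 ?mulfV ?mulVf.
Qed.

Lemma qc_x_gap_inv i p : (p <= N)%N -> qc (gap_exp N s i p)^-1 (x i) (V p).
Proof.
move=> pN; rewrite /gap_pot_inv; case: eqP => [_|/eqP p2].
  by rewrite /qcommutes (ba_0l mP) (ba_0r mP) scaler0.
have ra := gap_radius_range pN p2.
have xri := qc_x_rinv i ra.
apply: (qc_zr mP); apply: (qc_mr mP xri xri).
rewrite label_gap_hi // label_gap_lo // /gap_exp.
by case: ifP => _; [|case: ifP => _]; rewrite ?mulr1 ?invr1 // -expr2 ?invrK ?exprVn.
Qed.

Lemma gap_UV p : (p <= N)%N -> (2 * p)%N != N -> U p ** V p = e.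
Proof.
move=> pN p2; have ra := gap_radius_range pN p2.
rewrite /gap_pot /gap_pot_inv (negPf p2) (ba_Zl mP) (ba_Zr mP) scalerA mulVf ?omega0_neq0 //.
rewrite scale1r -(ba_assoc mP) [r _ ** (ri _ ** _)](ba_assoc mP) (ra_r_ri R ra) m1l.
exact: (ra_r_ri R ra).
Qed.

Lemma gap_VU p : (p <= N)%N -> (2 * p)%N != N -> V p ** U p = e.
Proof.
move=> pN p2; have ra := gap_radius_range pN p2.
rewrite /gap_pot /gap_pot_inv (negPf p2) (ba_Zl mP) (ba_Zr mP) scalerA mulfV ?omega0_neq0 //.
rewrite scale1r -(ba_assoc mP) [ri _ ** (r _ ** _)](ba_assoc mP) (ra_ri_r R ra) m1l.
exact: (ra_ri_r R ra).
Qed.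

Lemma qc_x_K j : ~~ odd N ->
  qc (if label j == 1 then q^-1 else if label j == -1 then q else 1) (x j) K.
Proof.
move=> ev; apply: qc_sym (ra_Kx R j ev).
by case: ifP => _; [|case: ifP => _]; rewrite ?mulr1 ?mulfV ?mulVf.
Qed.

Lemma qc_x_Ki j : ~~ odd N ->
  qc (if label j == 1 then q else if label j == -1 then q^-1 else 1) (x j) Ki.
Proof.
move=> ev; apply: (qc_inv (ra_K_Ki R ev) (ra_Ki_K R ev) _ (qc_x_K j ev)).
by case: ifP => _; [|case: ifP => _]; rewrite ?mulr1 ?mulfV ?mulVf.
Qed.

Lemma qc_x_diag i j : qc (if i == rev_ord i then 1 else if j == i then q
  else if j == rev_ord i then q^-1 else 1) (x j) (D i).
Proof.
rewrite /diag_entry; have [ii'|ii'] := eqVneq i (rev_ord i); first exact: qc1_unit.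
have li : label i != 0 by rewrite label_eq0.
have ji : (`|label j|%N == `|label i|%N) = (j == i) || (j == rev_ord i) by exact: label_abs_eq.
have lr := label_rev i.
have lj : [\/ j = i, j = rev_ord i | [/\ j != i, j != rev_ord i & `|label j|%N != `|label i|%N]].
  rewrite ji; have [->|n1] := eqVneq j i; first exact: Or31.
  by have [->|n2] := eqVneq j (rev_ord i); [apply: Or32|apply: Or33].
have cond : (if j == i then q else if j == rev_ord i then q^-1 else 1)
    = (if label j == label i then q else if label j == - label i then q^-1 else 1).
  case: lj => [->|->|[n1 n2 n3]].
  - by rewrite !eqxx.
  - rewrite eqxx [rev_ord i == i]eq_sym (negPf ii') lr eqxx ifF //.
    by apply/negP => /eqP; lia.
  - by rewrite (negPf n1) (negPf n2) !ifF //; apply/negP => /eqP; lia.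
have [/andP[ev l1]|ni] := boolP (near_mid i).
  apply: (qc_zr mP); have [l1'|l1'] := boolP (label i == 1).
    have := qc_x_Ki j ev; congr (qc _ _ _).
    by rewrite cond (eqP l1').
  have := qc_x_K j ev; congr (qc _ _ _).
  have lm : label i = -1 by lia.
  by rewrite cond lm opprK; case: (boolP (label j == 1)) => // /eqP ->.
have ra := label_radius li; have ra' := label_radius_pred li ni.
have xr := ra_xr R j ra; have xr' := ra_xr R j ra'.
have xi := qc_x_rinv j ra; have xi' := qc_x_rinv j ra'.
have [hi|lo] := boolP (rev_ord i < i)%N; apply: (qc_zr mP).
  by rewrite -label_gt0 in hi; apply: (qc_mr mP xr xi'); rewrite cond diag_exponent_hi.
have {}lo : label i < 0 by rewrite lt_neqAle li leNgt label_gt0.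
by apply: (qc_mr mP xr' xi); rewrite cond diag_exponent_lo.
Qed.

Lemma omega0_label i : 0 < label i -> omega0 `|label i|%N = rh i + (rh i)^-1.
Proof.
move=> li; rewrite /omega0 ifF; last by apply/negP => /eqP; lia.
by rewrite gez0_abs ?ltW.
Qed.

Let sV_neq0 : odd N -> s + s^-1 != 0.
Proof.
by move=> oN; have := omega0_neq0 (a := 0); rewrite /omega0 eqxx; apply; rewrite /radius_range oN.
Qed.

Let ss1 : odd N -> s * s + 1 != 0.
Proof.
move=> oN; have -> : s * s + 1 = s * (s + s^-1) by field.
by rewrite mulf_neq0 // sV_neq0.
Qed.

Let s4_neq1 : s ^+ 2 * s ^+ 2 - 1 != 0.
Proof.
have -> : s ^+ 2 * s ^+ 2 - 1 = q * k by rewrite /kk /qq; field.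
by rewrite mulf_neq0.
Qed.

Let ss_neq1 : s * s - 1 != 0.
Proof.
by apply: contraNneq s4_neq1 => /subr0_eq e1; rewrite expr2 e1 mulr1 subrr.
Qed.

Lemma omega0_pred i : 0 < label i -> ~~ near_mid i ->
  omega0 `|label i|.-1%N = if label i == 1 then s + s^-1 else omega N s (label i - 1).
Proof.
move=> li nm; have [[l1 _]|l2] := far_gt0 li nm; first by rewrite /omega0 l1.
by rewrite /omega0 -eqz_nat absz_pred // subr_eq0 !gt_eqF.
Qed.

Lemma qrho_pred i : 0 < label i -> ~~ near_mid i ->
  omega0 `|label i|.-1%N = q * rh i + (q * rh i)^-1.
Proof.
move=> li nm; rewrite omega0_pred //; have [[l1 oN]|l2] := far_gt0 li nm.
  rewrite /qrho l1 rho2_1 // /qq.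
  by rewrite exprN1; field.
rewrite gt_eqF // /omega; congr (_ + _^-1); rewrite /qrho /qq -[s ^+ 2]/(s ^ 2%:Z) -expfzDr //.
  by rewrite rho2_pred.
by rewrite rho2_pred.
Qed.

Lemma x_commutator i : 0 < label i -> ~~ near_mid i ->
  x i ** x (rev_ord i) - x (rev_ord i) ** x i
  = (k / omega0 `|label i|.-1%N) *: (r `|label i|.-1 ** r `|label i|.-1).
Proof.
move=> li nm; rewrite omega0_pred //; have [[l1 oN]|l2] := far_gt0 li nm.
  rewrite l1 eqxx (ra_opp1 R l1) oN /=; congr (_ *: _); rewrite /hh /kk /qq.
  by field; rewrite s_neq0 /= ss1.
by rewrite gt_eqF // (ra_opp R l2) -absz_pred.
Qed.

Lemma r_sqr_succ i : 0 < label i -> ~~ near_mid i ->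
  r `|label i| ** r `|label i| = r `|label i|.-1 ** r `|label i|.-1
    + (rh i)^-1 *: (x i ** x (rev_ord i)) + rh i *: (x (rev_ord i) ** x i).
Proof.
move=> li nm; have l0 : label i != 0 by rewrite gt_eqF.
have ii' : rev_ord i != i by rewrite eq_sym -label_eq0.
rewrite (ra_sqr R (label_radius l0)) (ra_sqr R (label_radius_pred l0 nm)).
rewrite (bigD1 i) //= (bigD1 (rev_ord i)) /=; last by rewrite label_rev abszN leqnn ii'.
rewrite rev_ordK qrho_rev invrK addrA addrC addrA; congr (_ + _ + _).
by apply: eq_bigl => j; rewrite label_leq_pred.
Qed.

(** For odd N and label 1 the prescribed h^-2 takes the general form, since k = (s + s^-1) h while
    omega_1 and [omega0 0] both equal s + s^-1. *)
Lemma gammaE i : 0 < label i -> ~~ near_mid i -> gamma i * gamma (rev_ord i) =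
  - (q^-1 * k ^- 2 * omega0 `|label i| * omega0 `|label i|.-1).
Proof.
move=> li nm; rewrite (omega0_pred li nm); have [[l1 oN]|l2] := far_gt0 li nm.
  rewrite gamma1 // oN omega0_label //.
  rewrite l1 eqxx /omega /qrho rho2_1 // exprN1 invrK /kk /qq.
  by field; rewrite s_neq0 ss_neq1 /= exprMn s4_neq1.
by rewrite gamma_gt1 // omega0_label // gt_eqF.
Qed.

Lemma diag_entry_near i : 0 < label i -> near_mid i ->
  D i = - (k * gamma i) *: Ki /\ D (rev_ord i) = - (k * gamma (rev_ord i)) *: K.
Proof.
move=> li nm; have ii' : i != rev_ord i by rewrite -label_eq0 gt_eqF.
have l1 := near_mid_gt0 li nm.
rewrite /diag_entry near_mid_rev nm rev_ordK [rev_ord i == i]eq_sym (negPf ii').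
by rewrite label_rev l1.
Qed.

Lemma diag_entry_far i : 0 < label i -> ~~ near_mid i ->
  D i = ((1 - q ^+ 2) * gamma i / omega0 `|label i|) *: (r `|label i| ** ri `|label i|.-1)
  /\ D (rev_ord i) = (k * gamma (rev_ord i) / omega0 `|label i|.-1)
      *: (r `|label i|.-1 ** ri `|label i|).
Proof.
move=> li nm; have ii' : i != rev_ord i by rewrite -label_eq0 gt_eqF.
rewrite /diag_entry near_mid_rev (negPf nm) rev_ordK [rev_ord i == i]eq_sym (negPf ii').
rewrite label_gt0 in li; rewrite li label_rev abszN ifF //.
by apply/negP => h; move: (ltn_trans li h); rewrite ltnn.
Qed.

Lemma diag_entry_mul_hi i : 0 < label i ->
  D i ** D (rev_ord i) = e.
Proof.
move=> li; have [nm|nm] := boolP (near_mid i).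
  have [-> ->] := diag_entry_near li nm; have /andP[ev _] := nm.
  have l1 := near_mid_gt0 li nm.
  rewrite (ba_Zl mP) (ba_Zr mP) (ra_Ki_K R ev) scalerA -[RHS]scale1r; congr (_ *: _).
  rewrite mulrNN mulrACA gamma1 // (negPf ev) -/k -/(kk s) -expr2 mulfV //.
  by rewrite expf_neq0.
have [-> ->] := diag_entry_far li nm; have l0 : label i != 0 by rewrite gt_eqF.
have ra := label_radius l0; have ra' := label_radius_pred l0 nm.
rewrite (ba_Zl mP) (ba_Zr mP) scalerA -(ba_assoc mP) [ri _ ** (_ ** _)](ba_assoc mP).
rewrite (ra_ri_r R ra') m1l (ra_r_ri R ra) -[RHS]scale1r; congr (_ *: _).
have E (c d u v : F) : c * gamma i / u * (d * gamma (rev_ord i) / v)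
   = c * d * (gamma i * gamma (rev_ord i)) / u / v by ring.
rewrite E gammaE //; have := omega0_neq0 ra; have := omega0_neq0 ra'.
move: (omega0 _) (omega0 _) => u v u0 v0.
have kq : 1 - q ^+ 2 = - (q * k) by rewrite /kk; field.
by rewrite kq; field; rewrite u0 v0 k_neq0 /=.
Qed.

Lemma diag_entry_mul i : D i ** D (rev_ord i) = e.
Proof.
have [l0|l0|l0] := ltgtP (label i) 0; [|exact: diag_entry_mul_hi|].
  have := diag_entry_mul_hi (i := rev_ord i); rewrite rev_ordK => E.
  by rewrite (qc1P (qc1_diag_diag i (rev_ord i))) E // label_rev oppr_gt0.
have ii' : i = rev_ord i by apply/eqP; rewrite -label_eq0 l0.
by rewrite -ii' /diag_entry -ii' eqxx m1l.
Qed.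

Lemma gap_pot_above i : 0 < label i ->
  U i.+1 = (omega0 `|label i|)^-1 *: (r `|label i| ** r `|label i|).
Proof.
move=> li; rewrite /gap_pot ifF; last by apply/negP; move: li; rewrite label_gt0 /=; lia.
by rewrite gap_radius_above // -label_gt0.
Qed.

Lemma gap_pot_below i : 0 < label i -> ~~ near_mid i ->
  U i = (omega0 `|label i|.-1)^-1 *: (r `|label i|.-1 ** r `|label i|.-1).
Proof.
move=> li nm; rewrite /gap_pot -near_midE // (negPf nm).
by rewrite gap_radius_below // -label_gt0.
Qed.

Lemma gap_pot_near i : 0 < label i -> near_mid i -> U i = 0.
Proof. by move=> li nm; rewrite /gap_pot -near_midE // nm. Qed.

Lemma qrho_near i : 0 < label i -> near_mid i -> rh i = 1.
Proof.
move=> li nm; have [ev _] := andP nm; have -> := near_mid_gt0 li nm.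
by rewrite /qrho /rho2 (negPf ev).
Qed.

(** For even N, [rho] vanishes at the labels 1 and -1, so r_1^2 is the sum of two equal products.
    Dividing by 2 is allowed because 2 is the value of [omega0] at 1. *)
Lemma x_near i : 0 < label i -> near_mid i ->
  x i ** x (rev_ord i) = 2^-1 *: (r 1 ** r 1)
  /\ x (rev_ord i) ** x i = 2^-1 *: (r 1 ** r 1).
Proof.
move=> li nm; have l1 := near_mid_gt0 li nm.
have rh1 := qrho_near li nm; have [ev _] := andP nm.
have l0 : label i != 0 by rewrite gt_eqF.
have ii' : rev_ord i != i by rewrite eq_sym -label_eq0.
have := ra_opp1 R l1; rewrite (negPf ev) => /subr0_eq xc.
have ra : radius_range N 1 by have := label_radius l0; rewrite l1.
have two : (2 : F) != 0.
  have := omega0_neq0 ra; have {1}<- : `|label i|%N = 1%N by rewrite l1.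
  by rewrite omega0_label // rh1 invr1.
suff -> : r 1 ** r 1 = 2 *: (x i ** x (rev_ord i)).
  by rewrite scalerA mulVf // scale1r xc.
rewrite (ra_sqr R ra) (bigD1 i) /=; last by rewrite l1.
rewrite (bigD1 (rev_ord i)) /=; last by rewrite label_rev l1 ii'.
rewrite big1 => [|j]; last first.
  have := label_leq_near j nm; rewrite l1 => ->.
  by case: (j == i); case: (j == rev_ord i).
by rewrite addr0 rev_ordK qrho_rev invrK rh1 invr1 -xc -scalerDl.
Qed.

(** The commutator of x^i and x^(-i) and the increment of the squared radius are two linear
    equations for the two products; these are their solutions, expressed in the rescaled squares
    U. *)
Lemma gap_pot_far i : 0 < label i -> ~~ near_mid i ->
  x i ** x (rev_ord i) = U i.+1 - q^-1 *: U i
  /\ x (rev_ord i) ** x i = U i.+1 - q *: U i.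
Proof.
move=> li nm; rewrite gap_pot_above // gap_pot_below //.
have l0 : label i != 0 by rewrite gt_eqF.
have w0 := omega0_neq0 (label_radius l0).
have w0' := omega0_neq0 (label_radius_pred l0 nm).
rewrite (r_sqr_succ li nm); have := x_commutator li nm.
set X := x i ** _; set Y := x (rev_ord i) ** _; set C := r _ ** _.
move: w0 w0'; rewrite (qrho_pred li nm) (omega0_label li).
have := qrho_neq0 s_neq0 i; move: (qrho N s (label i)) => t t0 w0 w0'.
have tt1 : t * t + 1 != 0.
  by apply: contraNneq w0 => tt; rewrite -[X in X == 0](mulfK t0) mulrDl mulVf // tt mul0r.
have qtt1 : q * t * (q * t) + 1 != 0.
  have qt0 : q * t != 0 by rewrite mulf_neq0.
  by apply: contraNneq w0' => tt; rewrite -[X in X == 0](mulfK qt0) mulrDl mulVf // tt mul0r.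
rewrite /kk; move: q q_neq0 {w0 w0'} qtt1 => p p0 qtt1 => XY.
have -> : X = Y + (p - p^-1) / (p * t + (p * t)^-1) *: C by rewrite -XY addrC subrK.
by split; lincomb F B Y C (0 : B) => //; field; rewrite ?t0 ?p0 ?tt1 ?qtt1 ?oner_neq0.
Qed.

Lemma gap_pot_hi i : 0 < label i -> x i ** x (rev_ord i) = U i.+1 - q^-1 *: U i.
Proof.
move=> li; have [nm|nm] := boolP (near_mid i); last exact: (gap_pot_far li nm).1.
have l1 : `|label i|%N = 1%N by move: nm => /andP[_ /eqP].
rewrite (gap_pot_near li nm) scaler0 subr0 gap_pot_above // omega0_label //.
by rewrite (qrho_near li nm) invr1 l1; exact: (x_near li nm).1.
Qed.

Lemma gap_pot_lo i : 0 < label i -> x (rev_ord i) ** x i = U i.+1 - q *: U i.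
Proof.
move=> li; have [nm|nm] := boolP (near_mid i); last exact: (gap_pot_far li nm).2.
have l1 : `|label i|%N = 1%N by move: nm => /andP[_ /eqP].
rewrite (gap_pot_near li nm) scaler0 subr0 gap_pot_above // omega0_label //.
by rewrite (qrho_near li nm) invr1 l1; exact: (x_near li nm).2.
Qed.

Lemma gap_pot_mid i : i = rev_ord i -> x i ** x i = (s + s^-1) *: U i.
Proof.
move=> ii'; have [oN l0 g0] := label_mid ii'.
rewrite /gap_pot ifF; last by apply/negP; move: oN; lia.
rewrite g0 /omega0 eqxx (ra_r0 R l0) scalerA mulfV ?scale1r //.
exact: sV_neq0.
Qed.

Lemma radial_torus : torus s m e x D U V.
Proof.
split.
- move=> i j ij ji'; apply: (ra_xx R ij).
  by apply: contraNneq ji' => ->; rewrite rev_ordK.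
- by move=> i; rewrite -label_gt0; apply: gap_pot_hi.
- by move=> i; rewrite -label_gt0; apply: gap_pot_lo.
- exact: gap_pot_mid.
- move=> p pN; rewrite /gap_pot gap_radius_sym //; congr (if _ then _ else _).
  by apply/eqP/eqP; lia.
- move=> p pN; rewrite /gap_pot_inv gap_radius_sym //; congr (if _ then _ else _).
  by apply/eqP/eqP; lia.
- by move=> p p2; rewrite /gap_pot p2 eqxx.
- by move=> p p2; rewrite /gap_pot_inv p2 eqxx.
- exact: gap_UV.
- exact: gap_VU.
- move=> p t pN tN; apply: qc1P; apply: qc1_gap_inv => // a ra.
  exact: qc1_sym (qc1_r_gap_inv ra pN).
- by move=> i p; apply: qc_x_gap.
- by move=> i p; apply: qc_x_gap_inv.
- exact: diag_entry_mul.
- move=> i j ij ij'; have := qc_x_diag i j.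
  rewrite [j == i]eq_sym (negPf ij) (_ : (j == rev_ord i) = false); first by case: ifP.
  by apply: negbTE; apply: contraNN ij' => /eqP ->; rewrite rev_ordK.
- by move=> i ii'; have := qc_x_diag i i; rewrite eqxx (negPf ii').
- by move=> i ii'; have := qc_x_diag i (rev_ord i); rewrite eqxx (negPf ii') eq_sym (negPf ii').
- by move=> i ii'; rewrite /diag_entry -ii' eqxx.
- move=> i p pN; apply: qc1_gap_inv => // a ra; exact: qc1_sym (qc1_r_diag i ra).
- exact: qc1_diag_diag.
Qed.

Lemma rinv_comm a b : radius_range N a -> radius_range N b ->
  ri a ** ri b = ri b ** ri a /\ r a ** ri b = ri b ** r a.
Proof.
move=> ra rb; split; apply: qc1P; last exact: (qc1_r rb (ra_rr R ra rb)).
by apply: qc1_r => //; apply: qc1_sym; apply: qc1_r => //; exact: (ra_rr R rb ra).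
Qed.

Lemma gap_pot_inv_above h : 0 < label h ->
  V h.+1 = omega0 `|label h| *: (ri `|label h| ** ri `|label h|).
Proof.
move=> lh; rewrite /gap_pot_inv ifF; last by apply/negP; move: lh; rewrite label_gt0 /=; lia.
by rewrite gap_radius_above // -label_gt0.
Qed.

Lemma gap_pot_inv_below h : label h < 0 -> ~~ near_mid h ->
  V h.+1 = omega0 `|label h|.-1 *: (ri `|label h|.-1 ** ri `|label h|.-1).
Proof.
move=> lh nm; have hN := ltn_ord h.
have lh' : 0 < label (rev_ord h) by rewrite label_rev oppr_gt0.
have gE : gap_radius h.+1 = `|label h|.-1%N.
  rewrite -gap_radius_sym // -[(N - h.+1)%N]/(val (rev_ord h)).
  by rewrite gap_radius_below -?label_gt0 // label_rev abszN.
rewrite /gap_pot_inv gE ifF //; apply/negP => /eqP h2; case/negP: nm.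
rewrite -near_mid_rev near_midE //=; apply/eqP; lia.
Qed.

(* [Lambda^-1 lambda_h = gamma_h *: radial_z h]. *)
Definition radial_z h : B :=
  if label h == 0 then ri 0%N
  else if near_mid h then
    2 *: (ri 1%N ** ri 1%N ** x (rev_ord h) ** (if label h == 1 then Ki else K))
  else ri `|label h| ** ri `|label h|.-1 ** x (rev_ord h).

Lemma radial_z_far h : label h != 0 -> ~~ near_mid h ->
  torus_z s m x D V h = gamma h *: radial_z h.
Proof.
move=> l0 nm; rewrite /torus_z /radial_z (negPf l0) (negPf nm).
rewrite ifF; last by apply: contraNF nm => /mid_pair_near[].
have ra := label_radius l0; have ra' := label_radius_pred l0 nm.
have w0 := omega0_neq0 ra; have w0' := omega0_neq0 ra'.
have hh' : h != rev_ord h by rewrite -label_eq0.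
rewrite /diag_entry (negPf hh') (negPf nm).
have rrr a b : radius_range N a -> radius_range N b ->
    r a ** ri b ** (ri a ** ri a) = ri a ** ri b.
  move=> ra1 rb1; rewrite (ba_assoc mP) -[r a ** ri b ** ri a](ba_assoc mP).
  rewrite (rinv_comm rb1 ra1).1 (ba_assoc mP) (ra_r_ri R ra1) m1l.
  exact: (rinv_comm rb1 ra1).1.
have [lh|lh] := boolP (rev_ord h < h)%N.
  rewrite gap_pot_inv_above ?label_gt0 // (ba_Zl mP) (ba_Zr mP) !scalerA (ba_Zl mP) scalerA rrr //.
  by congr (_ *: _); field; rewrite w0 /= -oppr_eq0 opprB subr_eq0 -subr_eq0.
have lh' : label h < 0 by rewrite lt_neqAle l0 leNgt label_gt0.
rewrite ifT -?label_lt0 //.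
rewrite gap_pot_inv_below // (ba_Zl mP) (ba_Zr mP) !scalerA (ba_Zl mP) scalerA rrr //.
rewrite (rinv_comm ra' ra).1; congr (_ *: _); field; rewrite w0' /=.
exact: k_neq0.
Qed.

(** Here D_h = 1 and V = (s + s^-1) r_0^-2, so the normalization s / (1 - q^2) of [torus_z] yields
    the scalar 1 / (1 - s^2), which is the prescribed [gamma0]. *)
Lemma radial_z_mid h : label h = 0 -> torus_z s m x D V h = gamma h *: radial_z h.
Proof.
move=> l0; have hh' : h = rev_ord h by apply/eqP; rewrite -label_eq0 l0.
have [oN _ g0] := label_mid hh'.
have r0 : radius_range N 0 by rewrite /radius_range oN.
rewrite /torus_z /radial_z l0 eqxx ifF; last first.
  by apply/negP => /mid_pair_near[_]; rewrite l0.
rewrite -hh' ltnn /diag_entry -hh' eqxx m1l /gap_pot_inv ifF; last by apply/negP; lia.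
have -> : gap_radius h.+1 = 0%N.
  by rewrite -gap_radius_sym // -[(N - h.+1)%N]/(val (rev_ord h)) -hh'.
rewrite -(ra_r0 R l0) (ba_Zl mP) -(ba_assoc mP) (ra_ri_r R r0) m1r scalerA.
rewrite gamma0 // /omega0 eqxx; congr (_ *: _); rewrite /qq.
field; rewrite s_neq0 ss_neq1 /= -oppr_eq0 opprB.
by rewrite [X in X - 1]expr2.
Qed.

Lemma near_radius h : near_mid h -> radius_range N 1.
Proof.
move=> nm; have [_ /eqP <-] := andP nm; apply: label_radius.
by apply/eqP => l0; move: nm; rewrite /near_mid l0 andbF.
Qed.

Lemma omega0_near h : near_mid h -> omega0 1 = 2.
Proof.
move=> nm; wlog lh : h nm / 0 < label h => [W|].
  have [lh|lh|lh] := ltgtP (label h) 0; [|exact: (W h)|].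
    by apply: (W (rev_ord h)); rewrite ?near_mid_rev // label_rev oppr_gt0.
  by move: nm; rewrite /near_mid lh andbF.
have [_ /eqP l1] := andP nm; transitivity (rh h + (rh h)^-1); last by rewrite (qrho_near lh nm) invr1.
by rewrite -omega0_label ?l1.
Qed.

Lemma radial_z_near h : near_mid h -> torus_z s m x D V h = gamma h *: radial_z h.
Proof.
move=> nm; have [ev /eqP l1] := andP nm; have r1 := near_radius nm.
have l0 : label h != 0 by rewrite -absz_eq0 l1.
have lh : label h != 1 -> label h = -1 by case: (near_mid_label nm) => ->.
have hh' : (h == rev_ord h) = false by rewrite -label_eq0 (negPf l0).
have Kri L : qc 1 K L -> qc 1 Ki L.
  by move=> KL; apply: qc1_sym; apply: qc1_K => //; apply: qc1_sym.
have KV : qc 1 (if label h == 1 then Ki else K) (ri 1%N ** ri 1%N).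
  have Kr : qc 1 K (ri 1%N) by apply: qc1_r => //; exact: (ra_Kr R ev r1).
  by case: ifP => _; apply: qc1_mul; auto.
have xK : qc q^-1 (x (rev_ord h)) (if label h == 1 then Ki else K).
  have := qc_x_Ki (rev_ord h) ev; have := qc_x_K (rev_ord h) ev.
  rewrite label_rev; have [->|n1] := eqVneq (label h) 1; first by [].
  by rewrite (lh n1).
have [V1 c1] : V (if mid_pair h then h.+2 else h.+1) = 2 *: (ri 1%N ** ri 1%N)
   /\ (if label h == 1 then true else mid_pair h).
  have [l1'|n1] := eqVneq (label h) 1.
    rewrite ifF; last by apply/negP => /mid_pair_near[_]; rewrite l1'.
    by rewrite gap_pot_inv_above ?l1' // (omega0_near nm).
  have lh' : label (rev_ord h) = 1 by rewrite label_rev (lh n1).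
  have hm := near_mid_pair nm (lh n1).
  rewrite hm; split=> //; have := gap_pot_inv_above (h := rev_ord h).
  by rewrite lh' (omega0_near nm) (eqP hm) => ->.
have -> : torus_z s m x D V h = (1 - q ^+ 2)^-1 *:
    (D h ** V (if mid_pair h then h.+2 else h.+1) ** x (rev_ord h)).
  rewrite /torus_z; case: (mid_pair h) c1 => //.
  by case: eqVneq => // l1' _; rewrite ifT // -label_gt0 l1'.
rewrite V1 /radial_z (negPf l0) nm /diag_entry hh' nm.
move: (if label h == 1 then Ki else K) KV xK => L KV xK.
rewrite -[ri 1%N ** ri 1%N ** _ ** _](ba_assoc mP) xK !(ba_Zl mP) !(ba_Zr mP) (ba_Zl mP) !scalerA.
rewrite (qc1P KV) (ba_assoc mP); congr (_ *: _); rewrite /kk; field.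
by rewrite q_neq0 /= -oppr_eq0 opprB subr_eq0 -subr_eq0 expr2.
Qed.

Lemma radial_zE h : torus_z s m x D V h = gamma h *: radial_z h.
Proof.
have [l0|l0] := eqVneq (label h) 0; first exact: radial_z_mid.
have [nm|nm] := boolP (near_mid h); [exact: radial_z_near|exact: radial_z_far].
Qed.

(** The inverse of x^(1) or x^(-1) for even N, obtained from [x_near]. It identifies the [ring_inv]
    in the definition of [lambda]. *)
Lemma x_near_inv h : near_mid h ->
  x h ** (2 *: (ri 1%N ** ri 1%N ** x (rev_ord h))) = e /\
  2 *: (ri 1%N ** ri 1%N ** x (rev_ord h)) ** x h = e.
Proof.
move=> nm; have r1 := near_radius nm.
have two : (2 : F) != 0 by rewrite -(omega0_near nm) omega0_neq0.
have xx' i : near_mid i -> x i ** x (rev_ord i) = 2^-1 *: (r 1 ** r 1).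
  move=> nmi; have [li|li|li] := ltgtP (label i) 0.
  - have := (x_near (i := rev_ord i)); rewrite rev_ordK near_mid_rev label_rev oppr_gt0.
    by move=> /(_ li nmi)[].
  - exact: (x_near li nmi).1.
  by move: nmi; rewrite /near_mid li andbF.
have rr : ri 1 ** ri 1 ** (r 1 ** r 1) = e.
  by rewrite (ba_assoc mP) -[ri 1 ** ri 1 ** r 1](ba_assoc mP) (ra_ri_r R r1) m1r (ra_ri_r R r1).
have xri : qc 1 (x h) (ri 1 ** ri 1).
  by apply: qc1_mul; have := qc_x_rinv h r1; case: (near_mid_label nm) => ->.
split.
  rewrite (ba_Zr mP) (ba_assoc mP) (qc1P xri) -(ba_assoc mP) xx' // (ba_Zr mP) rr.
  by rewrite scalerA mulfV // scale1r.
have := xx' (rev_ord h); rewrite near_mid_rev rev_ordK => /(_ nm) xhh.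
rewrite (ba_Zl mP) -(ba_assoc mP) xhh (ba_Zr mP) rr.
by rewrite scalerA mulfV // scale1r.
Qed.

Section Dilation.
Variable L : B.
Hypotheses (Lx : forall i, qc q^-1 L (x i))
  (Lr : forall a, radius_range N a -> qc q^-1 L (r a))
  (LK : ~~ odd N -> qc 1 L K).

Lemma radial_z_dilation h : qc q L (radial_z h).
Proof.
have Lri a : radius_range N a -> qc q L (ri a).
  by move=> ra; apply: (qc_inv (ra_r_ri R ra) (ra_ri_r R ra) _ (Lr ra)); rewrite mulfV.
have mul3 u v w : qc q L u -> qc q L v -> qc q^-1 L w -> qc q L (u ** v ** w).
  by move=> Lu Lv Lw; apply: (qc_mr mP (qc_mr mP Lu Lv erefl) Lw); rewrite mulfK.
rewrite /radial_z; have [l0|l0] := eqVneq (label h) 0.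
  by apply: Lri; have oN := label0_odd l0; rewrite /radius_range oN.
have [nm|nm] := boolP (near_mid h); last first.
  by apply: mul3 => //; apply: Lri; [apply: label_radius|apply: label_radius_pred].
apply: (qc_zr mP); have r1 := near_radius nm; have [ev _] := andP nm.
apply: (qc_mr mP (d := 1)); first by apply: mul3 => //; apply: Lri.
  by case: ifP => _; [apply: qc1_K|]; auto.
by rewrite mulr1.
Qed.

(** With respect to the dilation L, z has degree -1 and x degree 1, so their q-commutator has degree
    0. *)
Lemma borel_entry_dilation i j : qc 1 L (borel_entry s m x D V i j).
Proof.
rewrite /borel_entry; apply: (qc_zr mP); rewrite /qcomm radial_zE.
have Lz := qc_zr mP (gamma (rev_ord i)) (radial_z_dilation (rev_ord i)).
move: (gamma _ *: _) Lz => w Lz; rewrite /qcommutes (ba_Br mP) (ba_Bl mP) scale1r.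
rewrite (ba_Zr mP) (ba_Zl mP).
have E1 := qc_mr mP Lz (Lx (rev_ord j)) erefl.
have E2 := qc_mr mP (Lx (rev_ord j)) Lz erefl.
by congr (_ - _ *: _); apply: qc1P; rewrite /qcommutes ?E1 ?E2 ?mulfV ?mulVf.
Qed.

End Dilation.

End Radii.

(** * The homomorphism *)

Lemma bilinear_assoc_mul (K : fieldType) (G : choiceType)
    (rel : free_alg K G -> free_alg K G -> Prop) :
  bilinear_assoc (fun a b : presented rel => a * b).
Proof.
split=> [a b c|a b c|a b c|c a b|c a b]; first exact: mulrA.
- exact: mulrDl.
- exact: mulrDr.
- by rewrite presented_scalerAl.
- by rewrite presented_scalerAr.
Qed.

Section ProjRel.
Variables (K : comNzRingType) (G : choiceType).
Variable rel : free_alg K G -> free_alg K G -> Prop.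

Lemma projM u v : proj rel (u * v) = proj rel u * proj rel v.
Proof. exact: rmorphM. Qed.

Lemma proj_rel u v : rel u v -> proj rel u = proj rel v.
Proof.
by move=> uv; apply/projP; have := in_ideal_gen 1 1 uv; rewrite mul1r mulr1.
Qed.

Lemma proj_rel_inv u v : rel (u * v) 1 -> proj rel u * proj rel v = 1.
Proof. by move=> uv; rewrite -projM (proj_rel uv) rmorph1. Qed.

Lemma proj_rel_comm u v : rel (u * v) (v * u) ->
  proj rel u * proj rel v = proj rel v * proj rel u.
Proof. by move=> uv; rewrite -projM (proj_rel uv) projM. Qed.

Lemma proj_rel_qcomm c u v : rel (u * v) (c *: (v * u)) ->
  proj rel u * proj rel v = c *: (proj rel v * proj rel u).
Proof. by move=> uv; rewrite -projM (proj_rel uv) linearZ /= projM. Qed.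

End ProjRel.

(** * The extended quantum Euclidean algebra as a radial algebra *)

Section Concrete.
Variables (F : fieldType) (N : nat) (s : F).
Hypothesis s_neq0 : s != 0.
Implicit Types (i j h : 'I_N) (a p : nat).

Local Notation rh i := (qrho N s (label i)).
Local Notation q := (qq s).
Local Notation k := (kk s).
Local Notation A := (qea N s).
Local Notation x := (xx s).
Local Notation r := (@rr F N s).
Local Notation ri := (@rr_inv F N s).
Local Notation Lam := (Lam N s).
Local Notation Lami := (Lam_inv N s).
Local Notation K := (KK N s).
Local Notation Ki := (KK_inv N s).
Local Notation mul := (fun a b : A => a * b).
Local Notation qc := (@qcommutes F A mul).

Let q_neq0 : q != 0. Proof. exact: expf_neq0. Qed.

Let mP : bilinear_assoc mul := bilinear_assoc_mul (@qea_rel F N s).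

Let qc1I (a b : A) : a * b = b * a -> qc 1 a b. Proof. by rewrite /qcommutes scale1r. Qed.

Lemma qea_r_inv a : radius_range N a -> r a * ri a = 1 /\ ri a * r a = 1.
Proof.
move=> ra; split.
  exact: (proj_rel_inv (qea_Rinv s false ra)).
exact: (proj_rel_inv (qea_Rinv s true ra)).
Qed.

Lemma qea_Lam_inv : Lam * Lami = 1 /\ Lami * Lam = 1.
Proof.
split.
  exact: (proj_rel_inv (qea_Laminv N s false)).
exact: (proj_rel_inv (qea_Laminv N s true)).
Qed.

Lemma qea_K_inv : ~~ odd N -> K * Ki = 1 /\ Ki * K = 1.
Proof.
move=> ev; split.
  exact: (proj_rel_inv (qea_Kinv s false ev)).
exact: (proj_rel_inv (qea_Kinv s true ev)).
Qed.

Lemma qea_xx i j : (i < j)%N -> i != rev_ord j -> qc q (x i) (x j).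
Proof. move=> ij ij'; exact: (proj_rel_qcomm (qea_XX s ij ij')). Qed.

Lemma qea_xr i a : radius_range N a ->
  qc (if a%:Z < label i then q^-1 else if label i < - a%:Z then q else 1) (x i) (r a).
Proof.
move=> ra; case: ltP => [lt|le].
  exact: (proj_rel_qcomm (qea_XRhigh s ra lt)).
case: ltP => [lt|ge].
  exact: (proj_rel_qcomm (qea_XRlow s ra lt)).
have la : (`|label i| <= a)%N by lia.
exact: (qc1I (proj_rel_comm (qea_XRin s ra la))).
Qed.

Lemma qea_rr a b : radius_range N a -> radius_range N b -> qc 1 (r a) (r b).
Proof.
move=> ra rb; exact: (qc1I (proj_rel_comm (qea_RR s ra rb))).
Qed.

Lemma qea_xLam i : qc q (x i) Lam.
Proof. exact: (proj_rel_qcomm (qea_XLam s i)). Qed.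

Lemma qea_rLam a : radius_range N a -> qc q (r a) Lam.
Proof. move=> ra; exact: (proj_rel_qcomm (qea_RLam s ra)). Qed.

Lemma qea_Kx i : ~~ odd N ->
  qc (if label i == 1 then q else if label i == -1 then q^-1 else 1) K (x i).
Proof.
move=> ev; case: eqP => [l1|n1].
  exact: (proj_rel_qcomm (qea_KX1 s ev l1)).
case: eqP => [l1|n1'].
  exact: (proj_rel_qcomm (qea_KXN1 s ev l1)).
have l2 : (1 < `|label i|)%N.
  have : label i != 0 by rewrite label_eq0 -val_eqE /=; have := ltn_ord i; lia.
  by lia.
exact: (qc1I (proj_rel_comm (qea_KX s ev l2))).
Qed.

Lemma qea_Kr a : ~~ odd N -> radius_range N a -> qc 1 K (r a).
Proof. move=> ev ra; exact: (qc1I (proj_rel_comm (qea_KR s ev ra))). Qed.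

Lemma qea_KLam : ~~ odd N -> qc 1 K Lam.
Proof. move=> ev; exact: (qc1I (proj_rel_comm (qea_KLam s ev))). Qed.

Lemma qea_r_sqr a : radius_range N a ->
  r a ^+ 2 = \sum_(i : 'I_N | (`|label i| <= a)%N) (rh i)^-1 *: (x i * x (rev_ord i)).
Proof.
move=> ra; transitivity (proj (@qea_rel F N s) (fR F N a false ^+ 2)).
  by rewrite (rmorphXn (proj (@qea_rel F N s))).
rewrite (proj_rel (qea_Rsqr s ra)) (raddf_sum (proj (@qea_rel F N s))).
apply: eq_bigr => i li; rewrite (raddf_sum (proj (@qea_rel F N s))).
rewrite (bigD1 (rev_ord i)) /=; last by rewrite label_rev abszN.
rewrite big1 => [|j /andP[_ ji]].
  rewrite addr0 linearZ /= /metric eqxx.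
  by rewrite (rmorphM (proj (@qea_rel F N s)) (fX F i) (fX F (rev_ord i))).
by rewrite /metric (negPf ji) scale0r (raddf0 (proj (@qea_rel F N s))).
Qed.

Local Notation p := (proj (@qea_rel F N s)).

Lemma proj_sqr (u : free_alg F (qea_gen N)) : p (u ^+ 2) = p u * p u.
Proof. by rewrite (rmorphXn p) expr2. Qed.

Lemma proj_comm (u v : free_alg F (qea_gen N)) : p (u * v - v * u) = p u * p v - p v * p u.
Proof. rewrite (raddfB p); congr (_ - _); exact: projM. Qed.

Lemma qea_radial : radial_algebra s mul 1 x r ri K Ki.
Proof.
split.
- by move=> a ra; exact: (qea_r_inv ra).1.
- by move=> a ra; exact: (qea_r_inv ra).2.
- by move=> ev; exact: (qea_K_inv ev).1.
- by move=> ev; exact: (qea_K_inv ev).2.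
- exact: qea_xx.
- move=> i li; transitivity (p (fX F i * fX F (rev_ord i) - fX F (rev_ord i) * fX F i)).
    exact: esym (proj_comm _ _).
  rewrite (proj_rel (qea_XXopp s li)) linearZ /=; congr (_ *: _).
  exact: proj_sqr.
- move=> i li; transitivity (p (fX F i * fX F (rev_ord i) - fX F (rev_ord i) * fX F i)).
    exact: esym (proj_comm _ _).
  rewrite (proj_rel (qea_XXopp1 s li)); case: ifP => _; last exact: raddf0.
  rewrite linearZ /=; congr (_ *: _).
  exact: proj_sqr.
- move=> a ra; rewrite -(qea_r_sqr ra); exact: esym (expr2 _).
- by move=> i li; exact: (proj_rel (qea_R0 s li)).
- exact: qea_xr.
- exact: qea_rr.
- exact: qea_Kx.
- exact: qea_Kr.
Qed.

End Concrete.

(** Induction from the inside out: once the inner product is 1, the first and last factors are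
    adjacent and cancel. For odd n the innermost factor is the self-opposite one. *)
Lemma prod_rev_inv (A : pzRingType) n (f : 'I_n -> A) :
  (forall i, f i * f (rev_ord i) = 1) -> (forall i, i = rev_ord i -> f i = 1) ->
  \prod_(i < n) f i = 1.
Proof.
elim/ltn_ind: n f => -[|[|n]] IH f fV fmid; first by rewrite big_ord0.
  by rewrite big_ord_recl big_ord0 mulr1 fmid //; apply: val_inj.
rewrite big_ord_recl big_ord_recr /= mulrA [\prod_(i < n) _]IH //=.
- rewrite mulr1 -[RHS](fV ord0); congr (_ * f _); apply: val_inj => /=.
  by rewrite /bump /=; lia.
- move=> i; rewrite -[RHS](fV (lift ord0 (widen_ord (leqnSn n) i))).
  congr (f _ * f _); apply: val_inj => //=; rewrite /bump /=; have := ltn_ord i; lia.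
move=> i ii'; apply: fmid; apply: val_inj => /=; rewrite /bump /=.
by have := congr1 val ii' => /=; have := ltn_ord i; lia.
Qed.

Lemma ring_invE (A : pzRingType) (a b : A) : a * b = 1 -> b * a = 1 -> ring_inv a = b.
Proof.
move=> ab ba; apply: xget_unique => // c [ac ca].
by rewrite -[c]mul1r -ba -mulrA ac mulr1.
Qed.

Section EvalFree.
Variables (K : comNzRingType) (G H : choiceType).
Variable rel' : free_alg K H -> free_alg K H -> Prop.
Variable g : G -> presented rel'.
Local Notation ev := (eval_free g).

Lemma eval_free_mul u v : ev (u * v) = ev u * ev v.
Proof. exact: rmorphM. Qed.

Lemma eval_free_scale c u : ev (c *: u) = c *: ev u.
Proof. exact: linearZ. Qed.

Lemma eval_free_sum2 (I : finType) (c : I -> I -> K)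
    (u v : I -> I -> free_alg K G) (u' v' : I -> I -> presented rel') :
  (forall a b, ev (u a b) = u' a b) -> (forall a b, ev (v a b) = v' a b) ->
  ev (\sum_a \sum_b c a b *: (u a b * v a b))
  = \sum_a \sum_b c a b *: (u' a b * v' a b).
Proof.
move=> uE vE; rewrite (raddf_sum ev); apply: eq_bigr => a _.
rewrite (raddf_sum ev); apply: eq_bigr => b _.
transitivity (c a b *: ev (u a b * v a b)); first exact: eval_free_scale.
by congr (_ *: _); rewrite -uE -vE; exact: eval_free_mul.
Qed.

End EvalFree.

Lemma metric_sum (F : fieldType) N (s : F) (W : lmodType F) (f : 'I_N -> 'I_N -> W) i j :
  \sum_h \sum_k (metric s i h * metric s k j) *: f h k
  = (qrho N s (label j) / qrho N s (label i)) *: f (rev_ord i) (rev_ord j).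
Proof.
rewrite (bigD1 (rev_ord i)) //= [X in _ + X]big1 ?addr0 => [|h hi]; last first.
  by apply: big1 => k _; rewrite /metric (negPf hi) mul0r scale0r.
rewrite (bigD1 (rev_ord j)) //= big1 ?addr0 => [|k kj]; last first.
  rewrite /metric; have -> : (j == rev_ord k) = false by rewrite -rev_ord_eq eq_sym (negPf kj).
  by rewrite mulr0 scale0r.
by rewrite /metric rev_ordK !eqxx qrho_rev invrK mulrC.
Qed.

(** This is the origin of the q in [qcomm]: extracting Lambda from an ordinary commutator requires
    moving it past x. *)
Lemma dilation_commutator (K : comNzRingType) (G : choiceType)
    (rel : free_alg K G -> free_alg K G -> Prop) (c : K) (a ai w u : presented rel) :
  ai * a = 1 -> u * a = c *: (a * u) ->
  ai * ((a * w) * u - u * (a * w)) = w * u - c *: (u * w).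
Proof.
move=> aia ua; rewrite mulrBr !mulrA aia mul1r -[ai * u * a]mulrA ua.
by rewrite -presented_scalerAr mulrA aia mul1r presented_scalerAl.
Qed.

(** * Construction of the homomorphism *)

Section Assembly.
Variables (F : fieldType) (N : nat) (s : F).
Hypotheses (s_neq0 : s != 0) (k_neq0 : kk s != 0).
Hypothesis omega0_neq0 : forall a, radius_range N a -> omega0 N s a != 0.
Variable gamma : 'I_N -> F.
Local Notation q := (qq s).
Hypothesis gamma0 : forall i, label i = 0 -> gamma i = - (s^-1 * (s - s^-1)^-1).
Hypothesis gamma1 : forall i, label i = 1 -> gamma i * gamma (rev_ord i) =
  if odd N then - (q^-1 * (s - s^-1) ^- 2) else (q - q^-1) ^- 2.
Hypothesis gamma_gt1 : forall i, 1 < label i -> gamma i * gamma (rev_ord i) =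
  - (q^-1 * (q - q^-1) ^- 2 * omega N s (label i) * omega N s (label i - 1)).

Local Notation A := (qea N s).
Local Notation mul := (fun a b : A => a * b).
Local Notation x := (xx s).
Local Notation r := (@rr F N s).
Local Notation ri := (@rr_inv F N s).
Local Notation Lam := (Lam N s).
Local Notation Lami := (Lam_inv N s).
Local Notation K := (KK N s).
Local Notation Ki := (KK_inv N s).
Local Notation D := (diag_entry s mul 1 r ri K Ki gamma).
Local Notation V := (gap_pot_inv N s mul ri).
Local Notation L := (borel_entry s mul x D V).
Local Notation z := (radial_z mul x ri K Ki).

Let q_neq0 : q != 0. Proof. exact: expf_neq0. Qed.
Let mP : bilinear_assoc mul := bilinear_assoc_mul (@qea_rel F N s).
Let m1l : left_id 1 mul. Proof. exact: mul1r. Qed.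
Let m1r : right_id 1 mul. Proof. exact: mulr1. Qed.
Let R := qea_radial N s_neq0.

Let T : torus s mul 1 x D (gap_pot N s mul r) V :=
  radial_torus s_neq0 mP m1l m1r R omega0_neq0 k_neq0 gamma1 gamma_gt1.

Let zE h : torus_z s mul x D V h = gamma h *: z h.
Proof. exact: (radial_zE s_neq0 mP m1l m1r R omega0_neq0 k_neq0 gamma0). Qed.

Lemma lambdaE h : lambda s gamma h = gamma h *: (Lam * z h).
Proof.
rewrite /lambda /radial_z; congr (_ *: _).
have [l0|l0] := eqVneq (label h) 0.
  congr (_ * _); have oN := label0_odd l0.
  have r0 : radius_range N 0 by rewrite /radius_range oN.
  rewrite -(ra_r0 R l0); apply: ring_invE; first exact: (ra_r_ri R r0).
  exact: (ra_ri_r R r0).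
have [nm|nm] := boolP (near_mid h).
  have [ev /eqP l1] := andP nm.
  have [xu ux] := x_near_inv s_neq0 mP m1l m1r R omega0_neq0 k_neq0 nm.
  rewrite (ring_invE xu ux) ev /=; move: (_ * x (rev_ord h)) => u.
  have Zm (w : A) : Lam * (2 *: u) * w = Lam * (2 *: (u * w)).
    rewrite -[RHS]presented_scalerAr -[Lam * (2 *: u)]presented_scalerAr.
    by rewrite -[LHS]presented_scalerAl mulrA.
  have [l1'|l1'] := boolP (label h == 1); first exact: Zm.
  rewrite ifT; last by apply/eqP; lia.
  exact: Zm.
rewrite !ifF; first by rewrite !mulrA.
- by apply: contraNF nm => /andP[ev /eqP l1]; rewrite /near_mid ev l1.
- by apply: contraNF nm => /andP[ev /eqP l1]; rewrite /near_mid ev l1.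
Qed.

Lemma lambda_commutator h k :
  Lami * (lambda s gamma h * x k - x k * lambda s gamma h)
  = qcomm s mul x (gamma h *: z h) k.
Proof.
have -> : lambda s gamma h = Lam * (gamma h *: z h).
  by rewrite lambdaE; exact: presented_scalerAr.
exact: (dilation_commutator _ (qea_Lam_inv N s).2 (qea_xLam s k)).
Qed.

Lemma borel_commutator i j :
  L i j = \sum_h \sum_k (metric s i h * metric s k j) *:
     (Lami * (lambda s gamma h * x k - x k * lambda s gamma h)).
Proof.
rewrite metric_sum lambda_commutator -zE.
exact: erefl.
Qed.

Lemma prod_borel_diag : \prod_(i < N) L i i = 1.
Proof.
have LD i : L i i = D (rev_ord i) := borel_entry_diag s_neq0 mP k_neq0 m1l m1r T i.
apply: prod_rev_inv => [i|i ii']; rewrite !LD.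
  exact: (torus_DD T).
by rewrite -ii'; exact: (torus_Dmid T ii').
Qed.

Definition borel_map (ij : 'I_N * 'I_N) : A := L ij.1 ij.2.

Lemma borel_liftP : exists psi : {rmorphism uqso N s -> A},
  scalable psi /\ forall i j, psi (LL s i j) = L i j.
Proof.
have gL i j : eval_free borel_map (fL F i j) = L i j by exact: eval_free_gen.
have gL1 c : eval_free borel_map c%:A = c *: (1 : A).
  transitivity (c *: eval_free borel_map 1); first exact: eval_free_scale.
  by congr (_ *: _); exact: rmorph1.
have [|psi [psiZ psiE]] := @presented_liftP F _ _ (@uqso_rel F N s) (@qea_rel F N s) borel_map.
  move=> _ _ [i j ij||i l|i l|a b c d].
  - by rewrite gL (raddf0 (eval_free borel_map)) (borel_entry_tri s_neq0 mP k_neq0 T ij).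
  - rewrite (rmorph_prod (eval_free borel_map)) (rmorph1 (eval_free borel_map)).
    by rewrite -[RHS]prod_borel_diag; apply: eq_bigr => i _; exact: gL.
  - rewrite gL1 -(borel_entry_metric_up s_neq0 mP k_neq0 m1l m1r T).
    by apply: eval_free_sum2 => *; exact: gL.
  - rewrite gL1 -(borel_entry_metric_down s_neq0 mP k_neq0 m1l m1r T).
    by apply: eval_free_sum2 => *; exact: gL.
  transitivity (\sum_c0 \sum_d0 Rhat s a b c0 d0 *: (L d0 d * L c0 c)).
    by apply: eval_free_sum2 => *; exact: gL.
  rewrite (borel_entry_RLL s_neq0 mP k_neq0 m1l m1r T).
  by apply: esym; apply: eval_free_sum2 => *; exact: gL.
by exists psi; split=> // i j; exact: psiE.
Qed.

Lemma Lam_borel i j : Lam * L i j = L i j * Lam.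
Proof.
have C : qcommutes mul 1 Lam (L i j).
  apply: (borel_entry_dilation s_neq0 mP m1l m1r R omega0_neq0 k_neq0 gamma0).
  - by move=> h; apply: qc_sym (qea_xLam s h); rewrite mulVf.
  - by move=> c rc; apply: qc_sym (qea_rLam s rc); rewrite mulVf.
  by move=> ev; apply: qc_sym (qea_KLam s ev); rewrite mulr1.
exact: (qc1P C).
Qed.

Lemma cross_liftP : exists phi : {rmorphism cross N s -> A},
  [/\ scalable phi, forall a, phi (of_qea a) = a
    & forall i j, phi (of_uqso (LL s i j)) = L i j].
Proof.
have [psi [psiZ psiE]] := borel_liftP.
(* The cross product has one generator per element of either algebra, so the map is prescribed on
   all elements; the relations encoding the two inclusions hold because the identity and [psi] are
   homomorphisms. *)
pose g (w : A + uqso N s) : A := match w with inl a => a | inr u => psi u end.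
have gA a : eval_free g (fA a) = a by exact: eval_free_gen.
have gU u : eval_free g (fU u) = psi u by exact: eval_free_gen.
have gM u v : eval_free g (u * v) = eval_free g u * eval_free g v := eval_free_mul g u v.
have gZ c u : eval_free g (c *: u) = c *: eval_free g u := eval_free_scale g c u.
have gD u v : eval_free g (u + v) = eval_free g u + eval_free g v := raddfD (eval_free g) u v.
have [|phi [phiZ phiE]] := @presented_liftP F _ _ (@cross_rel F N s) (@qea_rel F N s) g.
  move=> _ _ [a b|c a|a b||u v|c u|u v||i a b|a b].
  - by rewrite gD !gA.
  - by rewrite gZ !gA.
  - rewrite gM !gA; exact: erefl.
  - rewrite gA; exact: esym (rmorph1 (eval_free g)).
  - by rewrite gD !gU (raddfD psi).
  - by rewrite gZ !gU psiZ.
  - rewrite gM !gU; exact: rmorphM.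
  - rewrite gU (rmorph1 psi); exact: esym (rmorph1 (eval_free g)).
  - rewrite gM gA gU psiE (borel_entry_cross s_neq0 mP k_neq0 m1l m1r T).
    apply: esym; apply: eval_free_sum2 => *; last exact: gA.
    by rewrite gU.
  have E1 : eval_free g (fA (Lam : A) * fU (LL s a b)) = Lam * L a b by rewrite gM gA gU psiE.
  have E2 : eval_free g (fU (LL s a b) * fA (Lam : A)) = L a b * Lam by rewrite gM gA gU psiE.
  exact: etrans E1 (etrans (Lam_borel a b) (esym E2)).
exists phi; split=> [|a|i j]; [exact: phiZ|exact: (phiE (inl a))|].
by rewrite -psiE; exact: (phiE (inr (LL s i j))).
Qed.

End Assembly.

(** * Nonvanishing of k and of the omega_a *)

Section NotRootOfUnity.
Variables (F : numFieldType) (s : F).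
Hypotheses (q_neq0 : qq s != 0) (q_not_root : forall m : nat, (0 < m)%N -> qq s ^+ m != 1).

Lemma not_root_kk_neq0 : kk s != 0.
Proof.
apply: contraNneq (q_not_root (m := 2) isT) => /subr0_eq e.
by rewrite expr2 {1}e mulVf.
Qed.

(** If t = s^|m| satisfies t + t^-1 = 0, then t^2 = -1 and t^4 = 1, that is q^(2|m|) = 1. For m = 0
    the sum is 2, nonzero in characteristic 0. *)
Lemma not_root_add_inv_neq0 (m : int) : s ^ m + (s ^ m)^-1 != 0.
Proof.
have s_neq0 : s != 0 by apply: contraNneq q_neq0 => ->; rewrite /qq expr0n.
have [->|m0] := eqVneq m 0.
  by rewrite expr0z invr1 -[1 + 1]/(2%:R) pnatr_eq0.
have t0 : s ^ m != 0 by rewrite expfz_neq0.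
have m2 : (0 < 2 * `|m|)%N by lia.
apply: contraNneq (q_not_root m2) => e; set t := s ^+ `|m|%N.
have {}e : t + t^-1 = 0.
  by move: e; rewrite /t; case: (m) => a //; rewrite /exprz /= invrK addrC.
have tt : t * t = -1.
  by move/eqP: e; rewrite addr_eq0 => /eqP e; rewrite {2}e mulrN mulfV // expf_neq0.
by rewrite /qq -exprM mulnA mulnC exprM -/t (exprM t 2 2) [t ^+ 2]expr2 tt sqrrN expr1n.
Qed.

End NotRootOfUnity.

Theorem theorem1 (R : realType) (N : nat) (hN : (3 <= N)%N)
    (q s : R[i]) (q_neq0 : q != 0)
    (q_not_root : forall m : nat, (0 < m)%N -> q ^+ m != 1)
    (s_sqr : s ^+ 2 = q)
    (gamma : 'I_N -> R[i])
    (gamma0 : odd N -> forall a : 'I_N, label a = 0 ->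
       gamma a = - (s^-1 * (s - s^-1)^-1))
    (gamma1 : forall a : 'I_N, label a = 1 ->
       gamma a * gamma (rev_ord a) =
         if odd N then - (q^-1 * (s - s^-1) ^- 2) else (q - q^-1) ^- 2)
    (gamma_gt1 : forall a : 'I_N, 1 < label a ->
       gamma a * gamma (rev_ord a) =
         - (q^-1 * (q - q^-1) ^- 2
            * omega N s (label a) * omega N s (label a - 1))) :
  exists phi : {rmorphism cross N s -> qea N s},
    [/\ (forall (c : R[i]) (u : cross N s), phi (c *: u) = c *: phi u),
        (forall a : qea N s, phi (of_qea a) = a)
      & (forall i j : 'I_N,
          phi (of_uqso (LL s i j)) =
            \sum_h \sum_k (metric s i h * metric s k j) *:
              (Lam_inv N s *
                 (lambda s gamma h * xx s k - xx s k * lambda s gamma h)))].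
Proof.
subst q; have s_neq0 : s != 0 by apply: contraNneq q_neq0 => ->; rewrite expr0n.
have k_neq0 := not_root_kk_neq0 q_neq0 q_not_root.
have w_neq0 a : radius_range N a -> omega0 N s a != 0.
  rewrite /omega0 => _; case: ifP => _; last exact: not_root_add_inv_neq0.
  (* The exceptional value s + s^-1 of [omega0] at 0 is the case of exponent 1; the other values
     have exponent [rho2]. *)
  exact: (not_root_add_inv_neq0 q_neq0 q_not_root 1).
have g0 i : label i = 0 -> gamma i = - (s^-1 * (s - s^-1)^-1).
  by move=> l0; apply: gamma0 => //; apply: label0_odd l0.
have [phi [phiZ phiA phiL]] := cross_liftP s_neq0 k_neq0 w_neq0 g0 gamma1 gamma_gt1.
exists phi; split=> [c u|a|i j]; [exact: phiZ|exact: phiA|].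
rewrite phiL; exact: (borel_commutator s_neq0 k_neq0 w_neq0 g0 i j).
Qed.
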